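(* There exist constants $\varepsilon_3>0$ and $C>0$ with the following property. Let $\Omega$ be any open set in $\mathbb{R}^3$. If $u\in L^2_{loc}(\Omega;\mathbb{R}^3)$ is a very weak solution of the stationary Navier-Stokes equations $$-\Delta u+(u\cdot\nabla)u+\nabla p=0,\qquad\operatorname{div}u=0$$ in $\Omega$ (with zero force), and if $\|u\|_{L^{3,\infty}(\Omega)}\le\varepsilon_3$, then $u\in L^\infty_{loc}(\Omega)$ and $$\|u\|_{L^\infty(B(x_0,R))}\le\frac CR\,\|u\|_{L^{3,\infty}(\Omega)}$$ for any ball $B(x_0,2R)\subset\Omega$, where the constant $C$ is independent of $u$ and $R$.
   Context: $B(x_0,R)$ is the open ball of radius $R>0$ centred at $x_0$ in $\mathbb{R}^3$. $L^{3,\infty}$ denotes the weak $L^3$ space, with any fixed standard (quasi-)norm, e.g. $\sup_{\lambda>0}\lambda\,|\{|u|>\lambda\}|^{1/3}$. A vector field $u\in L^2_{loc}(\Omega;\mathbb{R}^3)$ is a very weak solution of the stationary Navier-Stokes equations in $\Omega$ with zero force if $$\int_\Omega u\cdot\nabla\phi\,dx=0\quad\text{for all }\phi\in C^1_c(\Omega)$$ and $$\int_\Omega\Big(-u\cdot\Delta\zeta-\sum_{i,j}u_iu_j\,\partial_i\zeta_j\Big)dx=0\quad\text{for all }\zeta\in C^2_c(\Omega;\mathbb{R}^3)\text{ with }\operatorname{div}\zeta=0.$$ No pressure appears in the definition and no boundary condition is imposed. *)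

(* Defs.v *)
From HB Require Import structures.
From mathcomp Require Import all_boot all_order all_algebra.
From mathcomp Require Import all_classical all_reals all_analysis.

Set Implicit Arguments.
Unset Strict Implicit.
Unset Printing Implicit Defensive.

Import Order.TTheory GRing.Theory Num.Theory.
Import numFieldNormedType.Exports.

Local Open Scope classical_set_scope.
Local Open Scope ring_scope.

(** Points and vectors are elements of [R * R * R], so that the product
    topology and the product measure of the library apply.  The library norm
    on products is the sup norm; lengths and balls are made Euclidean through
    [enorm].  An element of [L^2_loc] is given by a Borel representative; its
    values outside the domain [Omega] are irrelevant. *)
Notation R3 R := (R * R * R)%type.

(** [R3 R] with the measurable structure on which [lebesgue_measure] is
    defined; convertible to [R3 R]. *)
Notation mR3 R :=
  (measurableTypeR R * measurableTypeR R * measurableTypeR R)%type.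

Section euclidean_space.
Context {R : realType}.
Implicit Types (i : 'I_3) (x : R3 R).

Definition xcoord i x : R := tnth [tuple x.1.1; x.1.2; x.2] i.

Definition evec i : R3 R :=
  ((i == 0%N :> nat)%:R, (i == 1%N :> nat)%:R, (i == 2%N :> nat)%:R).

Definition enorm x : R := Num.sqrt (\sum_(i < 3) xcoord i x ^+ 2).

Definition eball x0 (r : R) : set (R3 R) := [set x | enorm (x - x0) < r].

Definition leb3 : {measure set (mR3 R) -> \bar R} :=
  ((@lebesgue_measure R \x @lebesgue_measure R) \x @lebesgue_measure R)%E.

End euclidean_space.

Section differential_operators.
Context {R : realType}.
Implicit Types (i : 'I_3) (f : R3 R -> R) (v : R3 R -> R3 R).

Definition pderiv i f : R3 R -> R := fun x => 'D_(evec i) f x.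

Definition laplacian f : R3 R -> R :=
  fun x => \sum_(i < 3) pderiv i (pderiv i f) x.

Definition vcoord i v : R3 R -> R := fun x => xcoord i (v x).

Definition divergence v : R3 R -> R :=
  fun x => \sum_(i < 3) pderiv i (vcoord i v) x.

Fixpoint class_C (k : nat) f : Prop :=
  continuous f /\
  if k is k'.+1 then
    forall i, (forall x, derivable f x (evec i)) /\ class_C k' (pderiv i f)
  else True.

(** [C^k_c(Omega)]: the functions are extended by zero to the whole space. *)
Definition class_Cc (k : nat) (Omega : set (R3 R)) f : Prop :=
  [/\ class_C k f, compact (closure [set x | f x != 0]) &
      closure [set x | f x != 0] `<=` Omega].

Definition class_Cc_field (k : nat) (Omega : set (R3 R)) v : Prop :=
  forall i, class_Cc k Omega (vcoord i v).

End differential_operators.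

Section function_spaces.
Context {R : realType}.
Implicit Types (Omega B : set (R3 R)) (u : R3 R -> R3 R).

Definition measurable_field Omega u : Prop :=
  forall i : 'I_3, measurable_fun Omega (vcoord i u : mR3 R -> R).

Definition L2_loc Omega u : Prop :=
  measurable_field Omega u /\
  forall K, compact K -> K `<=` Omega ->
    (\int[leb3]_(x in K) (enorm (u x) ^+ 2)%:E < +oo)%E.

Definition weak_L3_norm Omega u : \bar R :=
  ereal_sup [set (l%:E * leb3 (Omega `&` [set x | (l < enorm (u x))%R])
                            `^ 3^-1)%E | l in [set l : R | 0 < l]].

(** The [L^infty(B)] norm is the one, over the whole space, of the extension
    by zero of [u] outside [B]. *)
Definition Linfty_norm B u : \bar R :=
  'N[leb3]_+oo%E [(fun x => (enorm (u x))%:E) \_ B]%E.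

Definition Linfty_loc Omega u : Prop :=
  measurable_field Omega u /\
  forall K, compact K -> K `<=` Omega -> (Linfty_norm K u < +oo)%E.

End function_spaces.

Definition very_weak_solution {R : realType} (Omega : set (R3 R))
    (u : R3 R -> R3 R) : Prop :=
  (forall phi : R3 R -> R, class_Cc 1 Omega phi ->
    (\int[leb3]_(x in Omega)
      (\sum_(i < 3) vcoord i u x * pderiv i phi x)%:E = 0)%E) /\
  (forall zeta : R3 R -> R3 R, class_Cc_field 2 Omega zeta ->
    (forall x, divergence zeta x = 0) ->
    (\int[leb3]_(x in Omega)
      (- (\sum_(i < 3) vcoord i u x * laplacian (vcoord i zeta) x)
       - \sum_(i < 3) \sum_(j < 3)
           vcoord i u x * vcoord j u x
           * pderiv i (vcoord j zeta) x)%:E = 0)%E).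

(* Main.v *)
Require Import Defs.
From HB Require Import structures.
From mathcomp Require Import all_boot all_order all_algebra.
From mathcomp Require Import all_classical all_reals all_analysis.
From mathcomp Require Import measurable_realfun ess_sup_inf lra ring.

(** The bound is obtained by comparing [|u|] with the potential of
    [|u|^2] for the kernel [k(x,y) = 1/|x-y|^2]; smallness in weak [L^3] is what
    makes this comparison contractive.

    Representation.  For a radial function [H] the field
    [zeta = grad (d_k H) - (Lap H) e_k] is divergence free and
    [Lap zeta = grad (d_k Lap H) - (Lap^2 H) e_k].  In the weak equation the
    gradient is invisible to [u], so that [u_k Lap^2 H] and
    [sum u_i u_j d_i zeta_j] have the same integral: no pressure ever appears.
    With [H = sqrt (|y-x|^2 + d^2) / 2] the function [- Lap^2 H] is [15/2]
    times a positive bump [moll d x] of fixed mass concentrating at [x], while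
    [|grad zeta|] is at most a multiple of [k(x,y)].  To give [zeta] compact
    support in the ball of radius [r], a Taylor polynomial in [|y-x|^2] at [r^2]
    is subtracted from the profile; this costs only a bounded error of size
    [r^-3] in [Lap^2 H].
    The outcome, [local_representation], bounds the mean of [u_k] against
    [moll d x] by [C r^-3] times the integral of [|u|] plus [C] times the
    integral of [k(x,.) |u|^2], both over [B(x,r)], uniformly in [d].

    Removal of the mollifier.  Letting [d] tend to [0] turns this into an almost
    everywhere bound for [|u|].  Only an inequality between integrals over
    superlevel sets is needed ([ae_le_of_mollified_le]), and for that it suffices
    that a Borel set and its complement barely overlap after mollification.  The
    sets with this property form a sigma-algebra containing the half-spaces
    ([measurable_overlap_vanishes]).

    Regularity gain.  On [B(x0,S)] put [gap x = S - |x-x0|], take [r = gap x / 2]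
    and consider [f = gap |u|].  Since [gap] varies by a factor at most two on
    [B(x,r)], and since [|u|] has weak [L^3] norm at most [a], the bound becomes
    [f <= C a + C I], where [I] is the integral of [k(x,y) |u(y)| f(y)] over [y].
    Integrating over a set [E], an estimate of the integral of [f] by
    [A |E|^(8/9) + B |E|^(2/3)] reproduces itself with [B] halved when [a] is small
    ([riesz_contraction]); the weak [L^3] norm starts the iteration, and in the
    limit [f] is in weak [L^9] with norm of order [a]
    ([integral_bound_of_subsolution]).  As [2/9 + 2/3 < 1], the potential of [f^2]
    is then bounded ([riesz_potential_square_le]), and inserting this into the
    almost everywhere bound gives [|u| <= C a / S] on [B(x0, 2S/3)]
    ([ae_interior_bound]). *)

Set Implicit Arguments.
Unset Strict Implicit.
Unset Printing Implicit Defensive.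

Import Order.TTheory GRing.Theory Num.Theory.
Import numFieldNormedType.Exports.

Local Open Scope classical_set_scope.
Local Open Scope ring_scope.

(** * Layer-cake estimates with power decay *)

Lemma measurable_superlevel d (T : measurableType d) (R : realType)
    (W : T -> R) (t : R) :
  measurable_fun setT W -> measurable [set x | t < W x].
Proof.
move=> mW; rewrite (_ : [set x | _] = setT `&` W @^-1` `]t, +oo[%classic).
  exact: mW.
by apply/seteqP; split=> x /=; rewrite in_itv/= andbT => //; case.
Qed.

Lemma geometric_nneseries_le (R : realType) (c q : R) :
  0 <= c -> 0 <= q -> q < 1 ->
  (\sum_(n <oo) (c * q ^+ n)%:E <= (c / (1 - q))%:E)%E.
Proof.
move=> c0 q0 q1; apply: lime_le.
  by apply: is_cvg_nneseries => n _ _; rewrite lee_fin mulr_ge0// exprn_ge0.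
near=> n; rewrite sumEFin lee_fin.
have := @geometric_seriesE R c q; rewrite lt_eqF// => /(_ isT)/(congr1 (@^~ n)).
rewrite /series/= big_mkord => ->.
rewrite ler_pM2r ?invr_gt0 ?subr_gt0// -[leRHS]mulr1 ler_wpM2l//.
by rewrite lerBlDr lerDl exprn_ge0.
Unshelve. all: by end_near. Qed.

Lemma dyadic_scale (R : realType) (t : R) : 0 < t ->
  exists n : nat, (2 ^+ n < t /\ t <= 2 ^+ n.+1) \/
                  (2^-1 ^+ n.+1 < t /\ t <= 2^-1 ^+ n).
Proof.
move=> t0; have [t1|t1] := ltP 1 t.
  have [N HN] : exists N : nat, t <= 2 ^+ N.
    exists (Num.bound t); apply/ltW/(lt_trans (archi_boundP (ltW t0))).
    by rewrite -natrX ltr_nat ltn_expl.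
  case: (ex_minnP (ex_intro (fun k => is_true (t <= 2 ^+ k)) N HN)) => -[|m] mt mm.
    by move: mt; rewrite expr0 leNgt t1.
  exists m; left; split=> //; rewrite ltNge; apply/negP => /mm.
  by rewrite ltnn.
have [N HN] : exists N : nat, t > 2^-1 ^+ N.
  exists (Num.bound t^-1); rewrite exprVn -[ltRHS]invrK ltf_pV2 ?posrE ?exprn_gt0 ?invr_gt0//.
  apply/(lt_trans (archi_boundP _)); first by rewrite invr_ge0 ltW.
  by rewrite -natrX ltr_nat ltn_expl.
case: (ex_minnP (ex_intro (fun k => is_true (2^-1 ^+ k < t)) N HN)) => -[|m] mt mm.
  by move: mt; rewrite expr0 ltNge t1.
exists m; right; split=> //; rewrite leNgt; apply/negP => /mm.
by rewrite ltnn.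
Qed.

Lemma integral_mul_indic d (T : measurableType d) (R : realType)
    (mu : {measure set T -> \bar R}) (D E : set T) (f : T -> R) :
  (\int[mu]_(x in D) (f x * \1_E x)%:E = \int[mu]_(x in D `&` E) (f x)%:E)%E.
Proof.
rewrite integral_mkcondr; apply: eq_integral => x _; rewrite patchE indicE.
by case: ifPn => _; rewrite ?mulr1 ?mulr0.
Qed.

Lemma powR_exprn (R : realType) (x a : R) n :
  0 <= x -> (x ^+ n) `^ a = (x `^ a) ^+ n.
Proof.
move=> x0; rewrite -powR_mulrn// -powRrM mulrC powRrM.
by rewrite powR_mulrn// powR_ge0.
Qed.

(** Cut the range of [W] into the dyadic shells [2^n s < W <= 2^(n+1) s], [n]
    ranging over the integers.  On the shell the integrand is at most
    [2^(n+1) s f], so the two decay rates give geometric series of ratios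
    [2^(1 - beta)] upwards and [2^(alpha - 1)] downwards; this is where
    [alpha < 1 < beta] enters. *)
Lemma layer_cake (R : realType) (alpha beta : R) : alpha < 1 -> 1 < beta ->
  exists2 C : R, 0 < C &
  forall d (T : measurableType d) (mu : {measure set T -> \bar R})
    (D : set T) (f W : T -> R) (K s : R),
  measurable D -> measurable_fun setT f -> measurable_fun setT W ->
  (forall x, 0 <= f x) -> (forall x, 0 <= W x) -> 0 <= K -> 0 < s ->
  (forall t, 0 < t -> t <= s ->
    (\int[mu]_(x in D `&` [set x | (t < W x)%R]) (f x)%:E
      <= (K * (s / t) `^ alpha)%:E)%E) ->
  (forall t, s <= t ->
    (\int[mu]_(x in D `&` [set x | (t < W x)%R]) (f x)%:E
      <= (K * (s / t) `^ beta)%:E)%E) ->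
  (\int[mu]_(x in D) (f x * W x)%:E <= (C * K * s)%:E)%E.
Proof.
move=> a1 b1.
pose q1 : R := 2 * 2^-1 `^ beta; pose q2 : R := 2^-1 * 2 `^ alpha.
have q10 : 0 <= q1 by rewrite mulr_ge0// powR_ge0.
have q20 : 0 <= q2 by rewrite mulr_ge0// powR_ge0.
have q11 : q1 < 1.
  rewrite /q1 -ltr_pdivlMl// mulr1 -[ltRHS]powRr1//.
  rewrite lt_neqAle ger_powR ?invr_gt0 ?invf_le1 ?ler1n ?ltr0n// ?(ltW b1)// andbT.
  apply/negP => /eqP/(congr1 (@ln R)); rewrite !ln_powR => /eqP.
  rewrite -subr_eq0 -mulrBl mulf_eq0 subr_eq0 (gt_eqF b1)/= lnV ?posrE// oppr_eq0.
  by rewrite gt_eqF// ln_gt0// ltr1n.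
have q21 : q2 < 1.
  rewrite /q2 mulrC ltr_pdivrMr// mul1r -[ltRHS]powRr1//.
  rewrite lt_neqAle ler_powR ?ler1n// ?(ltW a1)// andbT.
  apply/negP => /eqP/(congr1 (@ln R)); rewrite !ln_powR => /eqP.
  rewrite -subr_eq0 -mulrBl mulf_eq0 subr_eq0 (lt_eqF a1)/=.
  by rewrite gt_eqF// ln_gt0// ltr1n.
exists (2 / (1 - q1) + 2 `^ alpha / (1 - q2)).
  by rewrite addr_gt0// divr_gt0 ?subr_gt0 ?powR_gt0.
move=> d T mu D f W K s mD mf mW f0 W0 K0 s0 Hlo Hhi.
pose E t := D `&` [set x | t < W x].
have mE t : measurable (E t).
  by apply: measurableI => //; exact: measurable_superlevel.
pose c1 n : R := 2 ^+ n.+1 * s.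
pose c2 n : R := 2^-1 ^+ n * s.
have c10 n : 0 <= c1 n by rewrite mulr_ge0// ?ltW// exprn_ge0.
have c20 n : 0 <= c2 n by rewrite mulr_ge0// ?ltW// exprn_ge0// invr_ge0.
pose g1 n x : \bar R := (c1 n * (f x * \1_(E (2 ^+ n * s)) x))%:E.
pose g2 n x : \bar R := (c2 n * (f x * \1_(E (2^-1 ^+ n.+1 * s)) x))%:E.
have g10 n x : (0 <= g1 n x)%E by exact: (mulr_ge0 (c10 n) (mulr_ge0 (f0 x) _)).
have g20 n x : (0 <= g2 n x)%E by exact: (mulr_ge0 (c20 n) (mulr_ge0 (f0 x) _)).
have mg1 n : measurable_fun setT (g1 n).
  by apply/measurable_EFinP/measurable_funM => //; apply/measurable_funM => //; exact: measurable_indic.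
have mg2 n : measurable_fun setT (g2 n).
  by apply/measurable_EFinP/measurable_funM => //; apply/measurable_funM => //; exact: measurable_indic.
have key x : D x -> ((f x * W x)%:E <= \sum_(n <oo) (g1 n x + g2 n x))%E.
  move=> Dx; have [Wx0|Wx0] := eqVneq (W x) 0.
    rewrite Wx0 mulr0; apply: nneseries_ge0 => n _ _.
    by rewrite adde_ge0.
  have Wsx : 0 < W x / s by rewrite divr_gt0// lt0r Wx0 W0.
  have lef n : ((g1 n x + g2 n x) <= \sum_(n <oo) (g1 n x + g2 n x))%E.
    apply: (@le_trans _ _ (\sum_(0 <= i < n.+1) (g1 i x + g2 i x))%E).
      rewrite big_nat_recr//= leeDr// sume_ge0// => i _; exact: adde_ge0.
    by apply: nneseries_lim_ge => i _ _; rewrite adde_ge0.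
  have [n [[]|[]]] := dyadic_scale Wsx.
    rewrite ltr_pdivlMr// ler_pdivrMr// => h1 h2.
    apply: le_trans (lef n); rewrite -[leLHS]adde0; apply: leeD => //.
    rewrite lee_fin indicE mem_set//= mulr1 mulrC ler_wpM2r//.
  rewrite ltr_pdivlMr// ler_pdivrMr// => h1 h2.
  apply: le_trans (lef n); rewrite -[leLHS]add0e; apply: leeD => //.
  by rewrite lee_fin indicE mem_set//= mulr1 mulrC ler_wpM2r.
have I1 t c : (0 <= c)%R -> (\int[mu]_(x in D) (c * (f x * \1_(E t) x))%:E =
    c%:E * \int[mu]_(x in E t) (f x)%:E)%E.
  move=> c0; under eq_integral do rewrite EFinM.
  rewrite ge0_integralZl//; last 2 first.
  - by apply/measurable_EFinP/measurable_funM => //; exact: measurable_funTS.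
  - by move=> x _; rewrite lee_fin mulr_ge0.
  by rewrite integral_mul_indic /E setIA setIid.
apply: (@le_trans _ _ (\int[mu]_(x in D) \sum_(n <oo) (g1 n x + g2 n x))%E).
  apply: ge0_le_integral => //.
  - by move=> x _; rewrite lee_fin mulr_ge0.
  - apply/measurable_EFinP/measurable_funTS/measurable_funM => //.
  - apply: ge0_emeasurable_sum => //.
    + by move=> n x _ _; rewrite adde_ge0.
    + by move=> n _; apply: measurable_funTS; exact: emeasurable_funD.
rewrite integral_nneseries//; last 2 first.
- by move=> n; apply: measurable_funTS; exact: emeasurable_funD.
- by move=> n x _; rewrite adde_ge0.
apply: (@le_trans _ _ (\sum_(n <oo) ((K * s * 2 * q1 ^+ n)%:E + (K * s * 2 `^ alpha * q2 ^+ n)%:E))%E).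
  apply: lee_nneseries => [n _ _|n _].
    by apply: integral_ge0 => x _; rewrite adde_ge0.
  rewrite ge0_integralD//; [|exact: measurable_funTS..].
  apply: leeD.
    rewrite I1//; apply: (@le_trans _ _ ((c1 n)%:E * (K * (s / (2 ^+ n * s)) `^ beta)%:E)%E).
      rewrite lee_wpmul2l ?lee_fin//; apply: Hhi.
      by rewrite -[leLHS]mul1r ler_pM2r// exprn_ege1// ler1n.
    rewrite -EFinM lee_fin /c1 le_eqVlt; apply/orP; left; apply/eqP.
    have -> : s / (2 ^+ n * s) = 2^-1 ^+ n.
      by rewrite invfM mulrCA mulfV ?gt_eqF// mulr1 exprVn.
    by rewrite powR_exprn// /q1 exprMn exprS; ring.
  rewrite I1//; apply: (@le_trans _ _ ((c2 n)%:E * (K * (s / (2^-1 ^+ n.+1 * s)) `^ alpha)%:E)%E).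
    rewrite lee_wpmul2l ?lee_fin//; apply: Hlo; first by rewrite mulr_gt0// exprn_gt0.
    by rewrite -[leRHS]mul1r ler_pM2r// exprn_ile1// invf_le1// ler1n.
  rewrite -EFinM lee_fin /c2 le_eqVlt; apply/orP; left; apply/eqP.
  have -> : s / (2^-1 ^+ n.+1 * s) = 2 ^+ n.+1.
    by rewrite invfM mulrCA mulfV ?gt_eqF// mulr1 exprVn invrK.
  by rewrite powR_exprn// /q2 exprMn [(2 `^ alpha) ^+ n.+1]exprS; ring.
have Ks0 : 0 <= K * s * 2 by rewrite !mulr_ge0// ltW.
have Ks1 : 0 <= K * s * 2 `^ alpha by rewrite !mulr_ge0// ?powR_ge0// ltW.
rewrite nneseriesD//; last 2 first.
- by move=> n _ _; rewrite lee_fin mulr_ge0// exprn_ge0.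
- by move=> n _ _; rewrite lee_fin mulr_ge0// exprn_ge0.
apply: (@le_trans _ _ ((K * s * 2 / (1 - q1))%:E + (K * s * 2 `^ alpha / (1 - q2))%:E)%E).
  by apply: leeD; apply: geometric_nneseries_le.
by rewrite -EFinD lee_fin le_eqVlt; apply/orP; left; apply/eqP; ring.
Qed.

Ltac pos := repeat first [ assumption | apply: mulr_gt0 | apply: divr_gt0
  | apply: powR_gt0 | rewrite invr_gt0 | apply: exprn_gt0 | by rewrite ltr0n | by rewrite ltr01 | lra ].

(** Equalities between products of real powers of positive reals are linear
    identities between their logarithms. *)
Ltac lnfield := apply: ln_inj; [by rewrite posrE; pos | by rewrite posrE; pos |];
  repeat first [ rewrite lnM; [|by rewrite posrE; pos|by rewrite posrE; pos]
  | rewrite ln_powR | rewrite lnV; [|by rewrite posrE; pos]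
  | rewrite lnXn; [|by pos] ]; by field.

(** * Distribution functions and integrals over small sets *)

Section weak_lebesgue_spaces.
Context d (T : measurableType d) (R : realType).
Implicit Types (D E F : set T) (f V : T -> R) (A a b m s t v M : R).

Lemma measure_real (mu : {measure set T -> \bar R}) E v :
  (mu E <= v%:E)%E -> exists2 p : R, 0 <= p & mu E = p%:E.
Proof.
move=> Ev; have Efin : mu E \is a fin_num.
  by rewrite ge0_fin_numE// (le_lt_trans Ev)// ltry.
by exists (fine (mu E)); rewrite ?fine_ge0// fineK.
Qed.

Lemma integral_one (mu : {measure set T -> \bar R}) E : measurable E ->
  (\int[mu]_(x in E) (1%R)%:E = mu E)%E.
Proof. by move=> mE; rewrite integral_cst// mul1e. Qed.

(** The layer cake at the level [a m^(-1/3)], where the trivial bound [m] for the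
    measure of a superlevel set of [V] inside [E] meets the weak [L^3] bound. *)
Lemma integral_weak_L3_le : exists2 C : R, 0 < C &
  forall (mu : {measure set T -> \bar R}) D V a,
  measurable D -> measurable_fun setT V -> (forall x, 0 <= V x) -> 0 < a ->
  (forall s, 0 < s ->
    (mu (D `&` [set x | (s < V x)%R]) <= ((a / s) `^ 3)%:E)%E) ->
  forall E m, measurable E -> E `<=` D -> 0 < m -> (mu E <= m%:E)%E ->
  (\int[mu]_(x in E) (V x)%:E <= (C * a * m `^ (2 / 3))%:E)%E.
Proof.
have [C C0 HC] := @layer_cake R 0 3 ltr01 (ltac:(lra)).
exists C => // mu D V a mD mV V0 a0 weak E m mE ED m0 Em.
have mEt t : measurable (E `&` [set x | t < V x]).
  by apply: measurableI => //; exact: measurable_superlevel.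
have -> : C * a * m `^ (2 / 3) = C * m * (a * m `^ (- (1 / 3))).
  by lnfield.
under eq_integral do rewrite -[V _]mul1r.
have s0 : 0 < a * m `^ (- (1 / 3)) by rewrite mulr_gt0 ?powR_gt0.
apply: HC => //; first exact: ltW.
- move=> t t0 _; rewrite integral_one// powRr0 mulr1 (le_trans _ Em)//.
  by apply: le_measure; rewrite ?inE//; exact: subIsetl.
- move=> t st; have t0 : 0 < t by rewrite (lt_le_trans s0).
  rewrite integral_one// (_ : m * _ = (a / t) `^ 3).
    apply: le_trans (weak t t0); apply: le_measure; rewrite ?inE//.
    + by apply: measurableI => //; exact: measurable_superlevel.
    + exact: setSI.
  by lnfield.
Qed.

(** Absorbs the power of [p] on the right: this is how a bound for an integral
    over a superlevel set becomes a bound for its measure. *)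
Lemma powR_le_swap (p q c e : R) : 0 <= p -> 0 < c -> 0 < e -> e < 1 ->
  p <= c * p `^ e -> p <= c `^ (1 - e)^-1.
Proof.
move=> p0 c0 e0 e1 h; have [->|pn0] := eqVneq p 0; first exact: powR_ge0.
have pp : 0 < p by rewrite lt0r pn0.
have : p `^ (1 - e) <= c.
  rewrite powRB ?pn0 ?implybT// powRr1//.
  by rewrite ler_pdivrMr ?powR_gt0.
move=> h2; have : (p `^ (1 - e)) `^ (1 - e)^-1 <= c `^ (1 - e)^-1.
  apply: ge0_ler_powR; rewrite ?nnegrE ?powR_ge0//; first by rewrite invr_ge0; lra.
  exact: ltW.
by rewrite -powRrM mulfV ?powRr1//; lra.
Qed.

(** Converse of the passage from weak type to integrals over small sets: the
    hypothesis is applied to the superlevel set itself, on which [f > s]. *)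
Lemma distribution_le_of_integral_le (mu : {measure set T -> \bar R}) D f A e v :
  measurable D -> (mu D <= v%:E)%E -> measurable_fun setT f ->
  0 < A -> 0 < e -> e < 1 ->
  (forall E m, measurable E -> E `<=` D -> 0 < m -> (mu E <= m%:E)%E ->
    (\int[mu]_(x in E) (f x)%:E <= (A * m `^ e)%:E)%E) ->
  forall s, 0 < s ->
  (mu (D `&` [set x | (s < f x)%R]) <= ((A / s) `^ (1 - e)^-1)%:E)%E.
Proof.
move=> mD Dv mf A0 e0 e1 H s s0; set E := D `&` _.
have mE : measurable E by apply: measurableI => //; exact: measurable_superlevel.
have ED : E `<=` D by exact: subIsetl.
have [p p0 Ep] : exists2 p : R, 0 <= p & mu E = p%:E.
  by apply: (@measure_real _ _ v); rewrite (le_trans _ Dv)// le_measure ?inE.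
rewrite Ep lee_fin; have [->|pn0] := eqVneq p 0; first exact: powR_ge0.
have pp : 0 < p by rewrite lt0r pn0.
have h := H E p mE ED pp (ltac:(by rewrite Ep)).
apply: powR_le_swap => //; rewrite ?divr_gt0//.
rewrite mulrAC ler_pdivlMr// mulrC -lee_fin.
apply: le_trans h; rewrite EFinM -Ep -integral_cst//.
apply: ge0_le_integral => //.
- by move=> x _; rewrite lee_fin ltW.
- exact/measurable_EFinP/measurable_funTS.
- by move=> x [_ /= /ltW]; rewrite lee_fin.
Qed.

End weak_lebesgue_spaces.

(** * Kernels of Riesz type and their potentials *)

(** The only facts about [1/|x-y|^2] that the potential theory below uses; [8] is
    the ratio of the volume of a cube to the cube of its half side. *)
Definition riesz_kernel d (T : measurableType d) (R : realType)
    (mu : set T -> \bar R) (k : T * T -> R) :=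
  [/\ measurable_fun setT k, forall z, 0 <= k z,
      forall x y, k (x, y) = k (y, x) &
      forall x t, 0 < t ->
        (mu [set y | (t < k (x, y))%R] <= (8 * t^-1 `^ (3 / 2))%:E)%E].

Lemma riesz_section_measurable d (T : measurableType d) (R : realType)
    (mu : set T -> \bar R) (k : T * T -> R) x :
  riesz_kernel mu k -> measurable_fun setT (fun y => k (x, y)).
Proof. by case=> mk _ _ _; apply: measurableT_comp => //; exact: pair1_measurable. Qed.

(** The layer cake at the level [(8/m)^(2/3)], above which the superlevel sets of
    [k(x,.)] are smaller than [F]. *)
Lemma riesz_kernel_integral_le (R : realType) : exists2 C : R, 0 < C &
  forall d (T : measurableType d) (mu : {measure set T -> \bar R}) k (F : set T) (m : R),
  riesz_kernel mu k -> measurable F -> 0 < m -> (mu F <= m%:E)%E ->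
  forall x, (\int[mu]_(y in F) (k (x, y))%:E <= (C * m `^ (1 / 3))%:E)%E.
Proof.
have [C C0 HC] := @layer_cake R 0 (3 / 2) ltr01 (ltac:(lra)).
exists (C * 8 `^ (2 / 3)); first by pos.
move=> d T mu k F m rk mF m0 Fm x; have [mk k0 ksym kw] := rk.
have mkx := riesz_section_measurable x rk.
under eq_integral do rewrite -[k _]mul1r.
have -> : C * 8 `^ (2 / 3) * m `^ (1 / 3) = C * m * (8 / m) `^ (2 / 3) by lnfield.
have s0 : 0 < (8 / m) `^ (2 / 3) by pos.
have mEt t : measurable (F `&` [set y | t < k (x, y)]).
  by apply: measurableI => //; exact: measurable_superlevel.
apply: HC => //; first exact: ltW.
- move=> t t0 _; rewrite integral_one// powRr0 mulr1 (le_trans _ Fm)//.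
  by apply: le_measure; rewrite ?inE//; exact: subIsetl.
- move=> t st; have t0 : 0 < t by rewrite (lt_le_trans s0).
  rewrite integral_one// (_ : m * _ = 8 * t^-1 `^ (3 / 2)); last by lnfield.
  apply: le_trans (kw x t t0); apply: le_measure; rewrite ?inE//.
  exact: measurable_superlevel.
Qed.

Section riesz_potential.
Context d (T : measurableType d) (R : realType).
Variable mu : {sigma_finite_measure set T -> \bar R}.
Implicit Types (D E F : set T) (f V : T -> R) (A a b m s t v M : R)
  (k : T * T -> R).

(** Real valued, for use in products and superlevel sets; the integral is finite
    whenever [F] has finite measure, see [riesz_potentialE]. *)
Definition riesz_potential k F y := fine (\int[mu]_(x in F) (k (y, x))%:E)%E.

Lemma measurable_ge0_parameter_integral (h : T * T -> R) F :
  measurable F -> measurable_fun setT h -> (forall z, 0 <= h z) ->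
  measurable_fun setT (fun x => \int[mu]_(y in F) (h (x, y))%:E)%E.
Proof.
move=> mF mh h0; pose h' z : \bar R := (h z * \1_F z.2)%:E.
have mh' : measurable_fun setT h'.
  apply/measurable_EFinP/measurable_funM => //.
  by apply: measurableT_comp => //; exact: measurable_indic.
have h'0 z : (0 <= h' z)%E by rewrite lee_fin mulr_ge0.
have := @measurable_fun_fubini_tonelli_F _ _ _ _ _ mu _ mh' h'0.
apply: eq_measurable_fun => x _; rewrite /fubini_F /h'/= .
by rewrite (@integral_mul_indic _ _ _ mu setT F (fun y => h (x, y))) setTI.
Qed.

Lemma tonelli_swap (h : T * T -> R) E F : measurable E -> measurable F ->
  measurable_fun setT h -> (forall z, 0 <= h z) ->
  (\int[mu]_(x in E) \int[mu]_(y in F) (h (x, y))%:E =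
   \int[mu]_(y in F) \int[mu]_(x in E) (h (x, y))%:E)%E.
Proof.
move=> mE mF mh h0; pose h' z : \bar R := (h z * \1_E z.1 * \1_F z.2)%:E.
have mh' : measurable_fun setT h'.
  apply/measurable_EFinP/measurable_funM => //; last first.
    by apply: measurableT_comp => //; exact: measurable_indic.
  apply/measurable_funM => //.
  by apply: measurableT_comp => //; exact: measurable_indic.
have h'0 z : (0 <= h' z)%E by rewrite lee_fin !mulr_ge0.
have := @fubini_tonelli _ _ _ _ _ mu mu _ mh' h'0.
rewrite /fubini_F /fubini_G /h'/= => H.
rewrite [LHS]integral_mkcond [RHS]integral_mkcond.
transitivity (\int[mu]_x \int[mu]_y (h (x, y) * \1_E x * \1_F y)%:E)%E.
  apply: eq_integral => x _; rewrite patchE; case: ifPn => xE.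
    rewrite -[F in LHS]setTI -(integral_mul_indic mu setT F (fun y => h (x, y))).
    by apply: eq_integral => y _; rewrite [\1_E x]indicE xE mulr1.
  by rewrite integral0_eq// => y _; rewrite indicE (negbTE xE) mulr0 mul0r.
rewrite H; apply: eq_integral => y _; rewrite patchE; case: ifPn => yF.
  rewrite -[E in RHS]setTI -(integral_mul_indic mu setT E (fun x => h (x, y))).
  by apply: eq_integral => x _; rewrite [\1_F y]indicE yF mulr1.
by rewrite integral0_eq// => x _; rewrite [\1_F y]indicE (negbTE yF) mulr0.
Qed.

Lemma riesz_potentialE k F v y : riesz_kernel mu k -> measurable F ->
  (mu F <= v%:E)%E ->
  (riesz_potential k F y)%:E = (\int[mu]_(x in F) (k (y, x))%:E)%E.
Proof.
move=> rk mF Fv; have [C C0 HC] := riesz_kernel_integral_le R.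
have v0 : 0 <= v by rewrite -lee_fin (le_trans _ Fv).
have h : (mu F <= (v + 1)%:E)%E by rewrite (le_trans Fv)// lee_fin lerDl.
have w0 : 0 < v + 1 by lra.
rewrite /riesz_potential fineK// ge0_fin_numE; last first.
  by apply: integral_ge0 => x _; rewrite lee_fin; case: rk.
by rewrite (le_lt_trans (HC _ _ _ _ _ _ rk mF w0 h y))// ltry.
Qed.

Lemma riesz_potential_measurable k F : riesz_kernel mu k -> measurable F ->
  measurable_fun setT (riesz_potential k F).
Proof.
move=> [mk k0 ksym kw] mF; rewrite /riesz_potential.
apply: measurableT_comp; first exact: fine_measurable.
exact: measurable_ge0_parameter_integral.
Qed.

(** For the superlevel set [G], integrating the potential of [F] over [G] and
    exchanging the integrals shows [t |G| <= C m |G|^(1/3)]. *)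
Lemma riesz_potential_distribution : exists2 C : R, 0 < C &
  forall k D F v m, riesz_kernel mu k -> measurable D -> (mu D <= v%:E)%E ->
  measurable F -> 0 < m -> (mu F <= m%:E)%E ->
  (forall y, riesz_potential k F y <= C * m `^ (1 / 3)) /\
  forall t, 0 < t -> (mu (D `&` [set y | (t < riesz_potential k F y)%R]) <=
     ((C * m / t) `^ (3 / 2))%:E)%E.
Proof.
have [C C0 HC] := riesz_kernel_integral_le R.
exists C => // k D F v m rk mD Dv mF m0 Fm; have [mk k0 ksym kw] := rk; split.
  move=> y; rewrite -lee_fin (riesz_potentialE _ rk mF Fm).
  exact: (HC _ _ _ _ _ _ rk mF m0 Fm y).
move=> t t0; set G := D `&` _.
have mg := riesz_potential_measurable rk mF.
have mG : measurable G by apply: measurableI => //; exact: measurable_superlevel.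
have [p p0 Gp] : exists2 p : R, 0 <= p & mu G = p%:E.
  apply: (@measure_real _ _ _ _ _ v); rewrite (le_trans _ Dv)// le_measure ?inE//.
  exact: subIsetl.
rewrite Gp lee_fin; have [->|pn0] := eqVneq p 0; first exact: powR_ge0.
have pp : 0 < p by rewrite lt0r pn0.
have -> : (3 / 2 : R) = (1 - 1 / 3)^-1 by field.
apply: powR_le_swap => //; [by pos|lra|].
rewrite mulrAC ler_pdivlMr// mulrC -lee_fin EFinM -Gp -integral_cst//.
apply: (@le_trans _ _ (\int[mu]_(y in G) (riesz_potential k F y)%:E)%E).
  apply: ge0_le_integral => //.
  - by move=> x _; rewrite lee_fin ltW.
  - exact/measurable_EFinP/measurable_funTS.
  - by move=> x [_ /= /ltW]; rewrite lee_fin.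
under eq_integral do rewrite (riesz_potentialE _ rk mF Fm).
rewrite tonelli_swap//.
apply: (@le_trans _ _ (\int[mu]_(x in F) (C * p `^ (1 / 3))%:E)%E).
  apply: ge0_le_integral => //.
  - by move=> x _; apply: integral_ge0 => y _; rewrite lee_fin.
  - apply: measurable_funTS.
    under eq_fun do under eq_integral do rewrite ksym.
    exact: measurable_ge0_parameter_integral.
  - move=> x _; under eq_integral do rewrite ksym.
    by apply: (HC _ _ _ _ _ _ rk mG pp _); rewrite -Gp.
rewrite integral_cst// (_ : C * m * _ = C * p `^ (1 / 3) * m); last by ring.
by rewrite [leRHS]EFinM lee_pmul2l// lte_fin; pos.
Qed.

End riesz_potential.

(** * Regularity gain for subsolutions of the potential inequality *)

Section riesz_contraction.
Context d (T : measurableType d) (R : realType).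
Variable mu : {sigma_finite_measure set T -> \bar R}.
Implicit Types (D E F : set T) (f V : T -> R) (A a b m s t v M : R)
  (k : T * T -> R).

(** The product of [V] with the potential [g] of a set of measure [m] has size
    about [C a] on a set of measure [m].  Where it exceeds [t], either [V > s0]
    or [g > t / s0], and [s0] is chosen to balance the two weak bounds; this
    controls small [t].  For large [t] the bound [g <= C m^(1/3)] leaves only the
    decay of [V]. *)
Lemma superlevel_mul_distribution : exists2 C : R, 0 < C &
  forall k D V v a F m, riesz_kernel mu k -> measurable D -> (mu D <= v%:E)%E ->
  measurable_fun setT V -> (forall x, 0 <= V x) -> 0 < a ->
  (forall s, 0 < s ->
    (mu (D `&` [set x | (s < V x)%R]) <= ((a / s) `^ 3)%:E)%E) ->
  measurable F -> 0 < m -> (mu F <= m%:E)%E ->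
  (forall t, 0 < t ->
    (mu (D `&` [set x | (t < V x * riesz_potential mu k F x)%R])
     <= (2 * m * (C * a / t))%:E)%E) /\
  (forall t, 0 < t ->
    (mu (D `&` [set x | (t < V x * riesz_potential mu k F x)%R])
     <= (m * (C * a / t) `^ 3)%:E)%E).
Proof.
have [C C0 HC] := riesz_potential_distribution mu.
exists C => // k D V v a F m rk mD Dv mV V0 a0 weak mF m0 Fm.
have [gle gdist] := HC k D F v m rk mD Dv mF m0 Fm.
have mg := riesz_potential_measurable rk mF.
have mVg : measurable_fun setT (fun x => V x * riesz_potential mu k F x).
  exact: measurable_funM.
have mlev (h : T -> R) t : measurable_fun setT h ->
    measurable (D `&` [set x | t < h x]).
  by move=> mh; apply: measurableI => //; exact: measurable_superlevel.
have g0 x : 0 <= riesz_potential mu k F x.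
  rewrite /riesz_potential fine_ge0// integral_ge0// => y _.
  by rewrite lee_fin; case: rk.
split=> t t0.
  (* the level of [V] at which the two weak bounds below coincide *)
  pose s0 := a * m `^ (- (1 / 3)) * (t / (C * a)) `^ (1 / 3).
  have s00 : 0 < s0 by rewrite /s0; pos.
  apply: (@le_trans _ _ (mu ((D `&` [set x | (s0 < V x)%R]) `|`
      (D `&` [set x | (t / s0 < riesz_potential mu k F x)%R])))).
    apply: le_measure; rewrite ?inE//; [exact: mlev|by apply: measurableU; exact: mlev|].
    move=> x [Dx /= tx]; have [Vs|Vs] := ltP s0 (V x); first by left.
    right; split=> //=; rewrite ltr_pdivrMr// (lt_le_trans tx)// mulrC ler_wpM2l//.
  apply: (le_trans (measureU2 _ _ _)); [exact: mlev|exact: mlev|].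
  have -> : 2 * m * (C * a / t) = (a / s0) `^ 3 + (C * m / (t / s0)) `^ (3 / 2).
    have -> : (a / s0) `^ 3 = m * (C * a / t) by rewrite /s0; lnfield.
    have -> : (C * m / (t / s0)) `^ (3 / 2) = m * (C * a / t) by rewrite /s0; lnfield.
    by ring.
  by rewrite EFinD; apply: leeD; [exact: weak|apply: gdist; pos].
have c0 : 0 < C * m `^ (1 / 3) by pos.
apply: (@le_trans _ _ (mu (D `&` [set x | (t / (C * m `^ (1 / 3)) < V x)%R]))).
  apply: le_measure; rewrite ?inE//; [exact: mlev|exact: mlev|].
  move=> x [Dx /= tx]; split=> //=; rewrite ltr_pdivrMr// (lt_le_trans tx)//.
  by rewrite ler_wpM2l.
have -> : m * (C * a / t) `^ 3 = (a / (t / (C * m `^ (1 / 3)))) `^ 3 by lnfield.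
by apply: weak; pos.
Qed.

(** Exchanging the integrals leaves the integral of [f] against [W = V g], with [g]
    the potential of [F].  By [superlevel_mul_distribution] the superlevel sets of
    [W] are small, and the hypothesis on [f] applied to them is the input of the
    layer cake: below the level [C1 a] the measure decays like [1/t], giving the
    exponent [8/9 < 1], above it like [t^-3], giving [3 * 2/3 = 2 > 1]. *)
Lemma riesz_contraction : exists2 C : R, 0 < C &
  forall k D V f v a A B, riesz_kernel mu k -> measurable D -> (mu D <= v%:E)%E ->
  measurable_fun setT V -> (forall x, 0 <= V x) -> 0 < a ->
  (forall s, 0 < s ->
    (mu (D `&` [set x | (s < V x)%R]) <= ((a / s) `^ 3)%:E)%E) ->
  measurable_fun setT f -> (forall x, 0 <= f x) -> 0 <= A -> 0 <= B ->
  (forall E m, measurable E -> E `<=` D -> 0 < m -> (mu E <= m%:E)%E ->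
    (\int[mu]_(x in E) (f x)%:E <= (A * m `^ (8 / 9) + B * m `^ (2 / 3))%:E)%E) ->
  forall F m, measurable F -> 0 < m -> (mu F <= m%:E)%E ->
  (\int[mu]_(x in F) \int[mu]_(y in D) (k (x, y) * (V y * f y))%:E <=
    (C * a * (A * m `^ (8 / 9) + B * m `^ (2 / 3)))%:E)%E.
Proof.
have [C1 C10 HC1] := superlevel_mul_distribution.
have [C C0 HC] := @layer_cake R (8 / 9) 2 (ltac:(lra)) (ltac:(lra)).
exists (C * 2 * C1); first by pos.
move=> k D V f v a A B rk mD Dv mV V0 a0 weak mf f0 A0 B0 Hf F m mF m0 Fm.
have [mk k0 ksym kw] := rk.
have mg := riesz_potential_measurable rk mF.
have mVg : measurable_fun setT (fun x => V x * riesz_potential mu k F x).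
  exact: measurable_funM.
have g0 x : 0 <= riesz_potential mu k F x.
  rewrite /riesz_potential fine_ge0// integral_ge0// => y _.
  by rewrite lee_fin.
have mVf : measurable_fun setT (fun y => V y * f y) by exact: measurable_funM.
have mh : measurable_fun setT (fun z : T * T => k z * (V z.2 * f z.2)).
  apply: measurable_funM => //.
  exact: (measurableT_comp mVf measurable_snd).
rewrite (@tonelli_swap _ _ _ _ (fun z => k z * (V z.2 * f z.2)))//; last first.
  by move=> z; rewrite !mulr_ge0.
have [dlo dhi] := HC1 k D V v a F m rk mD Dv mV V0 a0 weak mF m0 Fm.
pose S := A * m `^ (8 / 9) + B * m `^ (2 / 3).
have S0 : 0 <= S by rewrite addr_ge0// mulr_ge0// powR_ge0.
have s0 : 0 < C1 * a by pos.
rewrite (_ : C * 2 * C1 * a * _ = C * (2 * S) * (C1 * a)); last by rewrite /S; ring.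
rewrite (eq_integral (fun y => (f y * (V y * riesz_potential mu k F y))%:E)); last first.
  move=> y _; rewrite mulrA [f y * _]mulrC EFinM (riesz_potentialE _ rk mF Fm).
  rewrite -ge0_integralZl_EFin//; last 3 first.
  - by move=> x _; rewrite lee_fin.
  - by apply/measurable_EFinP/measurable_funTS; exact: riesz_section_measurable rk.
  - by rewrite mulr_ge0.
  by apply: eq_integral => x _; rewrite /= -EFinM mulrC ksym.
have mlev t : measurable (D `&` [set x | t < V x * riesz_potential mu k F x]).
  by apply: measurableI => //; exact: measurable_superlevel.
apply: HC => //; [by move=> x; rewrite mulr_ge0|by rewrite mulr_ge0| |].
  move=> t t0 ts; set r := C1 * a / t.
  have r1 : 1 <= r by rewrite /r ler_pdivlMr// mul1r.
  have r0 : 0 < r by rewrite (lt_le_trans ltr01).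
  apply: le_trans (Hf _ _ (mlev t) (@subIsetl _ _ _) _ (dlo t t0)) _; first by rewrite -/r; pos.
  rewrite lee_fin -/r /S mulrDr mulrDl.
  move: r r0 r1 => r r0 r1.
  have aux (e : R) : 0 < e -> e <= 8 / 9 ->
      (2 * m * r) `^ e <= 2 * m `^ e * r `^ (8 / 9).
    move=> e0 e1; rewrite !powRM ?mulr_ge0// ?(ltW m0)// ?(ltW r0)//.
    apply: ler_pM; rewrite ?mulr_ge0 ?powR_ge0//; last exact: ler_powR.
    by rewrite ler_wpM2r ?powR_ge0// ler1_powR ?ler1n//; lra.
  by apply: lerD; rewrite mulrCA -!mulrA ler_wpM2l// !mulrA; apply: aux; lra.
move=> t st; have t0 : 0 < t by rewrite (lt_le_trans s0).
set r := C1 * a / t.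
have r0 : 0 < r by rewrite /r; pos.
have r1 : r <= 1 by rewrite /r ler_pdivrMr// mul1r.
apply: le_trans (Hf _ _ (mlev t) (@subIsetl _ _ _) _ (dhi t t0)) _; first by rewrite -/r; pos.
rewrite lee_fin -/r /S mulrDr mulrDl.
have aux (e : R) : 2 / 3 <= e -> (m * r `^ 3) `^ e <= 2 * m `^ e * r `^ 2.
  move=> e1; rewrite powRM ?powR_ge0 ?(ltW m0)// -powRrM.
  apply: ler_pM; rewrite ?mulr_ge0 ?powR_ge0//.
    by rewrite -[leLHS]mul1r ler_wpM2r ?powR_ge0// ler1n.
  by apply: ger_powR; [rewrite r0|lra].
by apply: lerD; rewrite mulrCA -!mulrA ler_wpM2l// !mulrA; apply: aux; lra.
Qed.

(** Inserting the subsolution inequality into itself: [riesz_contraction] halves the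
    coefficient of [m^(2/3)], and the constant [M] contributes
    [M |E| <= M v^(1/9) m^(8/9)].  The weak [L^3] bound on [f] only starts the
    iteration, so its constant [b] disappears in the limit. *)
Lemma integral_bound_of_subsolution : exists2 C : R, 0 < C &
  forall k D V f v a b M, riesz_kernel mu k -> measurable D -> (mu D <= v%:E)%E ->
  measurable_fun setT V -> (forall x, 0 <= V x) -> 0 < a ->
  (forall s, 0 < s ->
    (mu (D `&` [set x | (s < V x)%R]) <= ((a / s) `^ 3)%:E)%E) ->
  measurable_fun setT f -> (forall x, 0 <= f x) -> 0 < b ->
  (forall s, 0 < s ->
    (mu (D `&` [set x | (s < f x)%R]) <= ((b / s) `^ 3)%:E)%E) ->
  forall kappa, 0 <= kappa -> kappa * C * a <= 2^-1 -> 0 <= M ->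
  {ae mu, forall x, D x -> ((f x)%:E <=
    M%:E + kappa%:E * \int[mu]_(y in D) (k (x, y) * (V y * f y))%:E)%E} ->
  forall E m, measurable E -> E `<=` D -> 0 < m -> (mu E <= m%:E)%E ->
    (\int[mu]_(x in E) (f x)%:E <= (2 * M * v `^ (1 / 9) * m `^ (8 / 9))%:E)%E.
Proof.
have [C C0 HC] := riesz_contraction.
have [C3 C30 HC3] := @integral_weak_L3_le _ T R.
exists C => // k D V f v a b M rk mD Dv mV V0 a0 weakV mf f0 b0 weakf kappa kap0 kapC M0 sub.
have [mk k0 ksym kw] := rk.
pose A := M * v `^ (1 / 9).
have v0 : 0 <= v by rewrite -lee_fin (le_trans _ Dv).
have A0 : 0 <= A by rewrite mulr_ge0// powR_ge0.
have iter n : forall E m, measurable E -> E `<=` D -> 0 < m -> (mu E <= m%:E)%E ->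
    (\int[mu]_(x in E) (f x)%:E <=
      ((2 * A) * m `^ (8 / 9) + (C3 * b / 2 ^+ n) * m `^ (2 / 3))%:E)%E.
  elim: n => [|n IH] E m mE ED m0 Em.
    apply: le_trans (HC3 mu D f b mD mf f0 b0 weakf E m mE ED m0 Em) _.
    by rewrite lee_fin expr0 divr1 lerDr !mulr_ge0// powR_ge0.
  have B0 : 0 <= C3 * b / 2 ^+ n by rewrite divr_ge0 ?exprn_ge0// mulr_ge0// ltW.
  have mVf : measurable_fun setT (fun y => V y * f y) by exact: measurable_funM.
  have mh : measurable_fun setT (fun z : T * T => k z * (V z.2 * f z.2)).
    apply: measurable_funM => //.
    exact: (measurableT_comp mVf measurable_snd).
  have h0 z : 0 <= k z * (V z.2 * f z.2) by rewrite !mulr_ge0.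
  have mI := @measurable_ge0_parameter_integral _ _ _ mu _ D mD mh h0.
  have I0 x : (0 <= \int[mu]_(y in D) (k (x, y) * (V y * f y))%:E)%E.
    by apply: integral_ge0 => y _; rewrite lee_fin; exact: (h0 (x, y)).
  apply: (@le_trans _ _ (\int[mu]_(x in E)
      (M%:E + kappa%:E * \int[mu]_(y in D) (k (x, y) * (V y * f y))%:E))%E).
    apply: ae_ge0_le_integral => //.
    - by move=> x _; rewrite lee_fin.
    - exact/measurable_EFinP/measurable_funTS.
    - by move=> x _; rewrite adde_ge0 ?mule_ge0 ?lee_fin.
    - apply: emeasurable_funD; first exact: measurable_cst.
      by apply: measurable_funeM; exact: measurable_funTS.
    - by apply: filterS sub => x h /ED.
  rewrite ge0_integralD//; last 2 first.
  - by move=> x _; rewrite mule_ge0 ?lee_fin.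
  - by apply: measurable_funeM; exact: measurable_funTS.
  rewrite integral_cst// ge0_integralZl_EFin//; last exact: measurable_funTS.
  have hT := HC k D V f v a (2 * A) _ rk mD Dv mV V0 a0 weakV mf f0 (ltac:(by rewrite mulr_ge0)) B0 IH E m mE m0 Em.
  have hM : (M%:E * mu E <= (A * m `^ (8 / 9))%:E)%E.
    have [p p0 Ep] := measure_real Em.
    rewrite Ep -EFinM lee_fin /A -mulrA ler_wpM2l//.
    have pm : p <= m by rewrite -lee_fin -Ep.
    have pv : p <= v by rewrite -lee_fin -Ep (le_trans _ Dv)// le_measure ?inE.
    have -> : p = p `^ (1 / 9) * p `^ (8 / 9).
      have [->|pn0] := eqVneq p 0; first by rewrite !powR0 ?mulr0//; lra.
      by rewrite -powRD ?pn0 ?implybT// (_ : 1 / 9 + 8 / 9 = 1) ?powRr1//; field.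
    by apply: ler_pM; rewrite ?powR_ge0//; apply: ge0_ler_powR;
      rewrite ?nnegrE ?(ltW m0)//; lra.
  set X := (2 * A) * _ + _ in hT.
  have X0 : 0 <= X by apply: addr_ge0; apply: mulr_ge0; rewrite ?powR_ge0// mulr_ge0.
  apply: (@le_trans _ _ (A * m `^ (8 / 9) + 2^-1 * X)%:E).
    rewrite EFinD; apply: leeD => //.
    apply: (@le_trans _ _ (kappa%:E * (C * a * X)%:E)%E).
      by rewrite lee_wpmul2l// lee_fin.
    by rewrite -EFinM lee_fin !mulrA ler_wpM2r.
  rewrite lee_fin /X exprS invfM le_eqVlt; apply/orP; left; apply/eqP.
  by field; rewrite expf_neq0.
move=> E m mE ED m0 Em.
apply/lee_addgt0Pr => e e0.
pose c := C3 * b * m `^ (2 / 3).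
have c0 : 0 < c by rewrite /c; pos.
have [n Hn] : exists n : nat, c / 2 ^+ n <= e.
  exists (Num.bound (c / e)); rewrite ler_pdivrMr ?exprn_gt0// mulrC -ler_pdivrMr//.
  apply/ltW/(lt_trans (archi_boundP (ltW (divr_gt0 c0 e0)))).
  by rewrite -natrX ltr_nat ltn_expl.
apply: le_trans (iter n E m mE ED m0 Em) _.
rewrite -EFinD lee_fin /A; apply: lerD; first by rewrite !mulrA.
by apply: le_trans Hn; rewrite /c mulrAC.
Qed.

(** By hypothesis [f] is in weak [L^9] and [k(x,.)] in weak [L^(3/2)], so [f k] is
    in weak [L^(9/7)]; integrating [f] over its superlevel sets gives the decay
    [(9/7)(8/9) = 8/7 > 1]. *)
Lemma riesz_potential_square_le : exists2 C : R, 0 < C &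
  forall k D f v M, riesz_kernel mu k -> measurable D -> (mu D <= v%:E)%E -> 0 < v ->
  measurable_fun setT f -> (forall x, 0 <= f x) -> 0 < M ->
  (forall E m, measurable E -> E `<=` D -> 0 < m -> (mu E <= m%:E)%E ->
    (\int[mu]_(x in E) (f x)%:E <= (2 * M * v `^ (1 / 9) * m `^ (8 / 9))%:E)%E) ->
  forall x, (\int[mu]_(y in D) (f y * (f y * k (x, y)))%:E
    <= (C * M ^+ 2 * v `^ (1 / 3))%:E)%E.
Proof.
have [C C0 HC] := @layer_cake R 0 (8 / 7) ltr01 (ltac:(lra)).
(* the sum of the constants of the two distribution bounds below *)
have [N N1 NE] : exists2 N : R, 1 <= N & N = 2 ^+ 9 + 8.
  by exists (2 ^+ 9 + 8) => //; rewrite ler_wpDr// exprn_ege1// ler1n.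
have N0 : 0 < N by lra.
exists (C * (2 * N)); first by pos.
move=> k D f v M rk mD Dv v0 mf f0 M0 Hf x; have [mk k0 ksym kw] := rk.
have A0 : 0 < 2 * M * v `^ (1 / 9) by pos.
have mkx := riesz_section_measurable x rk.
have fdist := distribution_le_of_integral_le mD Dv mf A0 (ltac:(lra) : 0 < 8 / 9) (ltac:(lra)) Hf.
(* for [t < s] the bound on all of [D] is the better one *)
pose s := M * v `^ (- (2 / 3)).
have s0 : 0 < s by rewrite /s; pos.
have -> : C * (2 * N) * M ^+ 2 * v `^ (1 / 3) = C * (2 * N * M * v) * s by rewrite /s; lnfield.
have mW : measurable_fun setT (fun y => f y * k (x, y)) by exact: measurable_funM.
have mlev (h : T -> R) t : measurable_fun setT h ->
    measurable (D `&` [set x | t < h x]).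
  by move=> mh; apply: measurableI => //; exact: measurable_superlevel.
apply: HC => //; [by move=> y; rewrite mulr_ge0|by apply: ltW; pos| |].
  move=> t t0 ts.
  have Dsub := @subIsetl _ D [set y | t < f y * k (x, y)].
  apply: le_trans (Hf _ v (mlev _ t mW) Dsub v0 _) _.
    by rewrite (le_trans _ Dv)// le_measure ?inE//; exact: mlev.
  have -> : 2 * M * v `^ (1 / 9) * v `^ (8 / 9) = 2 * M * v by lnfield.
  by rewrite lee_fin powRr0 mulr1 -!mulrA ler_pM2l// ler_peMl// mulr_ge0// ltW.
move=> t st; have t0 : 0 < t by rewrite (lt_le_trans s0).
pose r := s / t.
have r0 : 0 < r by rewrite /r; pos.
(* the level of [f] at which the weak bounds of [f] and [k] coincide *)
pose l := M * r `^ (- (1 / 7)).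
have l0 : 0 < l by rewrite /l; pos.
have dist : (mu (D `&` [set y | (t < f y * k (x, y))%R]) <= (N * v * r `^ (9 / 7))%:E)%E.
  apply: (@le_trans _ _ (mu ((D `&` [set y | (l < f y)%R]) `|`
      (D `&` [set y | (t / l < k (x, y))%R])))).
    apply: le_measure; rewrite ?inE//; [exact: mlev|by apply: measurableU; exact: mlev|].
    move=> y [Dy /= tx]; have [Vs|Vs] := ltP l (f y); first by left.
    right; split=> //=; rewrite ltr_pdivrMr// (lt_le_trans tx)// mulrC ler_wpM2l//.
  apply: (le_trans (measureU2 _ _ _)); [exact: mlev|exact: mlev|].
  have -> : N * v * r `^ (9 / 7) = (2 * M * v `^ (1 / 9) / l) `^ (1 - 8 / 9)^-1 +
      8 * (t / l)^-1 `^ (3 / 2).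
    have -> : (1 - 8 / 9)^-1 = 9 :> R by field.
    have -> : (2 * M * v `^ (1 / 9) / l) `^ 9 = 2 ^+ 9 * (v * r `^ (9 / 7)).
      rewrite /l; lnfield.
    have -> : (t / l)^-1 `^ (3 / 2) = v * r `^ (9 / 7).
      rewrite /l /r /s; lnfield.
    by rewrite NE; ring.
  rewrite EFinD; apply: leeD; first exact: fdist.
  apply: le_trans (kw x (t / l) _); last by pos.
  apply: le_measure; rewrite ?inE//; [exact: mlev|exact: measurable_superlevel].
have Dsub := @subIsetl _ D [set y | t < f y * k (x, y)].
apply: le_trans (Hf _ _ (mlev _ t mW) Dsub _ dist) _; first by pos.
rewrite lee_fin -/r.
have -> : 2 * M * v `^ (1 / 9) * (N * v * r `^ (9 / 7)) `^ (8 / 9) =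
   2 * N `^ (8 / 9) * M * v * r `^ (8 / 7) by lnfield.
rewrite ler_wpM2r ?powR_ge0// !ler_pM2r// ler_pM2l//.
by apply: ler1_powR; lra.
Qed.

End riesz_contraction.

(** * Euclidean geometry and measure of the space *)

Section euclidean_norm.
Context {R : realType}.
Implicit Types (x y z : R3 R) (r : R).

Lemma enorm_sqrE x : enorm x ^+ 2 = x.1.1 ^+ 2 + x.1.2 ^+ 2 + x.2 ^+ 2.
Proof.
rewrite /enorm sqr_sqrtr; last by apply: sumr_ge0 => i _; exact: sqr_ge0.
by rewrite !big_ord_recl big_ord0 /xcoord !(tnth_nth 0)/= addr0 addrA.
Qed.

Lemma enorm_ge0 x : 0 <= enorm x. Proof. exact: sqrtr_ge0. Qed.

Lemma xcoord_le_enorm i x : `|xcoord i x| <= enorm x.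
Proof.
rewrite -sqrtr_sqr /enorm ler_wsqrtr//.
by rewrite (bigD1 i)//= lerDl sumr_ge0// => j _; exact: sqr_ge0.
Qed.

Lemma xcoordD i x y : xcoord i (x + y) = xcoord i x + xcoord i y.
Proof. by rewrite /xcoord; case: i => -[|[|[|//]]] ?; rewrite !(tnth_nth 0). Qed.

Lemma xcoordN i x : xcoord i (- x) = - xcoord i x.
Proof. by rewrite /xcoord; case: i => -[|[|[|//]]] ?; rewrite !(tnth_nth 0). Qed.

Lemma xcoordB i x y : xcoord i (x - y) = xcoord i x - xcoord i y.
Proof. by rewrite xcoordD xcoordN. Qed.

Lemma xcoordZ i (a : R) x : xcoord i (a *: x) = a * xcoord i x.
Proof. by rewrite /xcoord; case: i => -[|[|[|//]]] ?; rewrite !(tnth_nth 0). Qed.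

Lemma xcoord_evec i j : xcoord i (evec j : R3 R) = (i == j)%:R.
Proof.
by rewrite /xcoord /evec; case: i => -[|[|[|//]]] ?; rewrite !(tnth_nth 0)/=;
  case: j => -[|[|[|//]]] ?.
Qed.

Lemma enormN x : enorm (- x) = enorm x.
Proof. by rewrite /enorm; congr Num.sqrt; apply: eq_bigr => i _; rewrite xcoordN sqrrN. Qed.

Lemma enormB x y : enorm (x - y) = enorm (y - x).
Proof. by rewrite -enormN opprB. Qed.

Lemma enorm0 : enorm (0 : R3 R) = 0.
Proof. apply/eqP; have /eqP := enorm_sqrE (0 : R3 R).
by rewrite /= !expr0n !addr0 expf_eq0. Qed.

(** The Cauchy-Schwarz inequality behind it is Lagrange's identity. *)
Lemma enormD x y : enorm (x + y) <= enorm x + enorm y.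
Proof.
rewrite -(@ler_pXn2r _ 2) ?nnegrE ?addr_ge0 ?enorm_ge0// sqrrD !enorm_sqrE/=.
set S := x.1.1 * y.1.1 + x.1.2 * y.1.2 + x.2 * y.2.
have : S <= enorm x * enorm y.
  rewrite (le_trans (ler_norm _))// -(@ler_pXn2r _ 2) ?nnegrE ?mulr_ge0 ?enorm_ge0//.
  rewrite real_normK ?num_real// exprMn !enorm_sqrE -subr_ge0 /S.
  set a := x.1.1; set b := x.1.2; set c := x.2.
  set a' := y.1.1; set b' := y.1.2; set c' := y.2.
  rewrite (_ : _ - _ = (a * b' - b * a') ^+ 2 + (a * c' - c * a') ^+ 2 +
    (b * c' - c * b') ^+ 2); last by ring.
  by rewrite !addr_ge0// sqr_ge0.
rewrite /S => h.
rewrite -subr_ge0 (_ : _ - _ = 2 * (enorm x * enorm y - S)); last by rewrite /S; ring.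
by rewrite mulr_ge0// subr_ge0.
Qed.

Lemma enorm_le_of_abs x r : `|x.1.1| <= r -> `|x.1.2| <= r -> `|x.2| <= r ->
  enorm x <= 3 * r.
Proof.
move=> h1 h2 h3; have r0 : 0 <= r by rewrite (le_trans _ h1).
rewrite -(@ler_pXn2r _ 2) ?nnegrE ?mulr_ge0 ?enorm_ge0// enorm_sqrE.
have sq (u : R) : `|u| <= r -> u ^+ 2 <= r ^+ 2.
  by move=> ur; rewrite -real_normK ?num_real// ler_pXn2r ?nnegrE.
have := sq _ h1; have := sq _ h2; have := sq _ h3; rewrite exprMn.
have : 0 <= r ^+ 2 by exact: sqr_ge0.
rewrite -natrX; lra.
Qed.

End euclidean_norm.

Section lebesgue3.
Context {R : realType}.
Implicit Types (x y z : R3 R) (r : R).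

Definition box x r : set (R3 R) :=
  [set y | [/\ `|x.1.1 - y.1.1| < r, `|x.1.2 - y.1.2| < r & `|x.2 - y.2| < r]].

Lemma boxE x r : box x r = ball x.1.1 r `*` ball x.1.2 r `*` ball x.2 r.
Proof.
apply/seteqP; split=> [y [h1 h2 h3]|y [[h1 h2] h3]]; last by split.
by split=> //; split.
Qed.

Lemma box_ballE x r : box x r = ball x r.
Proof. by rewrite boxE; apply/seteqP; split => y. Qed.

Lemma measurable_box x r : measurable (box x r : set (mR3 R)).
Proof. by rewrite boxE; apply: measurableX; [apply: measurableX|]; exact: measurable_ball. Qed.

Lemma leb3_box x r : 0 <= r -> leb3 (box x r) = ((2 * r) ^+ 3)%:E.
Proof.
move=> r0; rewrite boxE /leb3/= product_measure1E; last 2 first.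
- by apply: measurableX; exact: measurable_ball.
- exact: measurable_ball.
rewrite [X in (X * _)%E]product_measure1E; [|exact: measurable_ball..].
transitivity ((r *+ 2)%:E * (r *+ 2)%:E * (r *+ 2)%:E)%E.
  by congr (_ * _ * _)%E; exact: lebesgue_measure_ball.
by rewrite -!EFinM; congr _%:E; rewrite mulr2n; ring.
Qed.

(** The measurable structure is that of a product, so an open set is written as a
    countable union of rational boxes. *)
Lemma open_measurable3 (A : set (R3 R)) : open A -> measurable (A : set (mR3 R)).
Proof.
move=> oA; pose c (q : rat * rat * rat) : R3 R := (ratr q.1.1, ratr q.1.2, ratr q.2).
pose P (i : rat * rat * rat * nat) := box (c i.1) i.2.+1%:R^-1 `<=` A.
have -> : A = \bigcup_(i : rat * rat * rat * nat)
    (if `[< P i >] then box (c i.1) i.2.+1%:R^-1 else set0).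
  apply/seteqP; split=> [x Ax|x [i _]]; last by case: asboolP => // h /h.
  have [e /= e0 eA] : exists2 e : R, 0 < e & ball x e `<=` A.
    by have /nbhs_ballP[e /= e0 eA] := open_nbhs_nbhs (conj oA Ax); exists e.
  have [n _ nP] := near_infty_natSinv_lt (PosNum (divr_gt0 e0 (ltr0n R 2))).
  have := nP n (leqnn n) => /= ne {nP}.
  have n0 : 0 < n.+1%:R^-1 :> R by rewrite invr_gt0.
  have rd (u : R) : exists q : rat, `|ratr q - u| < n.+1%:R^-1.
    have [||y [uy [q _ qy]]] := @dense_rat R (ball u n.+1%:R^-1).
    - by exists u; exact: ballxx.
    - exact: ball_open.
    - by exists q; rewrite qy distrC.
  have [q1 h1] := rd x.1.1; have [q2 h2] := rd x.1.2; have [q3 h3] := rd x.2.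
  exists ((q1, q2, q3), n) => //; rewrite asboolT; first by split.
  move=> y [k1 k2 k3]; apply: eA; rewrite -box_ballE; split.
  - rewrite (splitr e); apply: le_lt_trans (ler_distD (ratr q1) _ _) _.
    by rewrite ltrD//; [rewrite distrC (lt_trans h1)|rewrite (lt_trans k1)].
  - rewrite (splitr e); apply: le_lt_trans (ler_distD (ratr q2) _ _) _.
    by rewrite ltrD//; [rewrite distrC (lt_trans h2)|rewrite (lt_trans k2)].
  - rewrite (splitr e); apply: le_lt_trans (ler_distD (ratr q3) _ _) _.
    by rewrite ltrD//; [rewrite distrC (lt_trans h3)|rewrite (lt_trans k3)].
apply: countable_bigcupT_measurable; first exact: countableP.
move=> i; case: asboolP => // _; exact: measurable_box.
Qed.

Lemma measurable_fun_coord d (T : measurableType d) (f : T -> mR3 R) i :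
  measurable_fun setT f -> measurable_fun setT (fun t => xcoord i (f t)).
Proof.
move=> mf; have m1 : measurable_fun setT (fun t => (f t).1) by apply: measurableT_comp mf.
case: i => -[|[|[|//]]] Hi.
- suff -> : (fun t => xcoord (Ordinal Hi) (f t)) = (fun t => (f t).1.1).
    by apply: measurableT_comp m1.
  by apply/funext => t; rewrite /xcoord (tnth_nth 0).
- suff -> : (fun t => xcoord (Ordinal Hi) (f t)) = (fun t => (f t).1.2).
    by apply: measurableT_comp m1.
  by apply/funext => t; rewrite /xcoord (tnth_nth 0).
- suff -> : (fun t => xcoord (Ordinal Hi) (f t)) = (fun t => (f t).2).
    by apply: measurableT_comp mf.
  by apply/funext => t; rewrite /xcoord (tnth_nth 0).
Qed.

(** The Lebesgue measure under a name of its own, to which a sigma-finite structure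
    is attached. *)
Definition volume : set (mR3 R) -> \bar R := leb3.

HB.instance Definition _ := Measure.copy volume leb3.

Lemma volume_sigma_finite : sigma_finite setT volume.
Proof.
exists (fun n => box 0 n%:R); last first.
  move=> n; split; first exact: measurable_box.
  by rewrite /volume leb3_box// ltry.
apply/esym/seteqP; split=> // x _.
exists (Num.bound (`|x.1.1| + `|x.1.2| + `|x.2|)) => //.
have := archi_boundP (addr_ge0 (addr_ge0 (normr_ge0 x.1.1) (normr_ge0 x.1.2)) (normr_ge0 x.2)).
have := normr_ge0 x.1.1; have := normr_ge0 x.1.2; have := normr_ge0 x.2.
by split; rewrite /= sub0r normrN; lra.
Qed.

HB.instance Definition _ := Measure_isSigmaFinite.Build _ _ _ volume volume_sigma_finite.

Lemma measurable_enorm d (T : measurableType d) (f g : T -> mR3 R) :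
  measurable_fun setT f -> measurable_fun setT g ->
  measurable_fun setT (fun t => enorm ((f t : R3 R) - (g t : R3 R))).
Proof.
move=> mf mg; apply: (@measurableT_comp _ _ _ _ _ _ (@Num.sqrt R)).
  exact: (continuous_measurable_fun (@sqrt_continuous R)).
apply: measurable_sum => i; apply: measurable_funX.
under eq_fun do rewrite xcoordB.
by apply: measurable_funB; exact: measurable_fun_coord.
Qed.

Lemma measurable_eball x r : measurable (eball x r : set (mR3 R)).
Proof.
rewrite /eball (_ : [set _ | _] = setT `&` [set y : mR3 R | (- r < - enorm ((y : R3 R) - x))%R]).
  apply: measurableI => //; apply: measurable_superlevel.
  apply: measurable_funN; exact: (@measurable_enorm _ (mR3 R) id (cst x)).
by rewrite setTI; apply/seteqP; split=> y /=; rewrite ltrN2.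
Qed.

Lemma eball_sub_box x r : eball x r `<=` box x r.
Proof.
move=> y; rewrite /eball/= enormB => h.
have k i : `|xcoord i x - xcoord i y| < r.
  by rewrite -xcoordB (le_lt_trans (xcoord_le_enorm _ _)).
by split; [have := k ord0|have := k (inord 1)|have := k (inord 2)];
  rewrite /xcoord !(tnth_nth 0)/= ?inordK.
Qed.

Lemma leb3_eball_le x r : 0 <= r -> (leb3 (eball x r) <= ((2 * r) ^+ 3)%:E)%E.
Proof.
move=> r0; rewrite -(leb3_box x r0); apply: le_measure; rewrite ?inE.
- exact: measurable_eball.
- exact: measurable_box.
- exact: eball_sub_box.
Qed.

Definition inv_sq_dist (z : mR3 R * mR3 R) : R :=
  (enorm ((z.1 : R3 R) - (z.2 : R3 R)) ^+ 2)^-1.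

Lemma measurable_inv_sq_dist : measurable_fun setT inv_sq_dist.
Proof.
rewrite (_ : inv_sq_dist = (fun z : mR3 R * mR3 R => (enorm ((z.1 : R3 R) - (z.2 : R3 R)) ^+ 2) `^ (-1))).
  apply: (@measurableT_comp _ _ _ _ _ _ (fun a : R => a `^ (-1))).
    exact: measurable_powR.
  apply: measurable_funX.
  by apply: measurable_enorm; [exact: measurable_fst|exact: measurable_snd].
by apply/funext => z; rewrite powR_inv1// sqr_ge0.
Qed.

(** The superlevel set [k(x,.) > t] lies in the ball of radius [t^(-1/2)], hence in a
    cube of volume [8 t^(-3/2)]. *)
Lemma inv_sq_dist_riesz : riesz_kernel volume inv_sq_dist.
Proof.
split.
- exact: measurable_inv_sq_dist.
- by move=> z; rewrite invr_ge0 sqr_ge0.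
- by move=> x y; rewrite /inv_sq_dist/= enormB.
- move=> x t t0; pose r := t^-1 `^ (1 / 2).
  have r0 : 0 < r by rewrite /r; pos.
  have -> : 8 * t^-1 `^ (3 / 2) = (2 * r) ^+ 3.
    have -> : (2 * r) ^+ 3 = 8 * r ^+ 3 by ring.
    by congr (_ * _); rewrite /r; lnfield.
  apply: le_trans (leb3_eball_le x (ltW r0)); apply: le_measure; rewrite ?inE.
  + apply: measurable_superlevel.
    exact: (measurableT_comp measurable_inv_sq_dist (pair1_measurable x)).
  + exact: measurable_eball.
  + move=> y /=; rewrite /inv_sq_dist/eball/= enormB => h.
    rewrite -(@ltr_pXn2r _ 2) ?nnegrE ?enorm_ge0 ?(ltW r0)//.
    have -> : r ^+ 2 = t^-1 by rewrite /r; lnfield.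
    move: h; set e := enorm _ ^+ 2 => h.
    have e0 : 0 < e by rewrite lt0r sqr_ge0 andbT; apply: contraTneq h => ->; rewrite invr0 -leNgt ltW.
    by rewrite -(invrK e) ltf_pV2 ?posrE// invr_gt0.
Qed.

End lebesgue3.

(** * Calculus of smooth functions, radial functions *)

Section directional_derivatives.
Context {R : realType}.
Implicit Types (x y v : R3 R) (f g : R3 R -> R).

(** Reduces directional derivatives to derivatives in one real variable. *)
Lemma is_derive_lineP f y v (d : R) :
  is_derive y v f d <-> is_derive (0 : R) 1 (fun t : R => f (t *: v + y)) d.
Proof.
suff E : (fun h : R => h^-1 *: ((f \o shift y) (h *: v) - f y)) =
  (fun h : R => h^-1 *: (((fun t : R => f (t *: v + y)) \o shift 0) (h *: 1) -
      f ((0 : R) *: v + y))).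
  by split => -[]; rewrite /derivable /derive => h1 h2; split;
    rewrite /derivable /derive; move: h1 h2; rewrite E.
apply/funext => h /=; congr (_ *: (f _ - f _)); last by rewrite scale0r add0r.
by rewrite addr0 /GRing.scale/= mulr1.
Qed.

Lemma is_derive_composition (h : R -> R) g y v (a b : R) :
  is_derive (g y) 1 h a -> is_derive y v g b ->
  is_derive y v (fun z => h (g z)) (a * b).
Proof.
move=> ha /is_derive_lineP gb; apply/is_derive_lineP.
apply: (@is_derive1_comp _ h (fun t => g (t *: v + y)) 0 a b) => //.
by rewrite scale0r add0r.
Qed.

Lemma is_derive_mul f g y v (a b : R) :
  is_derive y v f a -> is_derive y v g b ->
  is_derive y v (fun z => f z * g z) (f y * b + g y * a).
Proof. exact: is_deriveM. Qed.

Lemma is_derive_add f g y v (a b : R) :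
  is_derive y v f a -> is_derive y v g b ->
  is_derive y v (fun z => f z + g z) (a + b).
Proof. exact: is_deriveD. Qed.

Lemma is_derive_sub f g y v (a b : R) :
  is_derive y v f a -> is_derive y v g b ->
  is_derive y v (fun z => f z - g z) (a - b).
Proof. exact: is_deriveB. Qed.

Lemma is_derive_const (c : R) y v : is_derive y v (fun=> c) 0.
Proof. exact: is_derive_cst. Qed.

Lemma is_derive_xcoord x i j y :
  is_derive y (evec i) (fun z => xcoord j (z - x)) (i == j)%:R.
Proof.
have E : (fun t : R => xcoord j (t *: evec i + y - x)) =
   (fun t : R => xcoord j (y - x) + t * (i == j)%:R).
  by apply/funext => t; rewrite -addrA (xcoordD _ (t *: evec i)) xcoordZ xcoord_evec [LHS]addrC [j == i]eq_sym.
apply/is_derive_lineP; rewrite E; apply: is_derive_eq.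
by rewrite add0r mul1r scaler0 add0r /GRing.scale/= mulr1.
Qed.

Lemma pderivE i f f' : (forall y, is_derive y (evec i) f (f' y)) -> pderiv i f = f'.
Proof. by move=> h; apply/funext => y; rewrite /pderiv (@derive_val _ _ _ _ _ _ _ (h y)). Qed.

End directional_derivatives.

Section smooth_functions.
Context {R : realType}.
Implicit Types (x y : R3 R) (f g : R3 R -> R) (k : nat).

Lemma class_C_S k f : class_C k.+1 f -> class_C k f.
Proof.
elim: k f => [|k IH] f [cf h]; first by split.
by split=> // i; have [? ?] := h i; split=> //; exact: IH.
Qed.

Lemma class_C_continuous k f : class_C k f -> continuous f.
Proof. by case: k => [|k] []. Qed.

Lemma class_C_is_derive k f i y : class_C k.+1 f ->
  is_derive y (evec i) f (pderiv i f y).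
Proof. by move=> [_ /(_ i)[df _]]; exact: derivableP. Qed.

Lemma class_C_intro k f (f' : 'I_3 -> R3 R -> R) : continuous f ->
  (forall i y, is_derive y (evec i) f (f' i y)) ->
  (forall i, class_C k (f' i)) -> class_C k.+1 f.
Proof.
move=> cf df cf'; split=> // i; split=> [y|]; first by case: (df i y).
by rewrite (pderivE (df i)).
Qed.

Lemma class_C_const k (c : R) : class_C k (fun=> c).
Proof.
elim: k c => [|k IH] c; first by split=> // x; exact: cst_continuous.
apply: (@class_C_intro _ _ (fun _ => fun=> 0)).
- by move=> x; exact: cst_continuous.
- by move=> i; exact: IH.
Qed.

Lemma class_C_add k f g : class_C k f -> class_C k g ->
  class_C k (fun y => f y + g y).
Proof.
elim: k f g => [|k IH] f g cf cg.
  split=> // x; by apply: cvgD; apply: class_C_continuous; eassumption.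
apply: (@class_C_intro _ _ (fun i => fun y => pderiv i f y + pderiv i g y)).
- by move=> x; by apply: cvgD; apply: class_C_continuous; eassumption.
- by move=> i y; apply: is_derive_add; [exact: (class_C_is_derive i y cf)|exact: (class_C_is_derive i y cg)].
- by move=> i; apply: IH; [case: cf|case: cg] => _ /(_ i)[].
Qed.

Lemma class_C_mul k f g : class_C k f -> class_C k g ->
  class_C k (fun y => f y * g y).
Proof.
elim: k f g => [|k IH] f g cf cg.
  split=> // x; by apply: cvgM; apply: class_C_continuous; eassumption.
apply: (@class_C_intro _ _ (fun i => fun y => f y * pderiv i g y + g y * pderiv i f y)).
- by move=> x; by apply: cvgM; apply: class_C_continuous; eassumption.
- by move=> i y; apply: is_derive_mul; [exact: (class_C_is_derive i y cf)|exact: (class_C_is_derive i y cg)].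
- move=> i; apply: class_C_add; apply: IH; try exact: class_C_S.
    by case: cg => _ /(_ i)[].
  by case: cf => _ /(_ i)[].
Qed.

Lemma class_C_sub k f g : class_C k f -> class_C k g ->
  class_C k (fun y => f y - g y).
Proof.
move=> cf cg; under eq_fun do rewrite -mulN1r.
by apply: class_C_add => //; apply: class_C_mul => //; exact: class_C_const.
Qed.

Lemma continuous_xcoord i : continuous (xcoord i : R3 R -> R).
Proof.
move=> x; case: i => -[|[|[|//]]] Hi.
- rewrite (_ : xcoord _ = fst \o fst); last by apply/funext => y; rewrite /xcoord (tnth_nth 0).
  by apply: continuous_comp; exact: cvg_fst.
- rewrite (_ : xcoord _ = snd \o fst); last by apply/funext => y; rewrite /xcoord (tnth_nth 0).
  by apply: continuous_comp; [exact: cvg_fst|exact: cvg_snd].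
- rewrite (_ : xcoord _ = snd); last by apply/funext => y; rewrite /xcoord (tnth_nth 0).
  exact: cvg_snd.
Qed.

Lemma class_C_xcoord k x i : class_C k (fun y => xcoord i (y - x)).
Proof.
have c : continuous (fun y => xcoord i (y - x)).
  move=> y; under eq_fun do rewrite xcoordB.
  apply: continuousB; [exact: continuous_xcoord|exact: cst_continuous].
case: k => [|k]; first by split.
apply: (class_C_intro c) => [j y|j]; first exact: is_derive_xcoord.
exact: class_C_const.
Qed.

Definition sqdist x y := enorm (y - x) ^+ 2.

Lemma sqdistE x y : sqdist x y = xcoord ord0 (y - x) ^+ 2 +
  xcoord (inord 1) (y - x) ^+ 2 + xcoord (inord 2) (y - x) ^+ 2.
Proof. by rewrite /sqdist enorm_sqrE /xcoord !(tnth_nth 0)/= ?inordK. Qed.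

Lemma sqdist_ge0 x y : 0 <= sqdist x y. Proof. exact: sqr_ge0. Qed.

Lemma is_derive_sqdist x i y : is_derive y (evec i) (sqdist x) (2 * xcoord i (y - x)).
Proof.
rewrite (_ : sqdist x = (fun y => xcoord ord0 (y - x) * xcoord ord0 (y - x) +
  xcoord (inord 1) (y - x) * xcoord (inord 1) (y - x) +
  xcoord (inord 2) (y - x) * xcoord (inord 2) (y - x))); last first.
  by apply/funext => z; rewrite sqdistE !expr2.
apply: is_derive_eq.
  by do 2 (apply: is_derive_add; last by apply: is_derive_mul; exact: is_derive_xcoord);
    apply: is_derive_mul; exact: is_derive_xcoord.
have [e|[e|e]] : i = ord0 \/ i = inord 1 \/ i = inord 2.
  case: i => -[|[|[|//]]] H; [left|right; left|right; right]; apply/val_inj => //=;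
  by rewrite inordK.
- by rewrite e eqxx -!val_eqE /= !inordK//=; ring.
- by rewrite e eqxx -!val_eqE /= !inordK//=; ring.
- by rewrite e eqxx -!val_eqE /= !inordK//=; ring.
Qed.

Lemma class_C_sqdist k x : class_C k (sqdist x).
Proof.
rewrite (_ : sqdist x = (fun y => xcoord ord0 (y - x) * xcoord ord0 (y - x) +
  xcoord (inord 1) (y - x) * xcoord (inord 1) (y - x) +
  xcoord (inord 2) (y - x) * xcoord (inord 2) (y - x))); last first.
  by apply/funext => z; rewrite sqdistE !expr2.
by do 2 (apply: class_C_add; last by apply: class_C_mul; exact: class_C_xcoord);
  apply: class_C_mul; exact: class_C_xcoord.
Qed.

(** [h 0, ..., h N] are the successive derivatives of one profile on the half-line
    [s >= 0], where squared distances live.  Carrying the derivatives along keeps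
    all formulas for the test field polynomial in the [h n]. *)
Definition derivative_chain (h : nat -> R -> R) (N : nat) :=
  (forall n (s : R), (n < N)%N -> 0 <= s -> is_derive s 1 (h n) (h n.+1 s)) /\
  (forall n (s : R), (n <= N)%N -> 0 <= s -> {for s, continuous (h n)}).

Lemma is_derive_radial h N n x i y : derivative_chain h N -> (n < N)%N ->
  is_derive y (evec i) (fun z => h n (sqdist x z))
    (2 * xcoord i (y - x) * h n.+1 (sqdist x y)).
Proof.
move=> [dh _] nN; apply: is_derive_eq.
  apply: is_derive_composition; first exact: dh nN (sqdist_ge0 x y).
  exact: is_derive_sqdist.
by rewrite mulrC.
Qed.

(** Each derivative of [h n (sqdist x y)] brings down a factor linear in [y] and
    moves one step along the chain. *)
Lemma class_C_radial h N n k x : derivative_chain h N -> (n + k <= N)%N ->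
  class_C k (fun y => h n (sqdist x y)).
Proof.
move=> dh; elim: k n => [|k IH] n nkN.
  split=> // y; apply: (@continuous_comp _ _ _ (sqdist x) (h n)).
    exact: class_C_continuous (class_C_sqdist 0 x) y.
  by apply: dh.2; [move: nkN; rewrite addn0|exact: sqdist_ge0].
apply: (@class_C_intro _ _ (fun i y => 2 * xcoord i (y - x) * h n.+1 (sqdist x y))).
- move=> y; apply: (@continuous_comp _ _ _ (sqdist x) (h n)).
    exact: class_C_continuous (class_C_sqdist 0 x) y.
  by apply: dh.2; [rewrite (leq_trans _ nkN)// leq_addr|exact: sqdist_ge0].
- by move=> i y; apply: is_derive_radial dh _; rewrite (leq_trans _ nkN)// -addn1 leq_add2l.
- move=> i; apply: class_C_mul; last by apply: IH; rewrite addSnnS.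
  by apply: class_C_mul; [exact: class_C_const|exact: class_C_xcoord].
Qed.

End smooth_functions.

(** * The divergence-free test field *)

Section test_field.
Context {R : realType}.
Implicit Types (x y : R3 R) (i j k : 'I_3).

Definition mkvec (F : 'I_3 -> R) : R3 R := (F ord0, F (inord 1), F (inord 2)).

Lemma ord3P i : [\/ i = ord0, i = inord 1 | i = inord 2].
Proof.
by case: i => -[|[|[|//]]] H; [apply: Or31|apply: Or32|apply: Or33];
  apply/val_inj => //=; rewrite inordK.
Qed.

Lemma sum3 (F : 'I_3 -> R) : \sum_(i < 3) F i = F ord0 + F (inord 1) + F (inord 2).
Proof.
rewrite !big_ord_recl big_ord0 addr0 addrA; congr (_ + F _ + F _);
by apply/val_inj; rewrite /= inordK.
Qed.

Lemma xcoord_mkvec i F : xcoord i (mkvec F) = F i.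
Proof. by case: (ord3P i) => ->; rewrite /xcoord (tnth_nth 0) ?inordK. Qed.

Variables (h : nat -> R -> R) (x : R3 R) (k : 'I_3).
Hypothesis dh : derivative_chain h 3.

Let z i y := xcoord i (y - x).
Let s y := sqdist x y.

(** With [H] radial and [h = 4 H'] as a function of [s = |y-x|^2], this is the [j]-th
    component of [grad (d_k H) - (Lap H) e_k]; [dzeta] and [ddzeta] are its first
    and pure second derivatives. *)
Definition zeta_coord j y := z j y * z k y * h 1 (s y)
  - (j == k)%:R * (h 0 (s y) + s y * h 1 (s y)).

Definition dzeta i j y :=
  ((i == j)%:R * z k y + (i == k)%:R * z j y) * h 1 (s y)
  + 2 * (z i y * z j y * z k y) * h 2 (s y)
  - (j == k)%:R * (z i y * (4 * h 1 (s y) + 2 * s y * h 2 (s y))).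

Definition ddzeta i j y :=
  2 * ((i == j)%:R * (i == k)%:R) * h 1 (s y)
  + 2 * z i y * ((i == j)%:R * z k y + (i == k)%:R * z j y) * h 2 (s y)
  + 2 * (z j y * z k y + z i y * ((i == j)%:R * z k y + (i == k)%:R * z j y)) * h 2 (s y)
  + 4 * (z i y * z j y * z k y * z i y) * h 3 (s y)
  - (j == k)%:R * (4 * h 1 (s y) + 2 * s y * h 2 (s y)
     + z i y * (z i y * (12 * h 2 (s y) + 4 * s y * h 3 (s y)))).

(** The function [d_k (Lap H)]. *)
Definition phi_test y := z k y * (5 * h 1 (s y) + 2 * s y * h 2 (s y)).

Definition dphi_test j y := (j == k)%:R * (5 * h 1 (s y) + 2 * s y * h 2 (s y))
  + z j y * z k y * (14 * h 2 (s y) + 4 * s y * h 3 (s y)).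

(** The function [Lap^2 H]. *)
Definition bilap y := 15 * h 1 (s y) + 20 * s y * h 2 (s y) + 4 * s y ^+ 2 * h 3 (s y).

Ltac differentiate := repeat first [ exact: is_derive_xcoord | exact: is_derive_sqdist
  | by apply: (is_derive_radial _ _ _ dh) | exact: is_derive_const
  | apply: is_derive_sub | apply: is_derive_add | apply: is_derive_mul ].

Lemma is_derive_zeta i j y : is_derive y (evec i) (zeta_coord j) (dzeta i j y).
Proof.
rewrite /zeta_coord /z /s; apply: is_derive_eq; first by differentiate.
rewrite /dzeta /z /s; ring.
Qed.

Lemma is_derive_dzeta i j y : is_derive y (evec i) (dzeta i j) (ddzeta i j y).
Proof.
rewrite /dzeta /z /s; apply: is_derive_eq; first by differentiate.
rewrite /ddzeta /z /s eqxx /=; ring.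
Qed.

Lemma is_derive_phi_test j y : is_derive y (evec j) phi_test (dphi_test j y).
Proof.
rewrite /phi_test /z /s; apply: is_derive_eq; first by differentiate.
rewrite /dphi_test /z /s; ring.
Qed.

Ltac case_ord := rewrite -!val_eqE /= ?inordK//=.

Lemma div_zeta y : \sum_(j < 3) dzeta j j y = 0.
Proof.
rewrite sum3 /dzeta /z /s sqdistE.
by case: (ord3P k) => ->; case_ord; ring.
Qed.

(** [Lap zeta = grad (d_k Lap H) - (Lap^2 H) e_k]. *)
Lemma laplacian_zeta_sum j y :
  \sum_(i < 3) ddzeta i j y = dphi_test j y - (j == k)%:R * bilap y.
Proof.
rewrite sum3 /ddzeta /dphi_test /bilap /z /s sqdistE.
by case: (ord3P k) => ->; case: (ord3P j) => ->; case_ord; ring.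
Qed.

Ltac smooth := repeat first [ exact: class_C_xcoord | exact: class_C_sqdist
  | by apply: (class_C_radial _ dh) | exact: class_C_const
  | apply: class_C_sub | apply: class_C_add | apply: class_C_mul ].

Lemma class_C_zeta j : class_C 2 (zeta_coord j).
Proof. by rewrite /zeta_coord /z /s; smooth. Qed.

Lemma class_C_phi_test : class_C 1 phi_test.
Proof. by rewrite /phi_test /z /s; smooth. Qed.

Lemma class_C_dzeta i j : class_C 0 (dzeta i j).
Proof. by rewrite /dzeta /z /s; smooth. Qed.

Lemma class_C_dphi_test j : class_C 0 (dphi_test j).
Proof. by rewrite /dphi_test /z /s; smooth. Qed.

Lemma class_C_bilap : class_C 0 bilap.
Proof. by rewrite /bilap /z /s; under eq_fun do rewrite expr2; smooth. Qed.

Lemma pderiv_zeta i j : pderiv i (zeta_coord j) = dzeta i j.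
Proof. by apply: pderivE => y; exact: is_derive_zeta. Qed.

Lemma pderiv_phi_test i : pderiv i phi_test = dphi_test i.
Proof. by apply: pderivE => y; exact: is_derive_phi_test. Qed.

Lemma laplacian_zeta j y :
  laplacian (zeta_coord j) y = dphi_test j y - (j == k)%:R * bilap y.
Proof.
rewrite -laplacian_zeta_sum /laplacian; apply: eq_bigr => i _.
by rewrite pderiv_zeta (pderivE (is_derive_dzeta i j)).
Qed.

Definition zeta y := mkvec (fun j => zeta_coord j y).

Lemma vcoord_zeta j : vcoord j zeta = zeta_coord j.
Proof. by apply/funext => y; rewrite /vcoord /zeta xcoord_mkvec. Qed.

Lemma divergence_zeta y : divergence zeta y = 0.
Proof.
rewrite -(div_zeta y) /divergence; apply: eq_bigr => j _.
by rewrite vcoord_zeta pderiv_zeta.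
Qed.

Variable r : R.
Hypothesis h_supp : forall n t, (n <= 3)%N -> r ^+ 2 <= t -> h n t = 0.

Lemma zeta_coord_supp j y : r ^+ 2 <= s y -> zeta_coord j y = 0.
Proof. by move=> ry; rewrite /zeta_coord !h_supp// !mulr0 addr0 mulr0 subr0. Qed.

Lemma dzeta_supp i j y : r ^+ 2 <= s y -> dzeta i j y = 0.
Proof. by move=> ry; rewrite /dzeta !h_supp// !mulr0 !addr0 !mulr0 subr0. Qed.

Lemma phi_test_supp y : r ^+ 2 <= s y -> phi_test y = 0.
Proof. by move=> ry; rewrite /phi_test !h_supp// !mulr0 addr0 mulr0. Qed.

Lemma dphi_test_supp j y : r ^+ 2 <= s y -> dphi_test j y = 0.
Proof. by move=> ry; rewrite /dphi_test !h_supp// !mulr0 !addr0 !mulr0 addr0. Qed.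

Lemma bilap_supp y : r ^+ 2 <= s y -> bilap y = 0.
Proof. by move=> ry; rewrite /bilap !h_supp// !mulr0 !addr0. Qed.

End test_field.

Section closed_balls.
Context {R : realType}.
Implicit Types (x y : R3 R) (r : R).

Definition cball x r : set (R3 R) := [set y | enorm (y - x) <= r].

Lemma continuous_enormB x : continuous (fun y : R3 R => enorm (y - x)).
Proof.
move=> y; rewrite (_ : (fun y => _) = Num.sqrt \o sqdist x); last first.
  by apply/funext => w; rewrite /sqdist /= sqrtr_sqr ger0_norm// enorm_ge0.
apply: continuous_comp; last exact: sqrt_continuous.
exact: class_C_continuous (class_C_sqdist 0 x) y.
Qed.

Lemma open_eball x r : open (eball x r).
Proof.
rewrite (_ : eball x r = (fun y => enorm (y - x)) @^-1` [set t | t < r])//.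
by apply: open_comp; [move=> y _; exact: continuous_enormB|exact: open_lt].
Qed.

Lemma closed_cball x r : closed (cball x r).
Proof.
rewrite (_ : cball x r = (fun y => enorm (y - x)) @^-1` [set t | t <= r])//.
by apply: closed_comp; [move=> y _; exact: continuous_enormB|exact: closed_le].
Qed.

(** A closed subset of a product of segments. *)
Lemma compact_cball x r : compact (cball x r).
Proof.
pose S : set (R3 R) := `[x.1.1 - r, x.1.1 + r] `*` `[x.1.2 - r, x.1.2 + r] `*` `[x.2 - r, x.2 + r].
have cS : compact S by do 2 (apply: compact_setX; last exact: segment_compact); exact: segment_compact.
apply: (subclosed_compact (@closed_cball x r) cS) => y yr.
have c i : `|xcoord i y - xcoord i x| <= r.
  by rewrite -xcoordB (le_trans (xcoord_le_enorm _ _)).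
split; [split|]; rewrite /= in_itv/= -ler_distlC.
- by have := c ord0; rewrite /xcoord !(tnth_nth 0)/= distrC.
- by have := c (inord 1); rewrite /xcoord !(tnth_nth 0) inordK//= distrC.
- by have := c (inord 2); rewrite /xcoord !(tnth_nth 0) inordK//= distrC.
Qed.

Lemma measurable_cball x r : measurable (cball x r : set (mR3 R)).
Proof.
rewrite -(setCK (cball x r)); apply: measurableC; apply: open_measurable3.
by apply: closed_openC; exact: closed_cball.
Qed.

Lemma compactly_supported_ball (f : R3 R -> R) x r (Omega : set (R3 R)) m :
  0 <= r -> class_C m f -> (forall y, r ^+ 2 <= sqdist x y -> f y = 0) ->
  cball x r `<=` Omega -> class_Cc m Omega f.
Proof.
move=> r0 cf f0 rO.
have sub : closure [set y | f y != 0] `<=` cball x r.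
  rewrite [X in _ `<=` X](iffLR (closure_id _) (@closed_cball x r)).
  apply: closure_subset => y /= fy; rewrite /cball /= leNgt.
  apply: contra fy => ry; apply/eqP/f0.
  by rewrite /sqdist ler_pXn2r ?nnegrE ?enorm_ge0// ltW.
split=> //; last exact: subset_trans rO.
by apply: (subclosed_compact _ (@compact_cball x r) sub); exact: closed_closure.
Qed.

Lemma continuous_bounded_on_compact (f : R3 R -> R) (K : set (R3 R)) :
  compact K -> continuous f -> exists2 c : R, 0 < c & forall y, K y -> `|f y| <= c.
Proof.
move=> cK cf.
have /compact_bounded[M [_ HM]] : compact (f @` K).
  by apply: continuous_compact => //; apply: continuous_subspaceT.
exists (`|M| + 1); first by rewrite ltr_pwDr.
by move=> y Ky; apply: HM; [rewrite (le_lt_trans (ler_norm M))// ltrDl|exists y].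
Qed.

End closed_balls.

(** * The regularised distance, cut off by its Taylor polynomial *)

Section cutoff_by_taylor.
Context {R : realType}.
Implicit Types (F : R -> R) (s d r : R).

(** The difference quotient of the glued function is dominated by that of [F]. *)
Lemma is_derive_glue0 F s0 : is_derive s0 1 F 0 -> F s0 = 0 ->
  is_derive s0 1 (fun s => if s < s0 then F s else 0) 0.
Proof.
move=> [dF eF] F0.
have cF : h^-1 *: ((F \o shift s0) (h *: 1) - F s0) @[h --> 0^'] --> (0 : R).
  have h : h^-1 *: ((F \o shift s0) (h *: 1) - F s0) @[h --> 0^'] --> 'D_1 F s0 by exact: dF.
  by rewrite -[X in _ --> X]eF.
suff cG : h^-1 *: (((fun s => if s < s0 then F s else 0) \o shift s0) (h *: 1) -
    (if s0 < s0 then F s0 else 0)) @[h --> 0^'] --> (0 : R).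
  split; first by apply/cvg_ex; exists 0.
  by rewrite /derive; apply: cvg_lim.
apply/norm_cvg0P; move/(iffRL (norm_cvg0P _)): cF => cF.
apply: (squeeze_cvgr _ (cvg_cst 0) cF); apply: nearW => h /=.
rewrite normr_ge0/= ltxx F0; case: ifP => // _.
by rewrite subr0 scaler0 normr0 normr_ge0.
Qed.

Lemma is_derive_continuous F s a : is_derive s (1 : R) F a -> {for s, continuous F}.
Proof. by move=> [dF _]; apply: differentiable_continuous; apply/derivable1_diffP. Qed.

Variables (d r : R).
Hypotheses (d0 : 0 < d) (r0 : 0 < r).

(** Reciprocal of the regularised distance, as a function of the squared
    distance. *)
Definition rdist s : R := (Num.sqrt (s + d ^+ 2))^-1.

(** Successive derivatives of [rdist] in [s]. *)
Definition rdist_chain (n : nat) s : R :=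
  nth 0 [:: rdist s; - (1 / 2) * rdist s ^+ 3; (3 / 4) * rdist s ^+ 5;
    - (15 / 8) * rdist s ^+ 7] n.

(** Third order Taylor polynomial of [rdist] at [r ^+ 2], and its derivatives. *)
Definition taylor_chain (n : nat) s : R :=
  let c i := rdist_chain i (r ^+ 2) in let t := s - r ^+ 2 in
  nth 0 [:: c 0 + c 1 * t + c 2 * (t * t / 2) + c 3 * (t * t * t / 6);
    c 1 + c 2 * t + c 3 * (t * t / 2); c 2 + c 3 * t; c 3] n.

(** The derivatives of the remainder up to order three vanish at [r ^+ 2], so that
    extension by zero keeps a chain of continuous derivatives. *)
Definition profile (n : nat) s : R :=
  if s < r ^+ 2 then rdist_chain n s - taylor_chain n s else 0.

Lemma rdist_gt0 s : 0 <= s -> 0 < rdist s.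
Proof. by move=> s0; rewrite invr_gt0 sqrtr_gt0 ltr_wpDl// exprn_gt0. Qed.

Lemma is_derive_rdist s : 0 <= s -> is_derive s (1 : R) rdist (- (1 / 2) * rdist s ^+ 3).
Proof.
move=> s0; have t0 : 0 < s + d ^+ 2 by rewrite ltr_wpDl// exprn_gt0.
have sq0 : Num.sqrt (s + d ^+ 2) != 0 by rewrite gt_eqF// sqrtr_gt0.
have h1 : is_derive s (1 : R) (fun s => s + d ^+ 2) 1.
  by apply: is_derive_eq; rewrite addr0.
have h2 := @is_derive1_comp _ Num.sqrt (fun s => s + d ^+ 2) s _ _ (is_derive1_sqrt t0) h1.
have h3 := is_deriveV (sq0 : (Num.sqrt \o (fun s => s + d ^+ 2)) s != 0) h2.
apply: is_derive_eq h3 _; rewrite /= /rdist /GRing.scale/=.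
by field.
Qed.

Lemma is_derive_rdist_pow n s : 0 <= s ->
  is_derive s (1 : R) (fun s => rdist s ^+ n.+1) (- (n.+1%:R / 2) * rdist s ^+ n.+3).
Proof.
move=> s0; elim: n => [|n IH]; first exact: is_derive_rdist s0.
have hM : is_derive s (1 : R) (fun s => rdist s * rdist s ^+ n.+1)
    (rdist s * (- (n.+1%:R / 2) * rdist s ^+ n.+3) +
     rdist s ^+ n.+1 * (- (1 / 2) * rdist s ^+ 3)).
  exact: is_deriveM (is_derive_rdist s0) IH.
apply: is_derive_eq hM _.
by rewrite -(natr1 n.+1) !exprS; field.
Qed.

Lemma is_derive_chain_remainder n s : (n < 3)%N -> 0 <= s ->
  is_derive s (1 : R) (fun s => rdist_chain n s - taylor_chain n s)
    (rdist_chain n.+1 s - taylor_chain n.+1 s).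
Proof.
move=> n3 s0; have hc (c : R) : is_derive s (1 : R) (fun=> c) 0 by exact: is_derive_cst.
have hid : is_derive s (1 : R) (fun s => s - r ^+ 2) 1.
  by apply: is_derive_eq; rewrite subr0.
have hM (f g : R -> R) (a b : R) : is_derive s (1 : R) f a -> is_derive s (1 : R) g b ->
    is_derive s (1 : R) (fun s => f s * g s) (f s * b + g s * a) by exact: is_deriveM.
have hD (f g : R -> R) (a b : R) : is_derive s (1 : R) f a -> is_derive s (1 : R) g b ->
    is_derive s (1 : R) (fun s => f s + g s) (a + b) by exact: is_deriveD.
have hB (f g : R -> R) (a b : R) : is_derive s (1 : R) f a -> is_derive s (1 : R) g b ->
    is_derive s (1 : R) (fun s => f s - g s) (a - b) by exact: is_deriveB.
have p3 := is_derive_rdist_pow 2 s0; have p5 := is_derive_rdist_pow 4 s0.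
have p1 := is_derive_rdist s0.
have tay : is_derive s (1 : R) (taylor_chain n) (taylor_chain n.+1 s).
  rewrite /taylor_chain; case: n n3 => [|[|[|//]]] _ /=; apply: is_derive_eq;
  repeat first [exact: hid | exact: hc | apply: hD | apply: hM ]; rewrite /GRing.scale/=; by field.
suff hr : is_derive s (1 : R) (rdist_chain n) (rdist_chain n.+1 s) by exact: hB hr tay.
rewrite /rdist_chain; case: n n3 tay => [|[|[|//]]] _ _ //=.
- by apply: is_derive_eq (hM _ _ _ _ (hc _) p3) _; field.
- by apply: is_derive_eq (hM _ _ _ _ (hc _) p5) _; field.
Qed.

Lemma chain_remainder_at n : (n <= 3)%N ->
  rdist_chain n (r ^+ 2) - taylor_chain n (r ^+ 2) = 0.
Proof.
by case: n => [|[|[|[|//]]]] _; rewrite /taylor_chain /= subrr; field.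
Qed.

Lemma near_lt_neq s t : s != t -> \forall x \near s, (x < t) = (s < t).
Proof.
rewrite neq_lt => /orP[st|ts].
  have nb : nbhs s [set x | x < t] by apply: open_nbhs_nbhs; split=> //; exact: open_lt.
  by near=> x; rewrite st; near: x.
have nb : nbhs s [set x | t < x] by apply: open_nbhs_nbhs; split=> //; exact: open_gt.
near=> x; rewrite [RHS]ltNge (ltW ts)/=; apply/negbTE; rewrite -leNgt ltW//.
by near: x.
Unshelve. all: by end_near. Qed.

Lemma near_eq_continuous (f g : R -> R) s : (\forall t \near s, f t = g t) ->
  {for s, continuous f} -> {for s, continuous g}.
Proof.
move=> E cf; have e := nbhs_singleton E.
have cf' : f t @[t --> s] --> g s by rewrite -e; exact: cf.
by apply: cvg_trans cf'; exact: near_eq_cvg E.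
Qed.

Lemma profile_derivative_chain : derivative_chain profile 3.
Proof.
have der n s : (n < 3)%N -> 0 <= s -> is_derive s (1 : R) (profile n) (profile n.+1 s).
  move=> n3 s0; have dF := is_derive_chain_remainder n3 s0.
  have [e|ne] := eqVneq s (r ^+ 2).
    rewrite /profile e ltxx; apply: is_derive_glue0; last exact: chain_remainder_at (ltnW n3).
    by rewrite -(chain_remainder_at n3) -e.
  rewrite {2}/profile; case: ifPn => sr.
    apply: near_eq_is_derive dF; near=> t; rewrite /profile.
    by have -> : t < r ^+ 2 by rewrite (near (near_lt_neq ne)).
  apply: near_eq_is_derive (is_derive_cst 0 s 1); near=> t; rewrite /profile.
  by have -> : t < r ^+ 2 = false by rewrite (near (near_lt_neq ne) t)//; exact: negbTE.
split=> // n s n3 s0; have [n3'|] := ltnP n 3; first exact: is_derive_continuous (der _ _ n3' s0).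
move=> n3'; have -> : n = 3%N by apply/eqP; rewrite eqn_leq n3 n3'.
have cF : {for s, continuous (fun s => rdist_chain 3 s - taylor_chain 3 s)}.
  rewrite /rdist_chain /taylor_chain /=.
  apply: cvgB; last exact: cvg_cst.
  apply: cvgM; first exact: cvg_cst.
  exact: is_derive_continuous (is_derive_rdist_pow 6 s0).
have [e|ne] := eqVneq s (r ^+ 2); last first.
  have [sr|sr] := boolP (s < r ^+ 2).
    have E : \forall t \near s, rdist_chain 3 t - taylor_chain 3 t = profile 3 t.
      near=> t; rewrite /profile.
      by have -> : t < r ^+ 2 by rewrite (near (near_lt_neq ne)).
    exact: near_eq_continuous E cF.
  have E : \forall t \near s, (fun=> 0) t = profile 3 t.
    near=> t; rewrite /profile.
    by have -> : t < r ^+ 2 = false by rewrite (near (near_lt_neq ne) t)//; exact: negbTE.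
  exact: near_eq_continuous E (@cvg_cst _ _ _ _ _).
have {}cF : rdist_chain 3 t - taylor_chain 3 t @[t --> s] --> (0 : R).
  by rewrite -(chain_remainder_at (leqnn 3)) -e; exact: cF.
suff : profile 3 t @[t --> s] --> (0 : R).
  by move=> h; rewrite /prop_for /continuous_at {2}/profile e ltxx -e.
move/(iffRL (norm_cvg0P _)): cF => cF; apply/norm_cvg0P.
apply: (squeeze_cvgr _ (cvg_cst 0) cF); apply: nearW => t.
by rewrite normr_ge0 /profile /=; case: ifP => // _; rewrite normr0 normr_ge0.
Unshelve. all: by end_near. Qed.

Lemma profile_supp n t : (n <= 3)%N -> r ^+ 2 <= t -> profile n t = 0.
Proof. by move=> _ rt; rewrite /profile ltNge rt. Qed.

Lemma rdist_sqr s : 0 <= s -> rdist s ^+ 2 * (s + d ^+ 2) = 1.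
Proof.
move=> s0; have t0 : 0 < s + d ^+ 2 by rewrite ltr_wpDl// exprn_gt0.
by rewrite /rdist exprVn sqr_sqrtr ?ltW// mulVf// gt_eqF.
Qed.

Lemma rdist_mul_le1 e : 0 <= e -> rdist (e ^+ 2) * e <= 1.
Proof.
move=> e0; rewrite /rdist mulrC ler_pdivrMr ?mul1r; last first.
  by rewrite sqrtr_gt0 ltr_wpDl ?sqr_ge0// exprn_gt0.
by rewrite -[leLHS](@ger0_norm _ e)// -sqrtr_sqr ler_wsqrtr// lerDl sqr_ge0.
Qed.

(** In the variables [a = rdist (r^2) r] and [b = (r^2 - s) / r^2], both between [0]
    and [1], the Taylor polynomial is a power of [1/r] times a polynomial whose
    coefficients have one sign; the constants are the sums of these coefficients. *)
Lemma taylor_chain_le s : 0 <= s -> s <= r ^+ 2 ->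
  [/\ `|taylor_chain 1 s| <= 35 / 16 * r^-1 ^+ 3,
      `|taylor_chain 2 s| <= 21 / 8 * r^-1 ^+ 5 &
      `|taylor_chain 3 s| <= 15 / 8 * r^-1 ^+ 7].
Proof.
move=> s0 sr; rewrite /taylor_chain /rdist_chain /=.
set p := rdist (r ^+ 2); set P := r^-1.
have P0 : 0 < P by rewrite invr_gt0.
pose a := p * r; pose b := (r ^+ 2 - s) / r ^+ 2.
have rn0 : r != 0 by rewrite gt_eqF.
have a0 : 0 <= a by rewrite mulr_ge0// ltW// rdist_gt0// sqr_ge0.
have a1 : a <= 1 by apply: rdist_mul_le1; exact: ltW.
have b0 : 0 <= b by rewrite divr_ge0 ?subr_ge0// sqr_ge0.
have b1 : b <= 1 by rewrite ler_pdivrMr ?exprn_gt0// mul1r gerBl.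
have pE : p = a * P by rewrite /a -mulrA mulfV ?mulr1.
have tE : s - r ^+ 2 = - b / P ^+ 2 by rewrite /b /P; field.
have ax n : 0 <= a ^+ n /\ a ^+ n <= 1 by rewrite exprn_ge0// exprn_ile1.
have abx n m : 0 <= a ^+ n * b ^+ m /\ a ^+ n * b ^+ m <= 1.
  by rewrite mulr_ge0 ?exprn_ge0// mulr_ile1 ?exprn_ge0 ?exprn_ile1.
have Pn0 : P != 0 by rewrite gt_eqF.
have PX n : 0 <= P ^+ n by rewrite exprn_ge0// ltW.
rewrite tE pE; split.
- rewrite (_ : _ + _ = - ((1 / 2 * a ^+ 3 + 3 / 4 * (a ^+ 5 * b ^+ 1) +
      15 / 16 * (a ^+ 7 * b ^+ 2)) * P ^+ 3)); last by field.
  rewrite normrN ger0_norm; last first.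
    by have := abx 5 1%N; have := abx 7 2%N; have := ax 3 => -[? ?] [? ?] [? ?]; rewrite mulr_ge0//; lra.
  by rewrite ler_wpM2r//; have := abx 5 1%N; have := abx 7 2%N; have := ax 3 => -[? ?] [? ?] [? ?]; lra.
- rewrite (_ : _ + _ = (3 / 4 * a ^+ 5 + 15 / 8 * (a ^+ 7 * b ^+ 1)) * P ^+ 5); last by field.
  rewrite ger0_norm; last first.
    by have := abx 7 1%N; have := ax 5 => -[? ?] [? ?]; rewrite mulr_ge0//; lra.
  by rewrite ler_wpM2r//; have := abx 7 1%N; have := ax 5 => -[? ?] [? ?]; lra.
- rewrite (_ : _ * _ = - ((15 / 8 * a ^+ 7) * P ^+ 7)); last by ring.
  rewrite normrN ger0_norm; last by have := ax 7 => -[? ?]; rewrite mulr_ge0//; lra.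
  by rewrite ler_wpM2r//; have := ax 7 => -[? ?]; lra.
Qed.

(** Both [rdist] and its Taylor polynomial satisfy the bound, as [e < r] and
    [rdist (e^2) <= 1/e]. *)
Lemma profile_le e : 0 < e -> e < r ->
  `|profile 1 (e ^+ 2)| <= 3 * e^-1 ^+ 3 /\ `|profile 2 (e ^+ 2)| <= 4 * e^-1 ^+ 5.
Proof.
move=> e0 er; have er2 : e ^+ 2 < r ^+ 2 by rewrite ltr_pXn2r ?nnegrE ?ltW.
have [t1 t2 _] := taylor_chain_le (sqr_ge0 e) (ltW er2).
have rp n : r^-1 ^+ n <= e^-1 ^+ n.
  by rewrite lerXn2r ?nnegrE ?invr_ge0 ?ltW// ltf_pV2.
have qge : 0 <= rdist (e ^+ 2) by rewrite ltW// rdist_gt0// sqr_ge0.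
have qle : rdist (e ^+ 2) <= e^-1.
  by rewrite -[e^-1]mul1r ler_pdivlMr// rdist_mul_le1// ltW.
have ie : 0 <= e^-1 by rewrite invr_ge0 ltW.
have qp n : rdist (e ^+ 2) ^+ n <= e^-1 ^+ n by rewrite lerXn2r ?nnegrE.
have q0 n : 0 <= rdist (e ^+ 2) ^+ n by rewrite exprn_ge0.
rewrite /profile er2; split; apply: (le_trans (ler_normB _ _)).
  apply: (@le_trans _ _ (1 / 2 * e^-1 ^+ 3 + 35 / 16 * e^-1 ^+ 3)).
    apply: lerD; last by apply: le_trans t1 _; rewrite ler_wpM2l//; lra.
    rewrite /rdist_chain /= normrM (ger0_norm (q0 3)) normrN ger0_norm; last lra.
    by rewrite ler_wpM2l//; lra.
  have := q0 3; have := qp 3; lra.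
apply: (@le_trans _ _ (3 / 4 * e^-1 ^+ 5 + 21 / 8 * e^-1 ^+ 5)).
  apply: lerD; last by apply: le_trans t2 _; rewrite ler_wpM2l//; lra.
  rewrite /rdist_chain /= normrM (ger0_norm (q0 5)) ger0_norm; last lra.
  by rewrite ler_wpM2l//; lra.
have := q0 5; have := qp 5; lra.
Qed.

(** On [rdist] itself [bilap] is exactly [- (15/2) d^4 rdist^7], by
    [rdist^2 (s + d^2) = 1]; what remains is [bilap] of a polynomial in [s], of
    the size [r^-3] that scaling predicts. *)
Lemma bilap_profile_le x y : sqdist x y < r ^+ 2 ->
  `|bilap profile x y + 15 / 2 * (d ^+ 4 * rdist (sqdist x y) ^+ 7)| <= 100 * r^-1 ^+ 3.
Proof.
move=> sr; rewrite /bilap /profile sr; have s0 := sqdist_ge0 x y.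
move: (sqdist x y) sr s0 => s sr s0.
have [t1 t2 t3] := taylor_chain_le s0 (ltW sr).
have q0 := rdist_gt0 s0; have qd := rdist_sqr s0.
set T1 := taylor_chain 1 s in t1 *; set T2 := taylor_chain 2 s in t2 *.
set T3 := taylor_chain 3 s in t3 *; rewrite /rdist_chain /=.
set q := rdist s in q0 qd *.
rewrite (_ : _ + _ = - (15 * T1 + 20 * s * T2 + 4 * s ^+ 2 * T3)); last first.
  have dE : d ^+ 2 = q^-1 ^+ 2 - s.
    by rewrite exprVn -[_^-1]mul1r -qd; field; rewrite gt_eqF.
  have -> : d ^+ 4 = (q^-1 ^+ 2 - s) ^+ 2 by rewrite -dE; ring.
  by field; rewrite gt_eqF.
rewrite normrN; set P := r^-1 in t1 t2 t3 *.
have P0 : 0 < P by rewrite invr_gt0.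
pose b := s * P ^+ 2.
have rn0 : r != 0 by rewrite gt_eqF.
have b0 : 0 <= b by rewrite mulr_ge0// sqr_ge0.
have b1 : b <= 1 by rewrite /b /P exprVn ler_pdivrMr ?exprn_gt0// mul1r ltW.
have b2 : b ^+ 2 <= 1 by rewrite exprn_ile1.
have sT2 : `|20 * s * T2| <= 105 / 2 * P ^+ 3.
  rewrite normrM ger0_norm ?mulr_ge0//.
  apply: (@le_trans _ _ (20 * s * (21 / 8 * P ^+ 5))); first by rewrite ler_wpM2l// mulr_ge0.
  rewrite (_ : _ * _ = b * (105 / 2 * P ^+ 3)); last by rewrite /b; field.
  by rewrite ler_piMl// mulr_ge0 ?exprn_ge0 ?(ltW P0)//; lra.
have sT3 : `|4 * s ^+ 2 * T3| <= 15 / 2 * P ^+ 3.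
  rewrite normrM ger0_norm ?mulr_ge0 ?sqr_ge0//.
  apply: (@le_trans _ _ (4 * s ^+ 2 * (15 / 8 * P ^+ 7))); first by rewrite ler_wpM2l// mulr_ge0 ?sqr_ge0.
  rewrite (_ : _ * _ = b ^+ 2 * (15 / 2 * P ^+ 3)); last by rewrite /b; field.
  by rewrite ler_piMl// mulr_ge0 ?exprn_ge0 ?(ltW P0)//; lra.
have sT1 : `|15 * T1| <= 525 / 16 * P ^+ 3.
  by rewrite normrM ger0_norm//; lra.
have P3 : 0 <= P ^+ 3 by rewrite exprn_ge0// ltW.
apply: (le_trans (ler_normD _ _)); have := ler_normD (15 * T1) (20 * s * T2); lra.
Qed.

(** Each term is a product of [m] factors [y - x] and of a derivative of the profile
    of size [|y-x|^-(m+2)]. *)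
Lemma dzeta_profile_le x k i j y :
  `|dzeta profile x k i j y| <= 34 * inv_sq_dist (x, y).
Proof.
have [ry|] := leP (r ^+ 2) (sqdist x y).
  have -> : dzeta profile x k i j y = 0.
    by apply: (@dzeta_supp _ profile x k r) => // n t; exact: profile_supp.
  by rewrite normr0 mulr_ge0// /inv_sq_dist invr_ge0 sqr_ge0.
rewrite /inv_sq_dist /= enormB; pose e := enorm (y - x); rewrite -/e /sqdist -/e => er.
have e0 : 0 <= e by exact: enorm_ge0.
pose z i := xcoord i (y - x).
have ze l : `|z l| <= e by exact: xcoord_le_enorm.
have dl (m n : 'I_3) : `|((m == n)%:R : R)| <= 1 by case: eqP; rewrite ?normr1 ?normr0.
rewrite /dzeta /sqdist -/e -!/(z _).
have [e00|en0] := eqVneq e 0.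
  have z0 l : z l = 0 by apply/eqP; rewrite -normr_le0 -e00.
  rewrite !z0 (_ : _ - _ = 0); last by ring.
  by rewrite normr0 mulr_ge0// invr_ge0 sqr_ge0.
have e1 : 0 < e by rewrite lt0r en0.
have er' : e < r by rewrite -(@ltr_pXn2r _ 2)// nnegrE// ltW.
have [h1 h2] := profile_le e1 er'.
set H1 := profile 1 _ in h1 *; set H2 := profile 2 _ in h2 *.
have A1 : `|((i == j)%:R * z k + (i == k)%:R * z j) * H1| <= 6 * (e ^+ 2)^-1.
  rewrite normrM (_ : 6 * _ = (e + e) * (3 * e^-1 ^+ 3)); last by field.
  apply: ler_pM => //; apply: (le_trans (ler_normD _ _)).
  by apply: lerD; rewrite normrM -[leRHS]mul1r; apply: ler_pM.
have A2 : `|2 * (z i * z j * z k) * H2| <= 8 * (e ^+ 2)^-1.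
  rewrite normrM (_ : 8 * _ = (2 * (e * e * e)) * (4 * e^-1 ^+ 5)); last by field.
  apply: ler_pM => //; rewrite normrM ger0_norm// ler_wpM2l// !normrM.
  by apply: ler_pM => //; apply: ler_pM.
have A3 : `|(j == k)%:R * (z i * (4 * H1 + 2 * e ^+ 2 * H2))| <= 20 * (e ^+ 2)^-1.
  rewrite normrM -[leRHS]mul1r; apply: ler_pM => //.
  rewrite normrM (_ : 20 * _ = e * (4 * (3 * e^-1 ^+ 3) + 2 * e ^+ 2 * (4 * e^-1 ^+ 5))); last by field.
  apply: ler_pM => //; apply: (le_trans (ler_normD _ _)); apply: lerD.
    by rewrite normrM ger0_norm// ler_wpM2l.
  by rewrite normrM ger0_norm ?mulr_ge0 ?sqr_ge0// ler_wpM2l// mulr_ge0// sqr_ge0.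
apply: (le_trans (ler_normB _ _)); have := ler_normD (((i == j)%:R * z k + (i == k)%:R * z j) * H1) (2 * (z i * z j * z k) * H2).
lra.
Qed.

End cutoff_by_taylor.

(** * The local representation inequality *)

Section local_representation.
Context {R : realType}.
Implicit Types (x y : R3 R) (u : R3 R -> R3 R) (Omega : set (R3 R)).

Lemma continuous_measurable3 (f : R3 R -> R) : continuous f ->
  measurable_fun setT (f : mR3 R -> R).
Proof.
move=> cf; apply: (measurability _ (RGenOInfty.measurableE R)).
move=> _ [_ [a ->] <-]; rewrite setTI; apply: open_measurable3.
rewrite (_ : _ @^-1` _ = f @^-1` [set t | a < t]).
  by apply: open_comp; [move=> y _; exact: cf|exact: open_gt].
by apply/seteqP; split=> y /=; rewrite in_itv/= andbT.
Qed.

Lemma class_C_measurable (f : R3 R -> R) m (D : set (mR3 R)) : class_C m f ->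
  measurable_fun D (f : mR3 R -> R).
Proof.
by move=> cf; apply: measurable_funTS; apply: continuous_measurable3; exact: class_C_continuous cf.
Qed.

(** The regularisation of [- (2/15) Lap^2] of half the distance to [x]: a bump of
    height [d^-3] and width [d] whose integral does not depend on [d]. *)
Definition moll (d : R) x y : R := d ^+ 4 * rdist d (sqdist x y) ^+ 7.

Lemma class_C_moll d x : 0 < d -> class_C 0 (moll d x).
Proof.
move=> d0; split=> // y; rewrite /moll; apply: cvgM; first exact: cvg_cst.
apply: (@continuous_comp _ _ _ (sqdist x) (fun s => rdist d s ^+ 7)).
  exact: class_C_continuous (class_C_sqdist 0 x) y.
exact: is_derive_continuous (is_derive_rdist_pow d0 6 (sqdist_ge0 x y)).
Qed.

Lemma moll_ge0 d x y : 0 < d -> 0 <= moll d x y.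
Proof.
by move=> d0; rewrite /moll mulr_ge0 ?exprn_ge0 ?ltW ?rdist_gt0 ?sqdist_ge0// ltW.
Qed.

Lemma measurable_enorm_field (D : set (mR3 R)) u : measurable D ->
  (forall i, measurable_fun D (vcoord i u : mR3 R -> R)) ->
  measurable_fun D (fun y : mR3 R => enorm (u y)).
Proof.
move=> mD mu; apply: (@measurableT_comp _ _ _ _ _ _ (@Num.sqrt R)).
  exact: (continuous_measurable_fun (@sqrt_continuous R)).
by apply: measurable_sum => i; apply: measurable_funX; exact: mu.
Qed.

Lemma eball_sub_cball x r : eball x r `<=` cball x r.
Proof. by move=> y /ltW. Qed.

(** An upper bound for a signed integral, in the form without cancellation that
    extended real integrals of nonnegative functions allow. *)
Lemma integral_pos_le_neg (D : set (mR3 R)) (w : mR3 R -> R) (H : \bar R) :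
  measurable D -> leb3.-integrable D (EFin \o w) ->
  (\int[leb3]_(y in D) (w y)%:E <= H)%E ->
  (\int[leb3]_(y in D) (Num.max (w y) 0)%:E <=
   \int[leb3]_(y in D) (Num.max (- w y) 0)%:E + H)%E.
Proof.
move=> mD iw; have fn := integrable_neg_fin_num mD iw; rewrite integralE.
have -> : (\int[leb3]_(x in D) ((EFin \o w)^\+ x) = \int[leb3]_(y in D) (Num.max (w y) 0)%:E)%E.
  by apply: eq_integral => y _; rewrite funeposE /= EFin_max.
have eN : (\int[leb3]_(x in D) ((EFin \o w)^\- x) = \int[leb3]_(y in D) (Num.max (- w y) 0)%:E)%E.
  by apply: eq_integral => y _; rewrite funenegE /= EFin_max.
rewrite eN in fn *; rewrite leeBlDl//.
Qed.

Variables (Omega : set (R3 R)) (u : R3 R -> R3 R) (x : R3 R) (r d : R) (k : 'I_3).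
Hypotheses (oO : open Omega) (uL2 : L2_loc Omega u) (uws : very_weak_solution Omega u).
Hypotheses (r0 : 0 < r) (d0 : 0 < d) (xO : cball x r `<=` Omega).

Let D : set (mR3 R) := eball x r.
Let mD : measurable D. Proof. exact: measurable_eball. Qed.
#[local] Hint Resolve mD : core.
Let DO : D `<=` Omega. Proof. exact: subset_trans (@eball_sub_cball x r) xO. Qed.
Let mu i : measurable_fun D (vcoord i u : mR3 R -> R).
Proof. by case: uL2 => mu _; apply: measurable_funS (mu i); [exact: open_measurable3|exact: DO]. Qed.
#[local] Hint Resolve mu : core.
Let men : measurable_fun D (fun y : mR3 R => enorm (u y)).
Proof. exact: measurable_enorm_field. Qed.
#[local] Hint Resolve men : core.

Let integrable_bound (w : mR3 R -> R) (c : R) : measurable_fun D w -> 0 <= c ->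
  (forall y, D y -> `|w y| <= c * (1 + enorm (u y) ^+ 2)) ->
  leb3.-integrable D (EFin \o w).
Proof.
move=> mw c0 wc.
have mb : measurable_fun D (fun y : mR3 R => (1 + enorm (u y) ^+ 2)).
  by apply: measurable_funD => //; exact: measurable_funX.
apply: (@le_integrable _ _ _ _ _ mD _ (fun y => (c * (1 + enorm (u y) ^+ 2))%:E)).
- exact/measurable_EFinP.
- move=> y Dy /=; rewrite lee_fin (le_trans (wc y Dy))//; exact: ler_norm.
apply/integrableP; split.
  by apply/measurable_EFinP/measurable_funM.
have nn y : 0 <= 1 + enorm (u y) ^+ 2 by rewrite addr_ge0 ?sqr_ge0.
under eq_integral => y _ do rewrite gee0_abs ?lee_fin ?mulr_ge0// EFinM.
rewrite ge0_integralZl_EFin//; last 2 first.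
- by move=> y _; rewrite lee_fin.
- exact/measurable_EFinP.
apply: lte_mul_pinfty; rewrite ?lee_fin//.
under eq_integral do rewrite EFinD.
rewrite ge0_integralD//; last 2 first.
- by move=> y _; rewrite lee_fin sqr_ge0.
- by apply/measurable_EFinP; exact: measurable_funX.
apply: lte_add_pinfty.
  rewrite integral_one//; apply: le_lt_trans (leb3_eball_le x (ltW r0)) _.
  exact: ltry.
case: uL2 => _ /(_ _ (@compact_cball R x r) xO); apply: le_lt_trans.
apply: ge0_subset_integral => //; [exact: measurable_cball| | |].
- apply/measurable_EFinP/measurable_funX.
  apply: measurable_enorm_field; first exact: measurable_cball.
  move=> i; case: uL2 => mu' _; apply: measurable_funS (mu' i) => //; exact: open_measurable3.
- by move=> y _; rewrite lee_fin sqr_ge0.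
- exact: eball_sub_cball.
Qed.

Let integral_Omega (w : R3 R -> R) : (forall y, ~ D y -> w y = 0) ->
  (\int[leb3]_(y in Omega) (w y)%:E = \int[leb3]_(y in D) (w y)%:E)%E.
Proof.
move=> w0; rewrite -[X in (_ = \int[_]_(y in X) _)%E](setIidr DO) integral_mkcondr.
apply: eq_integral => y _; rewrite patchE; case: ifPn => // yD.
by rewrite w0//; move: yD; rewrite notin_setE.
Qed.

Let h := profile d r.
Let dh : derivative_chain h 3. Proof. exact: profile_derivative_chain. Qed.
Let hs : forall n t, (n <= 3)%N -> r ^+ 2 <= t -> h n t = 0.
Proof. by move=> n t; exact: profile_supp. Qed.

Let nD y : ~ D y -> r ^+ 2 <= sqdist x y.
Proof.
move=> nDy; rewrite /sqdist ler_pXn2r ?nnegrE ?enorm_ge0 ?(ltW r0)//.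
by rewrite leNgt; apply/negP.
Qed.

Let uc i y : `|vcoord i u y| <= enorm (u y). Proof. exact: xcoord_le_enorm. Qed.

#[local] Hint Resolve uc : core.
Let le1sq (a : R) : a <= 1 + a ^+ 2.
Proof. by rewrite -subr_ge0 (_ : _ - _ = (a - 1 / 2) ^+ 2 + 3 / 4); [rewrite addr_ge0 ?sqr_ge0//; lra|field]. Qed.

Let integrable_linear i (f : R3 R -> R) : class_C 0 f ->
  leb3.-integrable D (EFin \o (fun y => vcoord i u y * f y)).
Proof.
move=> cf; have [c c0 fc] := continuous_bounded_on_compact (@compact_cball R x r) (class_C_continuous cf).
apply: (@integrable_bound _ c); [|exact: ltW|].
  by apply: measurable_funM => //; exact: (class_C_measurable cf).
move=> y Dy; rewrite normrM mulrC; apply: ler_pM => //; first exact: fc (eball_sub_cball Dy).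
exact: le_trans (uc i y) (le1sq _).
Qed.

Let integrable_quadratic i j (f : R3 R -> R) : class_C 0 f ->
  leb3.-integrable D (EFin \o (fun y => vcoord i u y * vcoord j u y * f y)).
Proof.
move=> cf; have [c c0 fc] := continuous_bounded_on_compact (@compact_cball R x r) (class_C_continuous cf).
apply: (@integrable_bound _ c); [|exact: ltW|].
  by apply: measurable_funM; [exact: measurable_funM|exact: (class_C_measurable cf)].
move=> y Dy; rewrite normrM mulrC; apply: ler_pM => //; first exact: fc (eball_sub_cball Dy).
apply: (@le_trans _ _ (enorm (u y) ^+ 2)); last by rewrite lerDr.
by rewrite normrM expr2; apply: ler_pM.
Qed.

Let F1 y := \sum_(j < 3) vcoord j u y * dphi_test h x k j y.
Let G y := \sum_(i < 3) \sum_(j < 3) vcoord i u y * vcoord j u y * dzeta h x k i j y.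

Let iF1 : leb3.-integrable D (EFin \o F1).
Proof.
rewrite (_ : EFin \o F1 = fun y => (\sum_(j < 3) (vcoord j u y * dphi_test h x k j y)%:E)%E).
  apply: integrable_sum => // j _; apply: integrable_linear; exact: (class_C_dphi_test x k dh).
by apply/funext => y; rewrite /= /F1 -sumEFin.
Qed.

Let iG : leb3.-integrable D (EFin \o G).
Proof.
rewrite (_ : EFin \o G = fun y => (\sum_(i < 3) \sum_(j < 3)
    (vcoord i u y * vcoord j u y * dzeta h x k i j y)%:E)%E).
  apply: integrable_sum => // i _; apply: integrable_sum => // j _.
  by apply: integrable_quadratic; exact: (class_C_dzeta x k dh).
by apply/funext => y; rewrite /= /G -sumEFin; apply: eq_bigr => i _; rewrite -sumEFin.
Qed.

Let intF1 : (\int[leb3]_(y in D) (F1 y)%:E = 0)%E.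
Proof.
have cc : class_Cc 1 Omega (phi_test h x k).
  apply: compactly_supported_ball xO; [exact: ltW|exact: (class_C_phi_test x k dh)|].
  by move=> y; exact: (phi_test_supp k hs).
have := uws.1 _ cc.
under eq_integral do under eq_bigr do rewrite (pderiv_phi_test x k dh).
rewrite (integral_Omega (w := F1))// => y /nD ry; rewrite /F1 big1// => j _.
by rewrite (dphi_test_supp k hs j ry) mulr0.
Qed.

(** The equation tested with [zeta], in which the term with the gradient of
    [phi_test] drops out because [u] is weakly divergence free. *)
Lemma weak_identity : (\int[leb3]_(y in D) (vcoord k u y * bilap h x y)%:E =
  \int[leb3]_(y in D) (G y)%:E)%E.
Proof.
have cc : class_Cc_field 2 Omega (zeta h x k).
  move=> j; rewrite vcoord_zeta; apply: compactly_supported_ball xO; [exact: ltW|exact: (class_C_zeta x k dh)|].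
  by move=> y; exact: (zeta_coord_supp k hs j).
have := uws.2 _ cc (divergence_zeta x k dh).
have iB : leb3.-integrable D (EFin \o (fun y => vcoord k u y * bilap h x y)).
  by apply: integrable_linear; exact: (class_C_bilap x dh).
have E y : - (\sum_(i < 3) vcoord i u y * laplacian (vcoord i (zeta h x k)) y)
     - \sum_(i < 3) \sum_(j < 3) vcoord i u y * vcoord j u y * pderiv i (vcoord j (zeta h x k)) y
   = (vcoord k u y * bilap h x y - G y) - F1 y.
  rewrite /G /F1; under [in LHS]eq_bigr do rewrite vcoord_zeta (laplacian_zeta x k dh) mulrBr.
  rewrite sumrB; under [X in _ - X = _]eq_bigr do under eq_bigr do rewrite vcoord_zeta (pderiv_zeta x k dh).
  have -> : \sum_(i < 3) vcoord i u y * ((i == k)%:R * bilap h x y) = vcoord k u y * bilap h x y.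
    rewrite (bigD1 k)//= eqxx mul1r big1 ?addr0// => i /negbTE ->.
    by rewrite mul0r mulr0.
  by ring.
under eq_integral do rewrite E.
rewrite (integral_Omega (w := fun y => (vcoord k u y * bilap h x y - G y) - F1 y)); last first.
  move=> y /nD ry; rewrite /G /F1 (bilap_supp hs)// mulr0 big1; last first.
    by move=> i _; rewrite big1// => j _; rewrite (dzeta_supp k hs i j ry) mulr0.
  by rewrite big1 ?subr0// => j _; rewrite (dphi_test_supp k hs j ry) mulr0.
under eq_integral do rewrite EFinB EFinB.
rewrite integralB//; last by apply: integrableB.
rewrite integralB// intF1 sube0 => /eqP.
rewrite sube_eq ?add0e; last 2 first.
- exact: integrable_fin_num.
- by rewrite fin_num_adde_defr.
by move/eqP.
Qed.

(** [bilap] of the profile is [- (15/2) moll] up to an error of size [100 r^-3], and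
    the right-hand side of [weak_identity] is bounded by [dzeta_profile_le], whose
    constant [34] occurs for each of the nine pairs of indices. *)
Lemma local_representation :
  (`|\int[leb3]_(y in D) (vcoord k u y * moll d x y)%:E| <=
   (100 * r^-1 ^+ 3)%:E * \int[leb3]_(y in D) (enorm (u y))%:E +
   306%:E * \int[leb3]_(y in D) (enorm (u y) ^+ 2 * inv_sq_dist (x, y))%:E)%E.
Proof.
pose e y := bilap h x y + 15 / 2 * moll d x y.
have ce : class_C 0 e.
  apply: class_C_add; first exact: (class_C_bilap x dh).
  by apply: class_C_mul; [exact: class_C_const|exact: class_C_moll].
have im : leb3.-integrable D (EFin \o (fun y => vcoord k u y * moll d x y)).
  by apply: integrable_linear; exact: class_C_moll.
have ie : leb3.-integrable D (EFin \o (fun y => vcoord k u y * e y)) by exact: integrable_linear.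
have iB : leb3.-integrable D (EFin \o (fun y => vcoord k u y * bilap h x y)).
  by apply: integrable_linear; exact: (class_C_bilap x dh).
have key : ((15 / 2)%:E * \int[leb3]_(y in D) (vcoord k u y * moll d x y)%:E =
    \int[leb3]_(y in D) (vcoord k u y * e y)%:E - \int[leb3]_(y in D) (G y)%:E)%E.
  rewrite -weak_identity -integralZl// -integralB//.
  by apply: eq_integral => y _; rewrite /= -EFinM -EFinB /e; congr _%:E; ring.
set I := (\int[leb3]_(y in D) (vcoord k u y * moll d x y)%:E)%E in key *.
have le1 : (`|I| <= `|(15 / 2)%:E * I|)%E.
  have e15 : (`|(15 / 2)%:E| = (15 / 2)%:E :> \bar R)%E by rewrite gee0_abs// lee_fin; lra.
  rewrite abseM e15.
  by rewrite -[leLHS]mul1e; apply: lee_wpmul2r => //; rewrite lee_fin; lra.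
apply: (le_trans le1); rewrite key; apply: (le_trans (lee_abs_sub _ _)).
have mk : measurable_fun D (fun y : mR3 R => inv_sq_dist (x, y)).
  apply: measurable_funTS.
  exact: (measurableT_comp measurable_inv_sq_dist (pair1_measurable x)).
have k0 y : 0 <= inv_sq_dist (x, y) by rewrite invr_ge0 sqr_ge0.
have r30 : 0 <= 100 * r^-1 ^+ 3 by rewrite mulr_ge0// exprn_ge0// invr_ge0 ltW.
apply: leeD.
  apply: (le_trans (le_abse_integral _ _ _)) => //; first by case/integrableP: ie.
  rewrite -ge0_integralZl_EFin//; last 2 first.
  - by move=> y _; rewrite lee_fin enorm_ge0.
  - exact/measurable_EFinP.
  apply: ge0_le_integral => //.
  - by apply: measurableT_comp => //; case/integrableP: ie.
  - by apply/measurable_funeM/measurable_EFinP.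
  move=> y Dy /=; rewrite lee_fin normrM mulrC; apply: ler_pM => //.
  by apply: bilap_profile_le => //; rewrite /sqdist ltr_pXn2r ?nnegrE ?enorm_ge0 ?(ltW r0).
apply: (le_trans (le_abse_integral _ _ _)) => //; first by case/integrableP: iG.
have mq : measurable_fun D (fun y : mR3 R => enorm (u y) ^+ 2 * inv_sq_dist (x, y)).
  by apply: measurable_funM => //; exact: measurable_funX.
have c0 : 0 <= 306 :> R by rewrite ler0n.
rewrite -(ge0_integralZl_EFin _ mD _ _ c0); last 2 first.
- by move=> y _; rewrite lee_fin mulr_ge0// sqr_ge0.
- exact/measurable_EFinP.
apply: ge0_le_integral => //.
- by apply: measurableT_comp => //; case/integrableP: iG.
- by apply/measurable_funeM/measurable_EFinP.
move=> y Dy /=; rewrite lee_fin /G.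
apply: (@le_trans _ _ (\sum_(i < 3) \sum_(j < 3) (34 * (enorm (u y) ^+ 2 * inv_sq_dist (x, y))))).
  apply: (le_trans (ler_norm_sum _ _ _)); apply: ler_sum => i _.
  apply: (le_trans (ler_norm_sum _ _ _)); apply: ler_sum => j _.
  rewrite !normrM mulrCA expr2; apply: ler_pM; rewrite ?mulr_ge0//.
    by apply: ler_pM.
  exact: dzeta_profile_le.
by rewrite !sum3; lra.
Qed.

End local_representation.

(** * Mollified sets *)

Section mollifier_bounds.
Context {R : realType}.
Implicit Types (x y : R3 R) (d : R).

Lemma rdist_ge0 d (s : R) : 0 <= rdist d s.
Proof. by rewrite invr_ge0 sqrtr_ge0. Qed.

Lemma mollC d x y : moll d x y = moll d y x.
Proof. by rewrite /moll /sqdist enormB. Qed.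

Lemma measurable_moll d :
  measurable_fun setT (fun z : mR3 R * mR3 R => moll d (z.1 : R3 R) (z.2 : R3 R)).
Proof.
rewrite (_ : (fun z => _) = (fun z : mR3 R * mR3 R => d ^+ 4 *
   (Num.sqrt (enorm ((z.2 : R3 R) - (z.1 : R3 R)) ^+ 2 + d ^+ 2) `^ (-1)) ^+ 7)); last first.
  by apply/funext => z; rewrite /moll /rdist /sqdist powR_inv1// sqrtr_ge0.
apply: measurable_funM => //; apply: measurable_funX.
apply: (@measurableT_comp _ _ _ _ _ _ (fun a : R => a `^ (-1))).
  exact: measurable_powR.
apply: (@measurableT_comp _ _ _ _ _ _ (@Num.sqrt R)).
  exact: (continuous_measurable_fun (@sqrt_continuous R)).
apply: measurable_funD => //; apply: measurable_funX.
by apply: measurable_enorm; [exact: measurable_snd|exact: measurable_fst].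
Qed.

Lemma measurable_moll_section d x :
  measurable_fun setT (fun y : mR3 R => moll d x (y : R3 R)).
Proof. exact: (measurableT_comp (measurable_moll d) (pair1_measurable x)). Qed.

Lemma moll_far_le d x y (r : R) : 0 < d -> 0 < r -> r <= enorm (y - x) ->
  moll d x y <= d ^+ 4 * r^-1 ^+ 7.
Proof.
move=> d0 r0 ry; rewrite /moll ler_wpM2l ?exprn_ge0 ?(ltW d0)//.
have e0 : 0 < enorm (y - x) by rewrite (lt_le_trans r0).
rewrite lerXn2r ?nnegrE ?rdist_ge0 ?invr_ge0 ?(ltW r0)//.
apply: (@le_trans _ _ (enorm (y - x))^-1); last by rewrite lef_pV2.
by rewrite -[leRHS]mul1r ler_pdivlMr// /sqdist; apply: rdist_mul_le1 => //; exact: ltW.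
Qed.

Lemma moll_le d x y : 0 < d -> moll d x y <= d^-1 ^+ 3.
Proof.
move=> d0; have q : rdist d (sqdist x y) <= d^-1.
  rewrite /rdist lef_pV2 ?posrE//; last first.
    by rewrite sqrtr_gt0 ltr_wpDl ?sqdist_ge0// exprn_gt0.
  have {1}-> : d = Num.sqrt (d ^+ 2) by rewrite sqrtr_sqr gtr0_norm.
  by rewrite ler_wsqrtr// lerDr sqdist_ge0.
have -> : d^-1 ^+ 3 = d ^+ 4 * d^-1 ^+ 7 by field; rewrite gt_eqF.
rewrite /moll ler_wpM2l ?exprn_ge0 ?(ltW d0)// lerXn2r ?nnegrE ?rdist_ge0 ?invr_ge0 ?(ltW d0)//.
Qed.

Lemma moll_near_ge d x y : 0 < d -> box x d y -> d^-1 ^+ 3 / 128 <= moll d x y.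
Proof.
move=> d0 [h1 h2 h3].
have e3 : sqdist x y <= 3 * d ^+ 2.
  have sq (a b : R) : `|a - b| < d -> (b - a) ^+ 2 <= d ^+ 2.
    rewrite distrC => h; rewrite -real_normK ?num_real//.
    by rewrite lerXn2r ?nnegrE// ltW.
  rewrite /sqdist enorm_sqrE /=; have := sq _ _ h1; have := sq _ _ h2; have := sq _ _ h3; lra.
have q : (2 * d)^-1 <= rdist d (sqdist x y).
  rewrite /rdist lef_pV2 ?posrE ?mulr_gt0//; last first.
    by rewrite sqrtr_gt0 ltr_wpDl ?sqdist_ge0// exprn_gt0.
  rewrite -[leRHS](@ger0_norm _ (2 * d)) ?mulr_ge0 ?(ltW d0)// -sqrtr_sqr ler_wsqrtr//.
  rewrite exprMn; lra.
have -> : d^-1 ^+ 3 / 128 = d ^+ 4 * (2 * d)^-1 ^+ 7 by field; rewrite gt_eqF.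
rewrite /moll ler_wpM2l ?exprn_ge0 ?(ltW d0)// lerXn2r ?nnegrE ?rdist_ge0 ?invr_ge0 ?mulr_ge0 ?(ltW d0)//.
Qed.

(** The layer cake again: [moll d x > t] forces [|y-x| < (d^4/t)^(1/7)], and
    [moll] never exceeds [d^-3]. *)
Lemma moll_integral_le : exists2 C : R, 0 < C & forall d x (E : set (mR3 R)), 0 < d ->
  measurable E -> (\int[volume]_(y in E) (moll d x y)%:E <= C%:E)%E.
Proof.
have [C C0 HC] := @layer_cake R (3 / 7) 2 (ltac:(lra)) (ltac:(lra)).
exists (C * 8); first by pos.
move=> d x E d0 mE; have s0 : 0 < d^-1 ^+ 3 by pos.
have -> : C * 8 = C * (8 * d ^+ 3) * d^-1 ^+ 3 by field; rewrite gt_eqF.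
under eq_integral do rewrite -[moll _ _ _]mul1r.
have mm := measurable_moll_section d x.
have mlev t : measurable (E `&` [set y : mR3 R | (t < moll d x y)%R]).
  by apply: measurableI => //; exact: measurable_superlevel.
apply: HC => //.
- by move=> y; exact: moll_ge0.
- by rewrite mulr_ge0// exprn_ge0// ltW.
- move=> t t0 ts; rewrite integral_one//.
  pose rho := (d ^+ 4 / t) `^ (1 / 7).
  have rho0 : 0 < rho by rewrite /rho; pos.
  have -> : 8 * d ^+ 3 * (d^-1 ^+ 3 / t) `^ (3 / 7) = (2 * rho) ^+ 3.
    have -> : (2 * rho) ^+ 3 = 8 * rho ^+ 3 by ring.
    by rewrite -mulrA; congr (_ * _); rewrite /rho; lnfield.
  apply: le_trans (leb3_eball_le x (ltW rho0)); apply: le_measure; rewrite ?inE//.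
    exact: measurable_eball.
  move=> y [_ /= ty]; rewrite /eball /= ltNge; apply: contraTN ty => ry; rewrite -leNgt.
  apply: (le_trans (moll_far_le d0 rho0 ry)).
  by have -> : d ^+ 4 * rho^-1 ^+ 7 = t by rewrite /rho; lnfield.
- move=> t st; rewrite integral_one// (_ : E `&` _ = set0).
    by rewrite measure0 lee_fin mulr_ge0 ?powR_ge0// mulr_ge0// exprn_ge0// ltW.
  apply/seteqP; split=> // y [_ /=]; rewrite ltNge => /negP; apply.
  exact: le_trans (moll_le x y d0) st.
Qed.

(** The part of the mass carried by a cube of half side [d], where [moll] is at
    least [d^-3 / 128]. *)
Lemma moll_integral_ge d x (E : set (mR3 R)) : 0 < d -> measurable E ->
  box x d `<=` E -> (16^-1%:E <= \int[volume]_(y in E) (moll d x y)%:E)%E.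
Proof.
move=> d0 mE bE; have mm := measurable_moll_section d x.
apply: (@le_trans _ _ (\int[volume]_(y in box x d) (moll d x y)%:E)%E); last first.
  apply: ge0_subset_integral => //; first exact: measurable_box.
    exact/measurable_EFinP/measurable_funTS.
  by move=> y _; rewrite lee_fin moll_ge0.
apply: (@le_trans _ _ (\int[volume]_(y in box x d) (d^-1 ^+ 3 / 128)%:E)%E).
  rewrite integral_cst; last exact: measurable_box.
  rewrite [X in (_ * X)%E](leb3_box x (ltW d0)) -EFinM lee_fin.
  have -> : d^-1 ^+ 3 / 128 * (2 * d) ^+ 3 = 16^-1 by field; rewrite gt_eqF.
  by [].
apply: ge0_le_integral => //; first exact: measurable_box.
- by move=> y _; rewrite lee_fin divr_ge0// exprn_ge0// invr_ge0 ltW.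
- exact/measurable_EFinP/measurable_funTS.
- by move=> y yb; rewrite lee_fin moll_near_ge.
Qed.

End mollifier_bounds.

Section halfspaces.
Context {R : realType}.
Implicit Types (A : set (R3 R)).

Lemma volume_plane i (a : R) : volume [set x : R3 R | xcoord i x = a] = 0%E.
Proof.
have m1 (b : R) : measurable ([set b] : set (measurableTypeR R)) by exact: measurable_set1.
case: (ord3P i) => ->.
- rewrite (_ : [set _ | _] = [set a] `*` setT `*` setT).
    rewrite /volume /leb3 /= product_measure1E//; last exact: measurableX.
    by rewrite [X in (X * _)%E]product_measure1E// [X in (X * _ * _)%E]lebesgue_measure_set1 !mul0e.
  by apply/seteqP; split=> x /=; rewrite /xcoord (tnth_nth 0)/=; [move=> ->|case=> -[]].
- rewrite (_ : [set _ | _] = setT `*` [set a] `*` setT).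
    rewrite /volume /leb3 /= product_measure1E//; last exact: measurableX.
    by rewrite [X in (X * _)%E]product_measure1E// [X in (_ * X * _)%E]lebesgue_measure_set1 mule0 mul0e.
  by apply/seteqP; split=> x /=; rewrite /xcoord (tnth_nth 0) inordK//=; tauto.
- rewrite (_ : [set _ | _] = setT `*` setT `*` [set a]).
    rewrite /volume /leb3 /= product_measure1E//; last exact: measurableX.
    by rewrite [X in (_ * X)%E]lebesgue_measure_set1 mule0.
  by apply/seteqP; split=> x /=; rewrite /xcoord (tnth_nth 0) inordK//=; tauto.
Qed.

Lemma measurable_coord_set i (S : set R) : measurable S -> measurable ([set x | S (xcoord i x)] : set (mR3 R)).
Proof.
move=> mS; have mi : measurable_fun setT (id : mR3 R -> mR3 R) by [].
have := @measurable_fun_coord R _ (mR3 R) id i mi measurableT _ mS.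
by rewrite setTI.
Qed.

Definition halfspaces : set (set (R3 R)) :=
  [set A | exists i a, A = [set x | a < xcoord i x]].

(** The three coordinates are measurable for the generated sigma-algebra, hence so
    is the identity, assembled from them. *)
Lemma measurable_halfspaces A : measurable (A : set (mR3 R)) -> <<s halfspaces >> A.
Proof.
move=> mA; pose T := g_sigma_algebraType halfspaces.
have mc i : measurable_fun setT (fun t : T => xcoord i (t : R3 R) : measurableTypeR R).
  apply: (measurability _ (RGenOInfty.measurableE R)).
  move=> _ [_ [a ->] <-]; rewrite setTI; apply: sub_sigma_algebra.
  rewrite (_ : _ @^-1` _ = [set x | a < xcoord i x]); first by exists i, a.
  by apply/seteqP; split=> y /=; rewrite in_itv/= andbT.
have mid : measurable_fun setT (fun t : T => ((xcoord ord0 (t : R3 R), xcoord (inord 1) (t : R3 R)),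
    xcoord (inord 2) (t : R3 R)) : mR3 R).
  by apply: measurable_fun_pair => //; exact: measurable_fun_pair.
have := mid measurableT A mA; rewrite setTI.
rewrite (_ : _ @^-1` A = A)//; apply/seteqP; split=> -[[y1 y2] y3] /=;
by rewrite /xcoord !(tnth_nth 0) !inordK.
Qed.

End halfspaces.

Section finite_measure_tools.
Context {R : realType} d (T : measurableType d) (mu : {measure set T -> \bar R}).
Implicit Types (B E : set T) (U : T -> R) (W : T -> \bar R).

Lemma measure_decreasing_le B (A : (set T)^nat) : measurable B -> (mu B < +oo)%E ->
  (forall n, measurable (A n)) -> nonincreasing_seq A ->
  mu (B `&` \bigcap_n A n) = 0%E ->
  forall e : R, 0 < e -> exists n, (mu (B `&` A n) <= e%:E)%E.
Proof.
move=> mB fB mA dA A0 e e0.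
have : mu \o (fun n => B `&` A n) @ \oo --> mu (\bigcap_n (B `&` A n)).
  apply: nonincreasing_cvg_mu.
  - by apply: le_lt_trans fB; apply: le_measure; rewrite ?inE//; exact: measurableI.
  - by move=> n; exact: measurableI.
  - by apply: bigcap_measurable => // n _; exact: measurableI.
  - by move=> m n mn; apply/subsetPset => x [Bx Ax]; split=> //; exact: (subsetPset _ _ (dA _ _ mn)).
have -> : \bigcap_n (B `&` A n) = B `&` \bigcap_n A n.
  by apply/seteqP; split=> [x h|x [Bx h] n _]; [split=> [|n _]; [case: (h 0%N)|case: (h n)]|split=> //; exact: h].
rewrite A0 => h.
have [N _ HN] : \forall n \near \oo, (mu (B `&` A n) < e%:E)%E.
  by apply: (h [set z | (z < e%:E)%E]); apply: open_ereal_lt'; rewrite lte_fin.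
by exists N; apply/ltW/HN => /=.
Qed.

(** [U W <= lam U^2 + W^2 / (4 lam)], with [W^2 <= C W]: first choose [lam] small,
    then the integral of [W] small. *)
Lemma integral_mul_small B U (K C : R) : measurable B -> measurable_fun B U ->
  (forall x, 0 <= U x) -> (\int[mu]_(x in B) (U x ^+ 2)%:E <= K%:E)%E -> 0 <= K -> 0 < C ->
  forall e : R, 0 < e -> exists2 del : R, 0 < del &
  forall E W, measurable E -> E `<=` B -> measurable_fun E W ->
    (forall x, 0 <= W x)%E -> (forall x, W x <= C%:E)%E -> (\int[mu]_(x in E) W x <= del%:E)%E ->
    (\int[mu]_(x in E) ((U x)%:E * W x) <= e%:E)%E.
Proof.
move=> mB mU U0 UK K0 C0 e e0.
pose lam := e / (2 * (K + 1)).
have lam0 : 0 < lam by rewrite divr_gt0// mulr_gt0// ltr_wpDl.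
exists (e / 2 * (4 * lam) / C); first by rewrite divr_gt0// mulr_gt0// ?divr_gt0// mulr_gt0.
move=> E W mE EB mW W0 WC WE.
have mUE : measurable_fun E U by apply: measurable_funS mU.
have c0 : 0 <= C / (4 * lam) by rewrite divr_ge0// ?(ltW C0)// mulr_ge0// ltW.
apply: (@le_trans _ _ (\int[mu]_(x in E) (lam%:E * (U x ^+ 2)%:E + (C / (4 * lam))%:E * W x))%E).
  apply: ge0_le_integral => //.
  - by move=> x _; rewrite mule_ge0// lee_fin.
  - by apply: emeasurable_funM => //; exact/measurable_EFinP.
  - apply: emeasurable_funD; apply: measurable_funeM => //.
    by apply/measurable_EFinP; exact: measurable_funX.
  move=> x Ex; have := W0 x; have := WC x; case: (W x) => [w|//|//]; rewrite !lee_fin => wC w0.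
  have h : w * w <= C * w by rewrite ler_wpM2r.
  have -> : C / (4 * lam) * w = (C * w) / (4 * lam) by ring.
  apply: (@le_trans _ _ (lam * U x ^+ 2 + (w * w) / (4 * lam))); last first.
    by rewrite lerD2l ler_wpM2r// invr_ge0 mulr_ge0// ltW.
  rewrite -subr_ge0 (_ : _ - _ = lam * (U x - w / (2 * lam)) ^+ 2); last by field; rewrite gt_eqF.
  by rewrite mulr_ge0// ?sqr_ge0// ltW.
rewrite ge0_integralD//; last 4 first.
- by move=> x _; rewrite mule_ge0// lee_fin ?sqr_ge0// ltW.
- by apply: measurable_funeM; apply/measurable_EFinP; exact: measurable_funX.
- by move=> x _; rewrite mule_ge0.
- exact: measurable_funeM.
have mU2 : measurable_fun B (fun x => (U x ^+ 2)%:E).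
  by apply/measurable_EFinP; exact: measurable_funX.
rewrite ge0_integralZl_EFin//; last 3 first.
- by move=> x _; rewrite lee_fin sqr_ge0.
- exact: measurable_funS mU2.
- exact: ltW.
rewrite ge0_integralZl_EFin//.
have h1 : (\int[mu]_(x in E) (U x ^+ 2)%:E <= K%:E)%E.
  apply: le_trans UK; apply: ge0_subset_integral => //.
  by move=> x _; rewrite lee_fin sqr_ge0.
apply: (@le_trans _ _ (lam%:E * K%:E + (C / (4 * lam))%:E * (e / 2 * (4 * lam) / C)%:E)%E).
  by apply: leeD; apply: lee_wpmul2l => //; rewrite lee_fin// ltW.
rewrite -!EFinM -EFinD lee_fin.
have -> : C / (4 * lam) * (e / 2 * (4 * lam) / C) = e / 2.
  by field; rewrite !gt_eqF.
suff : lam * K <= e / 2 by lra.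
rewrite /lam mulrAC ler_pdivrMr ?mulr_gt0 ?ltr_wpDl//; nra.
Qed.

End finite_measure_tools.

#[local] Opaque moll.

Section overlap.
Context {R : realType}.
Variables (B : set (mR3 R)) (U : mR3 R -> R) (V K : R).
Implicit Types (F G E : set (mR3 R)) (d e : R).

Definition mollified_indicator d G (x : mR3 R) : \bar R :=
  (\int[volume]_(y in B `&` G) (moll d x y)%:E)%E.

(** Measures, with density [U], how much of the mollified [G] falls on [F]; for
    complementary sets it tends to [0] with [d]. *)
Definition overlap d F G : \bar R :=
  (\int[volume]_(x in B `&` F) ((U x)%:E * mollified_indicator d G x))%E.

Local Notation h := mollified_indicator.

Hypotheses (mB : measurable B) (BV : (volume B <= V%:E)%E)
  (mU : measurable_fun setT U) (U0 : forall x, 0 <= U x)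
  (UK : (\int[volume]_(x in B) (U x ^+ 2)%:E <= K%:E)%E).

Lemma mollified_indicator_ge0 d G x : 0 < d -> (0 <= h d G x)%E.
Proof. by move=> d0; apply: integral_ge0 => y _; rewrite lee_fin moll_ge0. Qed.

Lemma measurable_mollified_indicator d G E : 0 < d -> measurable G -> measurable E ->
  measurable_fun E (h d G).
Proof.
move=> d0 mG mE; apply: measurable_funTS.
apply: (@measurable_ge0_parameter_integral _ _ _ volume
   (fun z : mR3 R * mR3 R => moll d (z.1 : R3 R) (z.2 : R3 R))).
- exact: measurableI.
- exact: measurable_moll.
- by move=> z; exact: moll_ge0.
Qed.

Let mUh d F G E : 0 < d -> measurable G -> measurable E ->
  measurable_fun E (fun x => (U x)%:E * h d G x)%E.
Proof.
move=> d0 mG mE; apply: emeasurable_funM.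
  by apply/measurable_EFinP; exact: measurable_funTS.
exact: measurable_mollified_indicator.
Qed.

Let Uh0 d G x : 0 < d -> (0 <= (U x)%:E * h d G x)%E.
Proof. by move=> d0; rewrite mule_ge0 ?lee_fin// mollified_indicator_ge0. Qed.

Let mm d E x : measurable_fun E (fun y : mR3 R => (moll d x y)%:E).
Proof. by apply/measurable_EFinP/measurable_funTS; exact: measurable_moll_section. Qed.

Let mm0 d E x : 0 < d -> forall y, E y -> (0 <= (moll d x y)%:E)%E.
Proof. by move=> d0 y _; rewrite lee_fin moll_ge0. Qed.

Lemma mollified_indicator_le d F G x : 0 < d -> measurable F -> measurable G ->
  F `<=` G -> (h d F x <= h d G x)%E.
Proof.
move=> d0 mF mG FG; apply: ge0_subset_integral => //.
- exact: measurableI.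
- exact: measurableI.
- by apply: mm0.
- exact: setIS.
Qed.

Lemma mollified_indicatorU d F G x : 0 < d -> measurable F -> measurable G ->
  (h d (F `|` G) x <= h d F x + h d G x)%E.
Proof.
move=> d0 mF mG; rewrite /h.
rewrite (_ : B `&` (F `|` G) = (B `&` F) `|` (B `&` (G `\` F))); last first.
  by rewrite -setIUr; congr (_ `&` _); apply/seteqP; split=> y /=; [have := pselect (F y)|]; tauto.
rewrite ge0_integral_setU//.
- apply: leeD => //; apply: ge0_subset_integral => //; try by apply: measurableI => //; exact: measurableD.
  + by apply: mm0.
  + by move=> y [? []].
- exact: measurableI.
- by apply: measurableI => //; exact: measurableD.
- by apply: mm0.
- by apply/disj_setPS => y /= [[? ?] [? []]].
Qed.

Lemma overlap_le d F G F' G' : 0 < d -> measurable F -> measurable G -> measurable F' ->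
  measurable G' -> F `<=` F' -> G `<=` G' -> (overlap d F G <= overlap d F' G')%E.
Proof.
move=> d0 mF mG mF' mG' FF' GG'.
apply: (@le_trans _ _ (overlap d F G')).
  apply: ge0_le_integral => //.
  - exact: measurableI.
  - by move=> x _; exact: Uh0.
  - by apply: mUh => //; exact: measurableI.
  - by apply: mUh => //; exact: measurableI.
  by move=> x _; apply: lee_wpmul2l; [rewrite lee_fin|exact: mollified_indicator_le].
apply: ge0_subset_integral => //.
- exact: measurableI.
- exact: measurableI.
- by apply: mUh => //; exact: measurableI.
- by move=> x _; exact: Uh0.
- exact: setIS.
Qed.

Lemma overlapUl d F F' G : 0 < d -> measurable F -> measurable F' -> measurable G ->
  (overlap d (F `|` F') G <= overlap d F G + overlap d F' G)%E.
Proof.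
move=> d0 mF mF' mG; rewrite /overlap.
rewrite (_ : B `&` (F `|` F') = (B `&` F) `|` (B `&` (F' `\` F))); last first.
  by rewrite -setIUr; congr (_ `&` _); apply/seteqP; split=> y /=; [have := pselect (F y)|]; tauto.
have mB1 : measurable (B `&` F) by exact: measurableI.
have mB2 : measurable (B `&` (F' `\` F)) by apply: measurableI => //; exact: measurableD.
rewrite ge0_integral_setU//.
- apply: leeD => //; apply: ge0_subset_integral => //.
  + exact: measurableI.
  + by apply: mUh => //; exact: measurableI.
  + by move=> x _; exact: Uh0.
  + by move=> y [? []].
- by apply: mUh => //; exact: measurableU.
- by move=> x _; exact: Uh0.
- by apply/disj_setPS => y /= [[? ?] [? []]].
Qed.

Lemma overlapUr d F G G' : 0 < d -> measurable F -> measurable G -> measurable G' ->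
  (overlap d F (G `|` G') <= overlap d F G + overlap d F G')%E.
Proof.
move=> d0 mF mG mG'; rewrite /overlap.
have mBF : measurable (B `&` F) by exact: measurableI.
rewrite -ge0_integralD//; try by move=> x _; exact: Uh0.
- apply: ge0_le_integral => //; try by move=> x _; exact: Uh0.
  + by apply: mUh => //; exact: measurableU.
  + by apply: emeasurable_funD; exact: mUh.
  move=> x _; rewrite -ge0_muleDr ?mollified_indicator_ge0//.
  by apply: lee_wpmul2l; [rewrite lee_fin|exact: mollified_indicatorU].
- exact: mUh.
- exact: mUh.
Qed.

Lemma overlap_small e : 0 < e -> exists2 del : R, 0 < del &
  forall d F G, 0 < d -> measurable F -> measurable G ->
    (\int[volume]_(x in B `&` F) h d G x <= del%:E)%E -> (overlap d F G <= e%:E)%E.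
Proof.
move=> e0; have [C C0 HC] := @moll_integral_le R.
have K0 : 0 <= K.
  by rewrite -lee_fin; apply: le_trans UK; apply: integral_ge0 => x _; rewrite lee_fin sqr_ge0.
have [del del0 H] := integral_mul_small mB (measurable_funTS mU) U0 UK K0 C0 e0.
exists del => // d F G d0 mF mG hd; apply: H => //.
- exact: measurableI.
- by apply: measurable_mollified_indicator => //; exact: measurableI.
- by move=> x; exact: mollified_indicator_ge0.
- by move=> x; apply: HC => //; exact: measurableI.
Qed.

(** When the first set is small this holds because mollified indicators are bounded,
    when the second one is small because mollification preserves the integral up
    to a constant. *)
Lemma overlap_small_set e : 0 < e -> exists2 del : R, 0 < del &
  forall d F, 0 < d -> measurable F -> (volume (B `&` F) <= del%:E)%E ->
    (overlap d F setT <= e%:E)%E /\ (overlap d setT F <= e%:E)%E.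
Proof.
move=> e0; have [C C0 HC] := @moll_integral_le R.
have [del del0 H] := overlap_small e0.
exists (del / C); first by rewrite divr_gt0.
move=> d F d0 mF Fd; have mBF : measurable (B `&` F) by exact: measurableI.
have bound : (\int[volume]_(x in B `&` F) h d setT x <= del%:E)%E.
  apply: (@le_trans _ _ (\int[volume]_(x in B `&` F) C%:E)%E).
    apply: ge0_le_integral => //.
    - by move=> x _; exact: mollified_indicator_ge0.
    - exact: measurable_mollified_indicator.
    - by move=> x _; apply: HC => //; rewrite setIT.
  rewrite integral_cst//; apply: (@le_trans _ _ (C%:E * (del / C)%:E)%E).
    by apply: lee_wpmul2l => //; rewrite lee_fin ltW.
  by rewrite -EFinM mulrC divfK ?gt_eqF.
split; apply: H; [exact: d0|exact: mF|exact: measurableT|exact: bound|exact: d0|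
  exact: measurableT|exact: mF|].
have sw := @tonelli_swap _ _ _ volume (fun z : mR3 R * mR3 R => moll d (z.1 : R3 R) (z.2 : R3 R))
  (B `&` setT) (B `&` F) (measurableI _ _ mB measurableT) mBF (measurable_moll d)
  (fun z => moll_ge0 z.1 z.2 d0).
apply: (le_trans _ bound); rewrite [leLHS]sw le_eqVlt; apply/orP; left; apply/eqP.
apply: eq_integral => x _; rewrite /h; apply: eq_integral => y _; by rewrite mollC.
Qed.

Lemma overlap0 d F : overlap d set0 F = 0%E /\ overlap d F set0 = 0%E.
Proof.
rewrite /overlap setI0 integral_set0; split=> //; apply: integral0_eq => x _.
by rewrite /h setI0 integral_set0 mule0.
Qed.

(** At distance at least [rho] the mollifier is at most [d^4 rho^-7]. *)
Lemma overlap_far e rho F G : 0 < e -> 0 < rho -> measurable F -> measurable G ->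
  (forall x y, F x -> G y -> rho <= enorm ((y : R3 R) - (x : R3 R))) ->
  exists2 d0, 0 < d0 & forall d, 0 < d -> d <= d0 -> (overlap d F G <= e%:E)%E.
Proof.
move=> e0 rho0 mF mG FG; have [del del0 H] := overlap_small e0.
have V0 : 0 <= V by rewrite -lee_fin; exact: le_trans BV.
pose c := rho^-1 ^+ 7 * (V ^+ 2 + 1).
have c0 : 0 < c by rewrite mulr_gt0 ?exprn_gt0 ?invr_gt0// ltr_wpDl ?sqr_ge0.
exists (Num.min 1 (del / c)); first by rewrite lt_min ltr01 divr_gt0.
move=> d dp; rewrite le_min => /andP[d1 dd]; apply: H => //.
have mBF : measurable (B `&` F) by exact: measurableI.
have mBG : measurable (B `&` G) by exact: measurableI.
have BF : (volume (B `&` F) <= V%:E)%E.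
  by apply: le_trans BV; apply: le_measure; rewrite ?inE.
have BG : (volume (B `&` G) <= V%:E)%E.
  by apply: le_trans BV; apply: le_measure; rewrite ?inE.
have q0 : 0 <= d ^+ 4 * rho^-1 ^+ 7 by rewrite mulr_ge0 ?exprn_ge0 ?invr_ge0 ?(ltW dp) ?(ltW rho0).
have cstle E : measurable E -> (volume E <= V%:E)%E -> forall q : R, 0 <= q ->
    (\int[volume]_(x in E) q%:E <= (q * V)%:E)%E.
  by move=> mE EV q q00; rewrite integral_cst// EFinM; apply: lee_wpmul2l.
apply: (@le_trans _ _ (\int[volume]_(x in B `&` F) (d ^+ 4 * rho^-1 ^+ 7 * V)%:E)%E).
  apply: ge0_le_integral => //.
  - by move=> x _; exact: mollified_indicator_ge0.
  - exact: measurable_mollified_indicator.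
  move=> x [_ Fx]; apply: (@le_trans _ _ (\int[volume]_(y in B `&` G) (d ^+ 4 * rho^-1 ^+ 7)%:E)%E).
    apply: ge0_le_integral => //; first by apply: mm0.
    by move=> y [_ Gy]; rewrite lee_fin; apply: moll_far_le => //; exact: FG.
  exact: cstle.
apply: (le_trans (cstle _ mBF BF _ _)); first by rewrite mulr_ge0.
rewrite lee_fin; apply: (@le_trans _ _ (d * c)); last by rewrite -ler_pdivlMr.
have d4 : d ^+ 4 <= d by rewrite -[leRHS]expr1 ler_wiXn2l// ltW.
apply: (@le_trans _ _ (d ^+ 4 * c)).
  have -> : d ^+ 4 * rho^-1 ^+ 7 * V * V = d ^+ 4 * (rho^-1 ^+ 7 * V ^+ 2) by ring.
  rewrite /c ler_wpM2l ?exprn_ge0 ?(ltW dp)// ler_wpM2l ?exprn_ge0 ?invr_ge0 ?(ltW rho0)//.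
  by rewrite lerDl.
by rewrite ler_wpM2r// ltW.
Qed.

#[local] Opaque overlap.

Definition overlap_vanishes F := measurable F /\ forall e, 0 < e ->
  exists2 d0, 0 < d0 & forall d, 0 < d -> d <= d0 ->
    (overlap d F (~` F) <= e%:E)%E /\ (overlap d (~` F) F <= e%:E)%E.

Lemma overlap_vanishesC F : overlap_vanishes F -> overlap_vanishes (~` F).
Proof.
move=> [mF H]; split; first exact: measurableC.
move=> e /H[d0 d00 Hd]; exists d0; first exact: d00.
move=> d dp dd; rewrite setCK; have [h1 h2] := Hd d dp dd; split; [exact: h2|exact: h1].
Qed.

(** [overlap] is monotone and subadditive in each set, and the complement of a union
    is contained in both complements. *)
Lemma overlap_vanishesU F G : overlap_vanishes F -> overlap_vanishes G ->
  overlap_vanishes (F `|` G).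
Proof.
move=> [mF HF] [mG HG]; have mFG : measurable (F `|` G) by exact: measurableU.
split=> [|e e0]; first exact: mFG.
have e20 : 0 < e / 2 by rewrite divr_gt0.
have [a a0 Ha] := HF _ e20; have [b b0 Hb] := HG _ e20.
exists (Num.min a b); first by rewrite lt_min a0.
move=> d dp; rewrite le_min => /andP[da db].
have [F1 F2] := Ha d dp da; have [G1 G2] := Hb d dp db.
have mCFG := measurableC mFG; have mCF := measurableC mF; have mCG := measurableC mG.
have -> : e%:E = ((e / 2)%:E + (e / 2)%:E)%E by rewrite -EFinD -splitr.
split.
  apply: (le_trans (overlapUl dp mF mG mCFG)); apply: leeD.
    by apply: le_trans F1; apply: overlap_le => //; apply: subsetC => x; left.
  by apply: le_trans G1; apply: overlap_le => //; apply: subsetC => x; right.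
apply: (le_trans (overlapUr dp mCFG mF mG)); apply: leeD.
  by apply: le_trans F2; apply: overlap_le => //; apply: subsetC => x; left.
by apply: le_trans G2; apply: overlap_le => //; apply: subsetC => x; right.
Qed.

Lemma overlap_vanishes0 : overlap_vanishes set0.
Proof.
split=> // e e0; exists 1 => // d dp _.
have [-> _] := overlap0 d (~` set0); have [_ ->] := overlap0 d (~` set0).
by rewrite lee_fin ltW.
Qed.

(** The union differs from a finite one by a set of small measure. *)
Lemma overlap_vanishes_bigcup (F : (set (mR3 R))^nat) :
  (forall n, overlap_vanishes (F n)) -> overlap_vanishes (\bigcup_n F n).
Proof.
move=> HF; have mF n : measurable (F n) by case: (HF n).
have mbF : measurable (\bigcup_n F n) by exact: bigcup_measurable.
have finU n : overlap_vanishes (\big[setU/set0]_(i < n) F i).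
  elim: n => [|n IH]; first by rewrite big_ord0; exact: overlap_vanishes0.
  rewrite big_ord_recr; exact: overlap_vanishesU IH (HF n).
split=> // e e0; have e20 : 0 < e / 2 by rewrite divr_gt0.
have [del del0 H] := overlap_small_set e20.
pose E n := \bigcup_n F n `\` \big[setU/set0]_(i < n) F i.
have mA n : measurable (\big[setU/set0]_(i < n) F i) by case: (finU n).
have mE n : measurable (E n) by exact: measurableD.
have [N HN] : exists n, (volume (B `&` E n) <= del%:E)%E.
  apply: measure_decreasing_le => //.
  - exact: le_lt_trans BV (ltry _).
  - move=> m n mn; apply/subsetPset; apply: setDS; exact: subset_bigsetU.
  rewrite (_ : _ `&` _ = set0) ?measure0//; apply/seteqP; split=> // x [_ hx].
  have [[n _ Fx] _] := hx 0%N I; have [_] := hx n.+1 I; apply.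
  by rewrite big_ord_recr; right.
have [_ /(_ _ e20)[a a0 Ha]] := finU N; exists a => // d dp da.
have [A1 A2] := Ha d dp da; have [E1 E2] := H d (E N) dp (mE N) HN.
set A := \big[setU/set0]_(i < N) F i in A1 A2.
have mAN : measurable A := mA N.
have FAE : \bigcup_n F n = A `|` E N.
  by rewrite /E setDUK//; exact: bigsetU_bigcup.
rewrite FAE; have mAE : measurable (A `|` E N) by exact: measurableU.
have mCAE := measurableC mAE; have mCA := measurableC mAN.
have -> : e%:E = ((e / 2)%:E + (e / 2)%:E)%E by rewrite -EFinD -splitr.
split.
  apply: (le_trans (overlapUl dp mAN (mE N) mCAE)); apply: leeD.
    by apply: le_trans A1; apply: overlap_le => //; apply: subsetC => x; left.
  by apply: le_trans E1; apply: overlap_le.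
apply: (le_trans (overlapUr dp mCAE mAN (mE N))); apply: leeD.
  by apply: le_trans A2; apply: overlap_le => //; apply: subsetC => x; left.
by apply: le_trans E2; apply: overlap_le.
Qed.

(** Outside a thin slab around its boundary, the half-space is at a positive
    distance from its complement. *)
Lemma overlap_vanishes_halfspace i (a : R) :
  overlap_vanishes [set x | a < xcoord i (x : R3 R)].
Proof.
set H := [set x | _].
have mH : measurable H.
  by apply: (@measurable_coord_set _ i [set t | a < t]); rewrite -set_itvoy; exact: measurable_itv.
split=> // e e0; have e20 : 0 < e / 2 by rewrite divr_gt0.
have [del del0 Hs] := overlap_small_set e20.
pose slab n : set (mR3 R) := [set x | `|xcoord i (x : R3 R) - a| < n.+1%:R^-1].
have mslab n : measurable (slab n).
  apply: (@measurable_coord_set _ i [set t | `|t - a| < n.+1%:R^-1]).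
  rewrite (_ : [set _ | _] = ball a n.+1%:R^-1); last first.
    by apply/seteqP; split=> t; rewrite /ball/= distrC.
  exact: measurable_ball.
have [N HN] : exists n, (volume (B `&` slab n) <= del%:E)%E.
  apply: measure_decreasing_le => //.
  - exact: le_lt_trans BV (ltry _).
  - move=> m n mn; apply/subsetPset => x /= /lt_le_trans; apply.
    by rewrite lef_pV2 ?posrE// ler_nat.
  apply/eqP; rewrite eq_le measure_ge0 andbT -(volume_plane i a).
  apply: le_measure; rewrite ?inE.
  - by apply: measurableI => //; exact: bigcap_measurable.
  - by apply: (@measurable_coord_set _ i [set a]); exact: measurable_set1.
  move=> x [_ hx] /=; apply/eqP; rewrite -subr_eq0 -normr_eq0 eq_le normr_ge0 andbT.
  apply/ler_addgt0Pl => t t0; rewrite addr0.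
  have := hx (Num.truncn t^-1) I; move=> /= /ltW/le_trans; apply.
  by rewrite -[leRHS]invrK lef_pV2 ?posrE ?invr_gt0// ltW// truncnS_gt.
have rho0 : 0 < N.+1%:R^-1 :> R by rewrite invr_gt0.
have far F G : measurable F -> measurable G ->
    (forall x y, F x -> G y -> N.+1%:R^-1 <= `|xcoord i (y : R3 R) - xcoord i (x : R3 R)|) ->
    exists2 d0, 0 < d0 & forall d, 0 < d -> d <= d0 -> (overlap d F G <= (e / 2)%:E)%E.
  move=> mF mG FG; apply: (@overlap_far _ N.+1%:R^-1) => // x y Fx Gy.
  apply: (le_trans (FG x y Fx Gy)); rewrite -xcoordB; exact: xcoord_le_enorm.
have mCH := measurableC mH.
have [a1 a10 H1] : exists2 d0, 0 < d0 & forall d, 0 < d -> d <= d0 ->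
    (overlap d (H `\` slab N) (~` H) <= (e / 2)%:E)%E.
  apply: far => //; first exact: measurableD.
  move=> x y [Hx /= /negP]; rewrite -leNgt => sx /negP; rewrite -leNgt => Hy.
  rewrite /H/= in Hx; apply: (le_trans sx).
  by rewrite ger0_norm ?subr_ge0 ?(ltW Hx)// distrC ger0_norm ?subr_ge0 ?lerB// (le_trans Hy)// ltW.
have [a2 a20 H2] : exists2 d0, 0 < d0 & forall d, 0 < d -> d <= d0 ->
    (overlap d (~` H `\` slab N) H <= (e / 2)%:E)%E.
  apply: far => //; first exact: measurableD.
  move=> x y [/negP + /= /negP]; rewrite -leNgt => Hx; rewrite -leNgt => sx Hy.
  rewrite /H/= in Hy; apply: (le_trans sx).
  by rewrite distrC ger0_norm ?subr_ge0// ger0_norm ?subr_ge0 ?lerB// ltW// (le_lt_trans Hx).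
exists (Num.min a1 a2); first by rewrite lt_min a10.
move=> d dp; rewrite le_min => /andP[d1 d2].
have [S1 S2] := Hs d _ dp (mslab N) HN.
have halve F G : measurable F -> measurable G -> (overlap d (F `\` slab N) G <= (e / 2)%:E)%E ->
    (overlap d F G <= e%:E)%E.
  move=> mF mG h1; have mFs : measurable (F `\` slab N) by exact: measurableD.
  have -> : e%:E = ((e / 2)%:E + (e / 2)%:E)%E by rewrite -EFinD -splitr.
  apply: (@le_trans _ _ (overlap d ((F `\` slab N) `|` slab N) G)).
    apply: overlap_le => //; first exact: measurableU.
    by move=> x Fx; have [|] := pselect (slab N x); [right|left].
  apply: (le_trans (overlapUl dp mFs (mslab N) mG)); apply: leeD; first exact: h1.
  by apply: le_trans S1; apply: overlap_le.
by split; apply: halve; [|exact: mCH|exact: H1|exact: mCH| |exact: H2].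
Qed.

Lemma measurable_overlap_vanishes F : measurable F -> overlap_vanishes F.
Proof.
move=> /measurable_halfspaces; apply; split.
  split; first exact: overlap_vanishes0.
    by move=> A; rewrite setTD; exact: overlap_vanishesC.
  exact: overlap_vanishes_bigcup.
by move=> _ [i [a ->]]; exact: overlap_vanishes_halfspace.
Qed.

End overlap.

(** * Almost everywhere bounds from mollified bounds *)

Section mollified_comparison.
Context {R : realType}.
Variables (B : set (mR3 R)) (v : mR3 R -> R) (H : mR3 R -> \bar R) (V K : R).

Hypotheses (mB : measurable B) (BV : (volume B <= V%:E)%E)
  (mv : measurable_fun setT v)
  (vK : (\int[volume]_(x in B) (v x ^+ 2)%:E <= K%:E)%E)
  (mH : measurable_fun B H) (H0 : forall x, (0 <= H x)%E).

Let P x := Num.max (v x) 0.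
Let N x := Num.max (- v x) 0.

Let mP : measurable_fun setT P. Proof. exact: measurable_maxr. Qed.

Let mN : measurable_fun setT N.
Proof. by apply: measurable_maxr => //; exact: measurableT_comp. Qed.

Let P0 x : 0 <= P x. Proof. by rewrite /P le_max lexx orbT. Qed.

Let N0 x : 0 <= N x. Proof. by rewrite /N le_max lexx orbT. Qed.

Let square_part (w : mR3 R -> R) : measurable_fun setT w ->
  (forall x, `|w x| <= `|v x|) -> (\int[volume]_(x in B) (w x ^+ 2)%:E <= K%:E)%E.
Proof.
move=> mw wv; apply: le_trans vK; apply: ge0_le_integral => //.
- by move=> x _; rewrite lee_fin sqr_ge0.
- by apply/measurable_EFinP/measurable_funX; exact: measurable_funTS.
- by apply/measurable_EFinP/measurable_funX; exact: measurable_funTS.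
move=> x _; rewrite lee_fin -(real_normK (num_real (w x))) -(real_normK (num_real (v x))).
by rewrite lerXn2r ?nnegrE.
Qed.

Let PK : (\int[volume]_(x in B) (P x ^+ 2)%:E <= K%:E)%E.
Proof.
apply: square_part => // x; rewrite ger0_norm// /P ge_max normr_ge0 andbT; exact: ler_norm.
Qed.

Let NK : (\int[volume]_(x in B) (N x ^+ 2)%:E <= K%:E)%E.
Proof.
apply: square_part => // x; rewrite ger0_norm// /N ge_max normr_ge0 andbT -normrN; exact: ler_norm.
Qed.

(** Uses the symmetry of the mollifier. *)
Lemma overlap_swap (U : mR3 R -> R) d G : 0 < d -> measurable_fun setT U -> (forall x, 0 <= U x) ->
  measurable G -> G `<=` B ->
  (overlap B U d setT G = \int[volume]_(y in G) \int[volume]_(x in B) (U x * moll d y x)%:E)%E.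
Proof.
move=> d0 mU U0 mG GB; rewrite /overlap /mollified_indicator setIT (setIidr GB).
have mUm : measurable_fun setT (fun z : mR3 R * mR3 R => U z.1 * moll d (z.1 : R3 R) (z.2 : R3 R)).
  by apply: measurable_funM; [exact: measurableT_comp|exact: measurable_moll].
transitivity (\int[volume]_(x in B) \int[volume]_(y in G) (U x * moll d x y)%:E)%E.
  apply: eq_integral => x _; rewrite -ge0_integralZl_EFin; first by [].
  - exact: mG.
  - by move=> y _; rewrite lee_fin moll_ge0.
  - by apply/measurable_EFinP/measurable_funTS; exact: measurable_moll_section.
  - exact: U0.
have sw := @tonelli_swap _ _ _ volume _ B G mB mG mUm
  (fun z => mulr_ge0 (U0 z.1) (moll_ge0 z.1 z.2 d0)).
rewrite [LHS]sw; apply: eq_integral => y _; apply: eq_integral => x _.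
by rewrite mollC.
Qed.

(** Integrate the hypothesis over [G].  On the left the mollified positive part
    keeps at least [1/16] of its mass on [G], up to an overlap of [G] with its
    complement; on the right the mollified negative part, which vanishes on [G],
    only contributes such an overlap. *)
Lemma integral_le_of_mollified_le G : measurable G -> G `<=` B ->
  (forall x, G x -> 0 <= v x) ->
  (forall e : R, 0 < e -> exists2 d0, 0 < d0 & forall d, 0 < d -> d <= d0 ->
    forall x, G x -> box (x : R3 R) d `<=` B /\
    (\int[volume]_(y in B) (P y * moll d x y)%:E <=
     \int[volume]_(y in B) (N y * moll d x y)%:E + (H x + e%:E))%E) ->
  (16^-1%:E * \int[volume]_(x in G) (P x)%:E <= \int[volume]_(x in G) H x)%E.
Proof.
move=> mG GB vG HG; have V0 : 0 <= V by rewrite -lee_fin; exact: le_trans BV.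
have GV : (volume G <= V%:E)%E by apply: le_trans BV; apply: le_measure; rewrite ?inE.
have mHG : measurable_fun G H by exact: measurable_funS mH.
apply/lee_addgt0Pr => e' e'0.
(* two overlaps of size [e], and [e] times the measure of [G] *)
pose e := e' / (V + 2); have e0 : 0 < e by rewrite divr_gt0// ltr_wpDl.
have [_ /(_ _ e0)[dP dP0 HP]] := measurable_overlap_vanishes mB BV mP P0 PK mG.
have [_ /(_ _ e0)[dN dN0 HN]] := measurable_overlap_vanishes mB BV mN N0 NK mG.
have [d0 d00 HG0] := HG _ e0.
pose d := Num.min dP (Num.min dN d0).
have d_gt0 : 0 < d by rewrite !lt_min dP0 dN0.
have [dleP dleN dle0] : [/\ d <= dP, d <= dN & d <= d0] by rewrite /d !ge_min !lexx !orbT.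
have [P1 _] := HP d d_gt0 dleP; have [_ N2] := HN d d_gt0 dleN.
have mCG := measurableC mG.
have stepA : (16^-1%:E * \int[volume]_(x in G) (P x)%:E <= overlap B P d setT G + e%:E)%E.
  apply: (@le_trans _ _ (overlap B P d G setT)).
    rewrite /overlap (setIidr GB) -ge0_integralZl_EFin//; last 2 first.
    - by move=> x _; rewrite lee_fin.
    - by apply/measurable_EFinP; exact: measurable_funTS.
    apply: ge0_le_integral => //.
    - by move=> x _; rewrite -EFinM lee_fin mulr_ge0// invr_ge0.
    - by apply: measurable_funeM; apply/measurable_EFinP; exact: measurable_funTS.
    - apply: emeasurable_funM; first by apply/measurable_EFinP; exact: measurable_funTS.
      exact: measurable_mollified_indicator.
    move=> x Gx; rewrite muleC; apply: lee_wpmul2l; first by rewrite lee_fin.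
    rewrite /mollified_indicator setIT; apply: moll_integral_ge => //.
    by have [] := HG0 d d_gt0 dle0 x Gx.
  rewrite -[X in (overlap _ _ _ G X <= _)%E](setUv G); apply: (le_trans (overlapUr mB mP P0 d_gt0 mG mG mCG)).
  by apply: leeD P1; exact: overlap_le.
have stepC : (overlap B N d setT G <= e%:E)%E.
  rewrite -(setUv G); apply: (le_trans (overlapUl mB mN N0 d_gt0 mG mCG mG)).
  rewrite [X in (X + _)%E](_ : _ = 0%E) ?add0e//.
  rewrite /overlap; apply: integral0_eq => x [_ Gx].
  by rewrite /N max_r ?mul0e// oppr_le0 vG.
have stepB : (overlap B P d setT G <= overlap B N d setT G + \int[volume]_(x in G) H x + (e * V)%:E)%E.
  have mint (U : mR3 R -> R) : measurable_fun setT U -> (forall x, 0 <= U x) ->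
      measurable_fun G (fun y => \int[volume]_(x in B) (U x * moll d y x)%:E)%E.
    move=> mU U0; apply: measurable_funTS.
    apply: (@measurable_ge0_parameter_integral _ _ _ volume
       (fun z : mR3 R * mR3 R => U z.2 * moll d (z.1 : R3 R) (z.2 : R3 R))) => //.
      by apply: measurable_funM; [exact: measurableT_comp|exact: measurable_moll].
    by move=> z; rewrite mulr_ge0// moll_ge0.
  have int0 (U : mR3 R -> R) : (forall x, 0 <= U x) -> forall y,
      (0 <= \int[volume]_(x in B) (U x * moll d y x)%:E)%E.
    by move=> U0 y; apply: integral_ge0 => x _; rewrite lee_fin mulr_ge0// moll_ge0.
  rewrite !overlap_swap//.
  have -> : ((e * V)%:E = e%:E * V%:E)%E by [].
  apply: (@le_trans _ _ (\int[volume]_(y in G) (\int[volume]_(x in B) (N x * moll d y x)%:E +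
     (H y + e%:E)))%E).
    apply: ge0_le_integral => //.
    - by move=> y _; exact: int0.
    - exact: mint.
    - by apply: emeasurable_funD; [exact: mint|exact: emeasurable_funD].
    by move=> y Gy; have [_] := HG0 d d_gt0 dle0 y Gy.
  have e0' : (0 <= e%:E)%E by rewrite lee_fin ltW.
  rewrite ge0_integralD//; last 4 first.
  - by move=> y _; exact: int0.
  - exact: mint.
  - by move=> y _; rewrite adde_ge0.
  - exact: emeasurable_funD.
  rewrite -[leRHS]addeA.
  apply: leeD.
    exact: lexx.
  rewrite ge0_integralD//; apply: leeD; first exact: lexx.
  rewrite integral_cst//.
  exact: lee_wpmul2l.
apply: (le_trans stepA).
apply: (@le_trans _ _ (e%:E + \int[volume]_(x in G) H x + (e * V)%:E + e%:E)%E).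
  by apply: leeD => //; apply: (le_trans stepB); apply: leeD => //; exact: leeD.
have -> : e' = e + e * V + e by rewrite /e; field; rewrite gt_eqF// ltr_wpDl.
by rewrite [(e%:E + _)%E]addeC !EFinD -!addeA.
Qed.

(** On the set where [v > 16 H], the previous inequality says that the integral of
    [v] is at most that of [16 H], so this set is negligible. *)
Lemma ae_le_of_mollified_le F : measurable F -> F `<=` B ->
  (forall e : R, 0 < e -> exists2 d0, 0 < d0 & forall d, 0 < d -> d <= d0 ->
    forall x, F x -> box (x : R3 R) d `<=` B /\
    (\int[volume]_(y in B) (P y * moll d x y)%:E <=
     \int[volume]_(y in B) (N y * moll d x y)%:E + (H x + e%:E))%E) ->
  {ae volume, forall x, F x -> ((v x)%:E <= 16%:E * H x)%E}.
Proof.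
move=> mF FB HF.
pose G := F `&` [set x | (16%:E * H x < (v x)%:E)%E].
have mHF : measurable_fun F (fun x => 16%:E * H x)%E.
  by apply: measurable_funeM; exact: measurable_funS mH.
have mvF : measurable_fun F (fun x => (v x)%:E).
  by apply/measurable_EFinP; exact: measurable_funTS.
have mG : measurable G by exact: measurable_lte.
have GF : G `<=` F by move=> x [].
have GB : G `<=` B by exact: subset_trans FB.
have H16 x : (0 <= 16%:E * H x)%E by rewrite mule_ge0// lee_fin.
have vG x : G x -> P x = v x.
  by move=> [_ /= h]; rewrite /P max_l// -lee_fin; apply: le_trans (ltW h).
have key : (16^-1%:E * \int[volume]_(x in G) (P x)%:E <= \int[volume]_(x in G) H x)%E.
  apply: integral_le_of_mollified_le => //.
    by move=> x Gx; rewrite -vG.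
  move=> e /HF[d0 d00 h]; exists d0 => // d dp dd x [Fx _]; exact: h.
have mPG : measurable_fun G (fun x => (P x)%:E) by apply/measurable_EFinP; exact: measurable_funTS.
have mHG : measurable_fun G (fun x => 16%:E * H x)%E by exact: measurable_funS mHF.
have finP : (\int[volume]_(x in G) (P x)%:E \is a fin_num)%E.
  rewrite ge0_fin_numE; last by apply: integral_ge0 => x _; rewrite lee_fin.
  apply: (@le_lt_trans _ _ (\int[volume]_(x in B) (1 + (P x ^+ 2)%:E))%E).
    apply: (@le_trans _ _ (\int[volume]_(x in B) (P x)%:E)%E).
      apply: ge0_subset_integral => //; last by move=> x _; rewrite lee_fin.
      by apply/measurable_EFinP; exact: measurable_funTS.
    apply: ge0_le_integral => //.
    - by move=> x _; rewrite lee_fin.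
    - by apply/measurable_EFinP; exact: measurable_funTS.
    - apply: emeasurable_funD => //; apply/measurable_EFinP/measurable_funX; exact: measurable_funTS.
    - move=> x _; rewrite lee_fin; have := sqr_ge0 (P x - 1); rewrite sqrrB1; have := P0 x; lra.
  rewrite ge0_integralD//; last 2 first.
  - by move=> x _; rewrite lee_fin sqr_ge0.
  - by apply/measurable_EFinP/measurable_funX; exact: measurable_funTS.
  apply: lte_add_pinfty; last exact: le_lt_trans PK (ltry _).
  by rewrite integral_cst// mul1e; exact: le_lt_trans BV (ltry _).
pose q x := ((P x)%:E - 16%:E * H x)%E.
have q0 x : G x -> (0 < q x)%E.
  by move=> Gx; rewrite /q sube_gt0 vG//; case: Gx.
have mq : measurable_fun G q by exact: emeasurable_funB.
have Hfin x : G x -> (16%:E * H x \is a fin_num)%E.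
  by move=> [_ /= h]; rewrite ge0_fin_numE//; apply: lt_trans h (ltry _).
have dec : (\int[volume]_(x in G) (P x)%:E =
    \int[volume]_(x in G) q x + \int[volume]_(x in G) (16%:E * H x))%E.
  rewrite -ge0_integralD//; last by move=> x /q0/ltW.
  by apply: eq_integral => x; rewrite inE => Gx; rewrite subeK// Hfin.
have le2 : (\int[volume]_(x in G) (P x)%:E <= \int[volume]_(x in G) (16%:E * H x))%E.
  have mHG' : measurable_fun G H by exact: measurable_funS mH.
  rewrite ge0_integralZl_EFin//.
  rewrite -[leLHS]mul1e (_ : 1%E = (16%:E * 16^-1%:E)%E :> \bar R); last by rewrite -EFinM divff.
  by rewrite -muleA; apply: lee_wpmul2l => //; rewrite lee_fin.
have q_null : (\int[volume]_(x in G) q x = 0)%E.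
  apply/eqP; rewrite eq_le; apply/andP; split; last by apply: integral_ge0 => x /q0/ltW.
  have Ifin : (\int[volume]_(x in G) (16%:E * H x) \is a fin_num)%E.
    rewrite ge0_fin_numE; last exact: integral_ge0.
    apply: (@le_lt_trans _ _ (\int[volume]_(x in G) (P x)%:E)%E).
      by rewrite dec leeDr//; apply: integral_ge0 => x /q0/ltW.
    by rewrite -ge0_fin_numE//; apply: integral_ge0 => x _; rewrite lee_fin.
  by move: le2; rewrite dec -leeBrDr// subee.
have := (@ae_eq_integral_abs _ _ _ volume G mG q mq).1.
rewrite (eq_integral q); last by move=> x; rewrite inE => /q0/ltW/gee0_abs.
move=> /(_ q_null) [A [mA A0 sA]]; exists A; split=> //.
move=> x /= /not_implyP[Fx /negP]; rewrite -ltNge => vx; apply: sA => /= h.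
have Gx : G x by [].
by have := q0 x Gx; rewrite h// ltxx.
Qed.

End mollified_comparison.

(** * The local majorant of a solution *)

Section local_majorant.
Context {R : realType}.
Variables (Omega : set (R3 R)) (u : R3 R -> R3 R) (x0 : R3 R) (S : R).

Local Notation B := (eball x0 S : set (mR3 R)).

Definition gap (x : R3 R) : R := S - enorm (x - x0).

(** The length of [u] on the ball, extended by zero so as to be measurable on the
    whole space. *)
Definition speed : mR3 R -> R := patch (fun=> 0) B (fun y => enorm (u y)).

(** Indicator of the pairs [(x, y)] with [y] in the ball around [x] of half the
    radius that fits; written on pairs so that the integrals over these moving
    balls are measurable in [x]. *)
Definition half_ball : mR3 R * mR3 R -> R :=
  \1_[set z : mR3 R * mR3 R | enorm ((z.2 : R3 R) - (z.1 : R3 R)) < gap z.1 / 2].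

Definition local_mean (x : mR3 R) : \bar R :=
  (\int[volume]_(y in B) (speed y * half_ball (x, y))%:E)%E.

Definition local_energy (x : mR3 R) : \bar R :=
  (\int[volume]_(y in B) (speed y ^+ 2 * inv_sq_dist (x, y) * half_ball (x, y))%:E)%E.

(** The right-hand side of [local_representation] for the radius [gap x / 2], which
    explains [800 = 100 * 2^3]. *)
Definition local_majorant (x : mR3 R) : \bar R :=
  ((800 * `|gap x|^-1 ^+ 3)%:E * local_mean x + 306%:E * local_energy x)%E.

Hypotheses (oO : open Omega) (uL2 : L2_loc Omega u) (uws : very_weak_solution Omega u).
Hypotheses (S0 : 0 < S) (x0O : cball x0 S `<=` Omega).

Let mB : measurable B. Proof. exact: measurable_eball. Qed.

Let BO : B `<=` Omega. Proof. exact: subset_trans (@eball_sub_cball _ x0 S) x0O. Qed.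

Let mu k : measurable_fun B (vcoord k u : mR3 R -> R).
Proof. by case: uL2 => mu _; apply: measurable_funS (mu k); [exact: open_measurable3|exact: BO]. Qed.

Let mspeed : measurable_fun setT speed.
Proof.
apply: (@measurable_restrictT _ _ (mR3 R) (measurableTypeR R) B (fun y => enorm (u y)) mB).1.
exact: measurable_enorm_field.
Qed.

Lemma measurable_speed : measurable_fun setT speed. Proof. exact: mspeed. Qed.

Lemma speed_ge0 y : 0 <= speed y.
Proof. by rewrite /speed /patch; case: ifP => // _; exact: enorm_ge0. Qed.

Lemma speedE y : B y -> speed y = enorm (u y).
Proof. by move=> By; rewrite /speed /patch mem_set. Qed.

Let BV : (volume B <= ((2 * S) ^+ 3)%:E)%E.
Proof. exact: leb3_eball_le (ltW S0). Qed.

Lemma gap_gt0 x : B x <-> 0 < gap x.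
Proof. by rewrite /gap subr_gt0. Qed.

Lemma half_ball_sub x : eball x (gap x / 2) `<=` B.
Proof.
move=> y; rewrite /eball /gap /= => h.
have -> : y - x0 = (y - x) + (x - x0) by rewrite addrA subrK.
apply: le_lt_trans (enormD _ _) _; have := enorm_ge0 (y - x); lra.
Qed.

Lemma half_cball_sub x : B x -> cball x (gap x / 2) `<=` Omega.
Proof.
move=> /gap_gt0 g0 y h; apply: x0O; move: h; rewrite /cball /gap /= => h.
have -> : y - x0 = (y - x) + (x - x0) by rewrite addrA subrK.
rewrite /gap in g0; apply: le_trans (enormD _ _) _; lra.
Qed.

Lemma half_ball_gap_le x y : eball x (gap x / 2) y -> gap x <= 2 * gap y.
Proof.
rewrite /eball /gap /= => h.
have := enormD (y - x) (x - x0); rewrite addrA subrK; lra.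
Qed.

Let mgap : measurable_fun setT (gap : mR3 R -> R).
Proof. by apply: measurable_funB => //; exact: (@measurable_enorm _ _ (mR3 R) id (cst x0)). Qed.

Lemma measurable_gap : measurable_fun setT (gap : mR3 R -> R). Proof. exact: mgap. Qed.

Lemma measurable_half_ball : measurable_fun setT half_ball.
Proof.
apply: measurable_indic.
rewrite (_ : [set _ | _] = setT `&` [set z : mR3 R * mR3 R |
  (0 < gap z.1 / 2 - enorm ((z.2 : R3 R) - (z.1 : R3 R)))%R]).
  apply: measurableI => //; apply: measurable_superlevel; apply: measurable_funB.
    by apply: measurable_funM => //; exact: measurableT_comp.
  by apply: measurable_enorm; [exact: measurable_snd|exact: measurable_fst].
by rewrite setTI; apply/seteqP; split=> z /=; rewrite subr_gt0.
Qed.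

Let mmean_fun : measurable_fun setT (fun z : mR3 R * mR3 R => speed z.2 * half_ball z).
Proof. by apply: measurable_funM; [exact: measurableT_comp|exact: measurable_half_ball]. Qed.

Let menergy_fun : measurable_fun setT (fun z : mR3 R * mR3 R => speed z.2 ^+ 2 * inv_sq_dist z * half_ball z).
Proof.
apply: measurable_funM; last exact: measurable_half_ball.
apply: measurable_funM; last exact: measurable_inv_sq_dist.
by apply: measurable_funX; exact: measurableT_comp.
Qed.

Lemma half_ball_ge0 z : 0 <= half_ball z.
Proof. by rewrite /half_ball indicE. Qed.

Let isd_ge0 z : 0 <= @inv_sq_dist R z.
Proof. by rewrite invr_ge0 sqr_ge0. Qed.

Let energy_density_ge0 z : 0 <= speed z.2 ^+ 2 * inv_sq_dist z * half_ball z.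
Proof. by apply: mulr_ge0; [apply: mulr_ge0; [exact: sqr_ge0|exact: isd_ge0]|exact: half_ball_ge0]. Qed.

Lemma measurable_local_mean : measurable_fun setT local_mean.
Proof.
apply: (@measurable_ge0_parameter_integral _ _ _ volume _ B mB mmean_fun) => z.
by rewrite mulr_ge0 ?speed_ge0 ?half_ball_ge0.
Qed.

Lemma measurable_local_energy : measurable_fun setT local_energy.
Proof.
apply: (@measurable_ge0_parameter_integral _ _ _ volume _ B mB menergy_fun) => z.
exact: energy_density_ge0.
Qed.

Lemma local_mean_ge0 x : (0 <= local_mean x)%E.
Proof. by apply: integral_ge0 => y _; rewrite lee_fin mulr_ge0 ?speed_ge0 ?half_ball_ge0. Qed.

Lemma local_energy_ge0 x : (0 <= local_energy x)%E.
Proof. by apply: integral_ge0 => y _; rewrite lee_fin (energy_density_ge0 (x, y)). Qed.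

Lemma local_majorant_ge0 x : (0 <= local_majorant x)%E.
Proof.
apply: adde_ge0; apply: mule_ge0.
- by rewrite lee_fin; apply: mulr_ge0; [exact: ler0n|rewrite exprn_ge0// invr_ge0 normr_ge0].
- exact: local_mean_ge0.
- by rewrite lee_fin ler0n.
- exact: local_energy_ge0.
Qed.

Lemma measurable_local_majorant : measurable_fun setT local_majorant.
Proof.
apply: emeasurable_funD; last by apply: measurable_funeM; exact: measurable_local_energy.
apply: emeasurable_funM; last exact: measurable_local_mean.
apply/measurable_EFinP; apply: measurable_funM => //; apply: measurable_funX.
rewrite (_ : (fun x => _) = (fun x : mR3 R => `|gap x| `^ (-1))); last first.
  by apply/funext => x; rewrite powR_inv1.
apply: (@measurableT_comp _ _ _ _ _ _ (fun a : R => a `^ (-1))); first exact: measurable_powR.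
exact: measurableT_comp.
Qed.

Let half_ball_integral x (f g : mR3 R -> R) :
  (forall y, eball x (gap x / 2) y -> f y = g y) ->
  (\int[volume]_(y in B) (f y * half_ball (x, y))%:E = \int[volume]_(y in eball x (gap x / 2)) (g y)%:E)%E.
Proof.
move=> fg; rewrite (_ : (fun y => (f y * half_ball (x, y))%:E) =
    fun y => (f y * \1_(eball x (gap x / 2)) y)%:E); last first.
  by apply/funext => y; rewrite /half_ball !indicE; congr ((_ * (nat_of_bool _)%:R)%:E); apply/idP/idP; rewrite !inE.
rewrite integral_mul_indic setIidr; last exact: half_ball_sub.
by apply: eq_integral => y; rewrite inE => /fg ->.
Qed.

Lemma local_meanE x : (local_mean x = \int[volume]_(y in eball x (gap x / 2)) (enorm (u y))%:E)%E.
Proof. by apply: half_ball_integral => y /half_ball_sub; exact: speedE. Qed.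

Lemma local_energyE x : (local_energy x =
  \int[volume]_(y in eball x (gap x / 2)) (enorm (u y) ^+ 2 * inv_sq_dist (x, y))%:E)%E.
Proof.
apply: (@half_ball_integral x (fun y => speed y ^+ 2 * inv_sq_dist (x, y))) => y /half_ball_sub By.
by rewrite speedE.
Qed.

Lemma local_majorant_ge k x d : B x -> 0 < d ->
  (`|\int[volume]_(y in eball x (gap x / 2)) (vcoord k u y * moll d x y)%:E| <= local_majorant x)%E.
Proof.
move=> Bx d0; have g0 := (gap_gt0 x).1 Bx; have r0 : 0 < gap x / 2 by rewrite divr_gt0.
apply: (le_trans (local_representation k oO uL2 uws r0 d0 (half_cball_sub Bx))).
rewrite /local_majorant local_meanE local_energyE gtr0_norm//.
suff -> : 100 * (gap x / 2)^-1 ^+ 3 = 800 * (gap x)^-1 ^+ 3 by [].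
by field; rewrite gt_eqF.
Qed.

Lemma speed_square_finite : exists K : R, (\int[volume]_(x in B) (speed x ^+ 2)%:E <= K%:E)%E.
Proof.
have fin : (\int[volume]_(x in B) (speed x ^+ 2)%:E < +oo)%E.
  case: uL2 => mu' /(_ _ (@compact_cball R x0 S) x0O); apply: le_lt_trans.
  apply: (@le_trans _ _ (\int[volume]_(x in B) (enorm (u x) ^+ 2)%:E)%E).
    rewrite le_eqVlt; apply/orP; left; apply/eqP; apply: eq_integral => x; rewrite inE => Bx.
    by rewrite speedE.
  apply: ge0_subset_integral => //; [exact: measurable_cball| | |].
  - apply/measurable_EFinP/measurable_funX.
    apply: measurable_enorm_field; first exact: measurable_cball.
    by move=> i; apply: measurable_funS (mu' i) => //; exact: open_measurable3.
  - by move=> y _; rewrite lee_fin sqr_ge0.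
  - exact: eball_sub_cball.
exists (fine (\int[volume]_(x in B) (speed x ^+ 2)%:E)%E); rewrite fineK//.
by rewrite ge0_fin_numE//; apply: integral_ge0 => x _; rewrite lee_fin sqr_ge0.
Qed.

Lemma speed_integral_finite : exists2 M : R, 0 <= M & (\int[volume]_(x in B) (speed x)%:E <= M%:E)%E.
Proof.
have [K HK] := speed_square_finite.
have K0 : 0 <= K.
  by rewrite -lee_fin; apply: le_trans HK; apply: integral_ge0 => x _; rewrite lee_fin sqr_ge0.
exists ((2 * S) ^+ 3 + K); first by rewrite addr_ge0// exprn_ge0// mulr_ge0// ltW.
apply: (@le_trans _ _ (\int[volume]_(x in B) (1 + (speed x ^+ 2)%:E))%E).
  apply: ge0_le_integral => //.
  - by move=> x _; rewrite lee_fin speed_ge0.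
  - by apply/measurable_EFinP; exact: measurable_funTS.
  - apply: emeasurable_funD => //; apply/measurable_EFinP/measurable_funX; exact: measurable_funTS.
  - move=> x _; rewrite lee_fin; have := sqr_ge0 (speed x - 1); rewrite sqrrB1.
    have := speed_ge0 x; lra.
rewrite ge0_integralD//; last 2 first.
- by move=> x _; rewrite lee_fin sqr_ge0.
- by apply/measurable_EFinP/measurable_funX; exact: measurable_funTS.
by rewrite EFinD; apply: leeD => //; rewrite integral_cst// mul1e.
Qed.

Section component.
Variables (k : 'I_3) (sigma : R).
Hypothesis sigma1 : `|sigma| = 1.

Let w : mR3 R -> R := fun y => sigma * patch (fun=> 0) B (vcoord k u) y.

Let mw : measurable_fun setT w.
Proof.
apply: measurable_funM => //.
apply: (@measurable_restrictT _ _ (mR3 R) (measurableTypeR R) B (vcoord k u) mB).1.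
exact: mu.
Qed.

Let wE y : B y -> w y = sigma * vcoord k u y.
Proof. by move=> By; rewrite /w /patch mem_set. Qed.

Let w_speed y : `|w y| <= speed y.
Proof.
rewrite /w /speed /patch normrM sigma1 mul1r; case: ifP => _; last by rewrite normr0.
exact: xcoord_le_enorm.
Qed.

Let integrable_w d x : 0 < d -> volume.-integrable B (EFin \o (fun y => w y * moll d x y)).
Proof.
move=> d0; have [M M0 HM] := speed_integral_finite.
have mm := measurable_moll_section d x; have di0 : 0 <= d^-1 ^+ 3 by rewrite exprn_ge0// invr_ge0 ltW.
apply: (@le_integrable _ _ _ _ _ mB _ (fun y => (d^-1 ^+ 3 * speed y)%:E)).
- by apply/measurable_EFinP; apply: measurable_funM; exact: measurable_funTS.
- move=> y By /=; rewrite lee_fin normrM (ger0_norm (moll_ge0 x y d0)).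
  rewrite (ger0_norm (mulr_ge0 di0 (speed_ge0 y))) [leRHS]mulrC.
  by apply: ler_pM; rewrite ?moll_ge0 ?moll_le.
apply/integrableP; split.
  by apply/measurable_EFinP; apply: measurable_funM => //; exact: measurable_funTS.
under eq_integral => y _ do rewrite abse_EFin (ger0_norm (mulr_ge0 di0 (speed_ge0 y))) EFinM.
rewrite ge0_integralZl_EFin//.
- by apply: lte_mul_pinfty; rewrite ?lee_fin//; exact: le_lt_trans HM (ltry _).
- by move=> y _; rewrite lee_fin speed_ge0.
- by apply/measurable_EFinP; exact: measurable_funTS.
Qed.

Let P : mR3 R -> R := fun y => Num.max (w y) 0.
Let N : mR3 R -> R := fun y => Num.max (- w y) 0.

Let mP : measurable_fun setT P. Proof. exact: measurable_maxr. Qed.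

Let mN : measurable_fun setT N.
Proof. by apply: measurable_maxr => //; exact: measurableT_comp. Qed.

Let P0 x : 0 <= P x. Proof. by rewrite /P le_max lexx orbT. Qed.

Let N0 x : 0 <= N x. Proof. by rewrite /N le_max lexx orbT. Qed.

Let Pspeed y : P y <= speed y.
Proof. by rewrite /P ge_max speed_ge0 andbT (le_trans (ler_norm _) (w_speed y)). Qed.

Let near_part x d : B x -> 0 < d ->
  (\int[volume]_(y in eball x (gap x / 2)) (P y * moll d x y)%:E <=
   \int[volume]_(y in B) (N y * moll d x y)%:E + local_majorant x)%E.
Proof.
move=> Bx d0; pose D : set (mR3 R) := eball x (gap x / 2).
have mD : measurable D by exact: measurable_eball.
have DB : D `<=` B by exact: half_ball_sub.
have iw : leb3.-integrable D (EFin \o (fun y => w y * moll d x y)).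
  exact: integrableS (integrable_w x d0).
have s0 : sigma != 0 by rewrite -normr_eq0 sigma1 oner_eq0.
have le1 : (\int[leb3]_(y in D) (w y * moll d x y)%:E <= local_majorant x)%E.
  have iu : leb3.-integrable D (EFin \o (fun y => vcoord k u y * moll d x y)).
    have := integrableZl mD sigma^-1 iw; apply: eq_integrable => // y; rewrite inE => /DB By.
    by rewrite /= -EFinM wE// !mulrA mulVf// mul1r.
  rewrite (_ : (\int[_]_(y in D) _)%E = (sigma%:E * \int[leb3]_(y in D) (vcoord k u y * moll d x y)%:E)%E).
    apply: (le_trans (lee_abs _)); rewrite abseM abse_EFin sigma1 mul1e.
    exact: local_majorant_ge.
  rewrite -integralZl//; apply: eq_integral => y; rewrite inE => /DB By.
  by rewrite wE// -mulrA EFinM.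
have mm := measurable_moll_section d x.
apply: (@le_trans _ _ (\int[leb3]_(y in D) (Num.max (w y * moll d x y) 0)%:E)%E).
  rewrite le_eqVlt; apply/orP; left; apply/eqP; apply: eq_integral => y _.
  by rewrite /P maxr_pMl ?moll_ge0// mul0r.
apply: (le_trans (integral_pos_le_neg mD iw le1)); apply: leeD => //.
apply: (@le_trans _ _ (\int[volume]_(y in D) (N y * moll d x y)%:E)%E).
  rewrite le_eqVlt; apply/orP; left; apply/eqP; apply: eq_integral => y _.
  by rewrite /N maxr_pMl ?moll_ge0// mul0r mulNr.
apply: ge0_subset_integral => //.
- by apply/measurable_EFinP; apply: measurable_funM; exact: measurable_funTS.
- by move=> y _; rewrite lee_fin mulr_ge0// moll_ge0.
Qed.

Let far_part tau M x d : 0 < tau -> tau < gap x -> 0 < d -> 0 <= M ->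
  (\int[volume]_(y in B) (speed y)%:E <= M%:E)%E ->
  (\int[volume]_(y in B `\` eball x (gap x / 2)) (P y * moll d x y)%:E <=
   (d ^+ 4 * (tau / 2)^-1 ^+ 7 * M)%:E)%E.
Proof.
move=> t0 tx d0 M0 HM; have mm := measurable_moll_section d x.
have q0 : 0 <= d ^+ 4 * (tau / 2)^-1 ^+ 7.
  by rewrite mulr_ge0 ?exprn_ge0 ?invr_ge0 ?divr_ge0 ?(ltW t0) ?(ltW d0).
have mE : measurable (B `\` (eball x (gap x / 2) : set (mR3 R))).
  by apply: measurableD => //; exact: measurable_eball.
have msE (E : set (mR3 R)) : measurable_fun E (fun y => (speed y)%:E).
  by apply/measurable_EFinP; exact: measurable_funTS.
rewrite EFinM; apply: (@le_trans _ _ ((d ^+ 4 * (tau / 2)^-1 ^+ 7)%:E * \int[volume]_(y in B) (speed y)%:E)%E).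
  2: by apply: lee_wpmul2l.
apply: (@le_trans _ _ ((d ^+ 4 * (tau / 2)^-1 ^+ 7)%:E *
   \int[volume]_(y in B `\` eball x (gap x / 2)) (speed y)%:E)%E).
  rewrite -ge0_integralZl_EFin//; last by move=> y _; rewrite lee_fin speed_ge0.
  apply: ge0_le_integral => //.
  - by move=> y _; rewrite lee_fin mulr_ge0// moll_ge0.
  - by apply/measurable_EFinP; apply: measurable_funM; exact: measurable_funTS.
  - exact: measurable_funeM.
  move=> y [_ /negP]; rewrite -leNgt => gy.
  rewrite -EFinM lee_fin mulrC; apply: ler_pM; rewrite ?moll_ge0//.
  apply: moll_far_le => //; first by rewrite divr_gt0.
  apply: le_trans gy; lra.
apply: lee_wpmul2l => //; apply: ge0_subset_integral => //.
by move=> y _; rewrite lee_fin speed_ge0.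
Qed.

(** The representation inequality bounds the integral over the half ball; outside
    it, where [moll] is at most [d^4 (tau/2)^-7] if [gap x > tau], the integral
    tends to [0] with [d].  Applied on each [gap > 1/(j+1)]. *)
Lemma ae_component_le_local_majorant :
  {ae volume, forall x, B x -> ((sigma * vcoord k u x)%:E <= 16%:E * local_majorant x)%E}.
Proof.
have [K HK] := speed_square_finite; have [M M0 HM] := speed_integral_finite.
pose F j : set (mR3 R) := B `&` [set x | (j.+1%:R^-1 < gap x)%R].
have mF j : measurable (F j) by apply: measurableI => //; exact: measurable_superlevel.
have wK : (\int[volume]_(x in B) (w x ^+ 2)%:E <= K%:E)%E.
  apply: le_trans HK; apply: ge0_le_integral => //.
  - by move=> x _; rewrite lee_fin sqr_ge0.
  - by apply/measurable_EFinP/measurable_funX; exact: measurable_funTS.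
  - by apply/measurable_EFinP/measurable_funX; exact: measurable_funTS.
  move=> x _; rewrite lee_fin -(real_normK (num_real (w x))).
  by rewrite lerXn2r ?nnegrE ?speed_ge0.
have step j : {ae volume, forall x, F j x -> ((w x)%:E <= 16%:E * local_majorant x)%E}.
  apply: (@ae_le_of_mollified_le _ B w local_majorant _ K mB BV mw wK).
  - by apply: measurable_funTS; exact: measurable_local_majorant.
  - exact: local_majorant_ge0.
  - exact: mF.
  - by move=> x [].
  move=> e e0; pose tau : R := j.+1%:R^-1; have t0 : 0 < tau by rewrite invr_gt0.
  (* as [d <= 1], the far part is at most [d * c] *)
  pose c := (tau / 2)^-1 ^+ 7 * M + 1.
  have c0 : 0 < c by rewrite ltr_wpDl// mulr_ge0// exprn_ge0// invr_ge0 divr_ge0// ltW.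
  exists (Num.min 1 (Num.min (tau / 4) (e / c))).
    by rewrite !lt_min ltr01 !divr_gt0.
  move=> d d0; rewrite !le_min => /and3P[d1 dt de] x [Bx /= tx]; split.
    move=> y [h1 h2 h3]; rewrite /eball /=.
    have h : enorm (y - x) <= 3 * d by apply: enorm_le_of_abs; rewrite /= distrC ltW.
    have -> : y - x0 = (y - x) + (x - x0) by rewrite addrA subrK.
    apply: le_lt_trans (enormD _ _) _; rewrite /gap -/tau in tx; lra.
  pose D : set (mR3 R) := eball x (gap x / 2).
  have mD : measurable D by exact: measurable_eball.
  have DB : D `<=` B by exact: half_ball_sub.
  have mm := measurable_moll_section d x.
  rewrite -[X in (\int[volume]_(y in X) (Num.max (w _) _ * _)%:E <= _)%E](setDUK DB) ge0_integral_setU//; last 4 first.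
  - exact: measurableD.
  - by rewrite setDUK//; apply/measurable_EFinP; apply: measurable_funM; exact: measurable_funTS.
  - by move=> y _; rewrite lee_fin mulr_ge0 ?P0// moll_ge0.
  - by apply/disj_setPS => y [? []].
  rewrite [leRHS]addeA; apply: leeD; first exact: near_part.
  apply: (le_trans (far_part t0 tx d0 M0 HM)); rewrite lee_fin.
  apply: (@le_trans _ _ (d * c)); last by rewrite -ler_pdivlMr.
  have d4 : d ^+ 4 <= d by rewrite -[leRHS]expr1 ler_wiXn2l// ltW.
  rewrite -mulrA; apply: ler_pM => //; rewrite ?exprn_ge0 ?(ltW d0)//.
    by rewrite mulr_ge0// exprn_ge0// invr_ge0 divr_ge0// ltW.
  by rewrite /c lerDl.
have F0 : Filter (almost_everywhere (@volume R)) by exact: ae_filter_ringOfSetsType.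
apply: filterS (ae_foralln step) => x /= h Bx.
have g0 := (gap_gt0 x).1 Bx; rewrite -(wE Bx); apply: (h (Num.truncn (gap x)^-1)); split=> //=.
rewrite -[ltRHS]invrK ltf_pV2 ?posrE ?invr_gt0//; exact: truncnS_gt.
Qed.

End component.

Lemma ae_speed_le_local_majorant :
  {ae volume, forall x, B x -> ((enorm (u x))%:E <= 48%:E * local_majorant x)%E}.
Proof.
have F0 : Filter (almost_everywhere (@volume R)) by exact: ae_filter_ringOfSetsType.
have nm1 : `|-1 : R| = 1 by rewrite normrN1.
have h k : {ae volume, forall x, B x -> ((vcoord k u x)%:E <= 16%:E * local_majorant x)%E /\
    ((- vcoord k u x)%:E <= 16%:E * local_majorant x)%E}.
  apply: filterS2 (ae_component_le_local_majorant k (normr1 _)) (ae_component_le_local_majorant k nm1) => x.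
  by rewrite mul1r mulN1r => a b Bx; split; [exact: a|exact: b].
apply: filterS3 (h ord0) (h (inord 1)) (h (inord 2)) => x /=.
move=> + + + Bx => /(_ Bx)[+ +] /(_ Bx)[+ +] /(_ Bx)[+ +].
case: (local_majorant x) (local_majorant_ge0 x) => [m|_ *|//]; last first.
  by rewrite mulry gtr0_sg// mul1e leey.
  rewrite -!EFinM !lee_fin => m0 p0 n0 p1 n1 p2 n2.
  have nn i : vcoord i u x <= 16 * m -> - vcoord i u x <= 16 * m -> `|vcoord i u x| <= 16 * m.
    by move=> a b; rewrite ler_norml; apply/andP; split=> //; rewrite lerNl.
  have -> : 48 * m = 3 * (16 * m) by ring.
  by apply: enorm_le_of_abs; [exact: (nn ord0)|have := nn (inord 1) p1 n1|have := nn (inord 2) p2 n2];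
    rewrite /vcoord /xcoord !(tnth_nth 0) ?inordK.
Qed.

End local_majorant.

(** * The interior bound *)

Lemma pow3_powR_third (R : realType) (s p : R) : 0 <= s -> (s ^+ 3) `^ (p / 3) = s `^ p.
Proof.
by move=> s0; rewrite -[s ^+ 3]powR_mulrn// -powRrM; congr (_ `^ _); field.
Qed.

(** The weight absorbs the factor [1 / gap] of the majorant, so that an inequality
    with a constant right-hand side holds up to the boundary of the ball, where
    nothing is known of [u]. *)
Definition weighted_speed {R : realType} (u : R3 R -> R3 R) (x0 : R3 R) (S : R) : mR3 R -> R :=
  fun x => `|gap x0 S x| * speed u x0 S x.

Section interior_bound.
Context {R : realType}.
Variables (Omega : set (R3 R)) (u : R3 R -> R3 R) (x0 : R3 R) (S a : R).
Variables (C1 C3 al be : R).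

Local Notation B := (eball x0 S : set (mR3 R)).
Local Notation gap := (gap x0 S).
Local Notation speed := (speed u x0 S).
Local Notation half_ball := (half_ball x0 S).

Hypotheses (oO : open Omega) (uL2 : L2_loc Omega u) (uws : very_weak_solution Omega u).
Hypotheses (S0 : 0 < S) (x0O : cball x0 S `<=` Omega).
Hypotheses (a0 : 0 < a) (a1 : a <= 1).
Hypothesis weak_u : forall s, 0 < s ->
  (leb3 (Omega `&` [set x | (s < enorm (u x))%R]) <= ((a / s) `^ 3)%:E)%E.

Let mB : measurable B. Proof. exact: measurable_eball. Qed.

Let BV : (volume B <= ((2 * S) ^+ 3)%:E)%E.
Proof. exact: leb3_eball_le (ltW S0). Qed.

Let mspeed : measurable_fun setT speed. Proof. exact: (measurable_speed oO uL2 x0O). Qed.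

Let sp0 y : 0 <= speed y. Proof. exact: speed_ge0. Qed.

Lemma weak_speed s : 0 < s -> (volume (B `&` [set x | (s < speed x)%R]) <= ((a / s) `^ 3)%:E)%E.
Proof.
move=> s0; apply: le_trans (weak_u s0).
have BO : B `<=` Omega by exact: subset_trans (@eball_sub_cball _ x0 S) x0O.
have mO : measurable (Omega : set (mR3 R)) by exact: open_measurable3.
apply: le_measure; rewrite ?inE.
- by apply: measurableI => //; exact: measurable_superlevel.
- have men : measurable_fun (Omega : set (mR3 R)) (fun y : mR3 R => enorm (u y)).
    by apply: measurable_enorm_field => //; case: uL2.
  have := men mO _ (measurable_itv `]s, +oo[); congr (measurable _).
  by apply/seteqP; split=> x /=; rewrite in_itv/= andbT.
by move=> x [Bx /=]; rewrite speedE// => h; split=> //; exact: BO.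
Qed.

Hypotheses (C10 : 0 < C1) (C30 : 0 < C3) (al0 : 0 < al) (be0 : 0 < be).

Hypothesis mean_le : forall E m, measurable E -> E `<=` B -> 0 < m -> (volume E <= m%:E)%E ->
  (\int[volume]_(x in E) (speed x)%:E <= (C1 * a * m `^ (2 / 3))%:E)%E.

Hypothesis majorant_ae : {ae volume, forall x, B x -> ((speed x)%:E <=
  (al * (gap x)^-1 ^+ 3)%:E * local_mean u x0 S x + be%:E * local_energy u x0 S x)%E}.

Local Notation f := (weighted_speed u x0 S).

Lemma weighted_speed_ge0 x : 0 <= f x. Proof. by apply: mulr_ge0; [exact: normr_ge0|exact: sp0]. Qed.

Lemma measurable_weighted_speed : measurable_fun setT f.
Proof.
apply: measurable_funM; last exact: mspeed.
by apply: measurableT_comp => //; exact: measurable_gap.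
Qed.

Let mf : measurable_fun setT f. Proof. exact: measurable_weighted_speed. Qed.

Let isd_ge0 z : 0 <= @inv_sq_dist R z.
Proof. by rewrite invr_ge0 sqr_ge0. Qed.

Let m_isd x : measurable_fun setT (fun y : mR3 R => inv_sq_dist (x, y)).
Proof. exact: (measurableT_comp (measurable_inv_sq_dist) (pair1_measurable x)). Qed.

Let local_mean_le x : B x -> (local_mean u x0 S x <= (C1 * a * gap x ^+ 2)%:E)%E.
Proof.
move=> Bx; have g0 := (gap_gt0 x0 S x).1 Bx.
rewrite local_meanE.
rewrite (_ : (\int[_]_(y in _) _)%E = (\int[volume]_(y in eball x (gap x / 2)) (speed y)%:E)%E); last first.
  by apply: eq_integral => y; rewrite inE => /half_ball_sub By; rewrite speedE.
have -> : gap x ^+ 2 = (gap x ^+ 3) `^ (2 / 3) by rewrite pow3_powR_third ?(ltW g0)// powR_mulrn// ltW.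
apply: mean_le; rewrite ?exprn_gt0//.
- exact: measurable_eball.
- exact: half_ball_sub.
- have -> : gap x ^+ 3 = (2 * (gap x / 2)) ^+ 3 by congr (_ ^+ 3); field.
  by apply: leb3_eball_le; rewrite divr_ge0// ltW.
Qed.

Let energy_compare x c (g : mR3 R -> R) : 0 <= c -> measurable_fun setT g ->
  (forall y, 0 <= g y) ->
  (forall y, eball x (gap x / 2) y -> c * speed y ^+ 2 <= g y) ->
  (c%:E * local_energy u x0 S x <= \int[volume]_(y in B) (g y * inv_sq_dist (x, y))%:E)%E.
Proof.
move=> c0 mg g0 cg; have mnx : measurable_fun setT (fun y : mR3 R => half_ball (x, y)).
  exact: (measurableT_comp (measurable_half_ball x0 S) (pair1_measurable x)).
have mE : measurable_fun B (fun y : mR3 R => (speed y ^+ 2 * inv_sq_dist (x, y) * half_ball (x, y))%:E).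
  apply/measurable_EFinP/measurable_funTS; apply: measurable_funM; last exact: mnx.
  by apply: measurable_funM; [exact: measurable_funX|exact: m_isd].
have E0 y : 0 <= speed y ^+ 2 * inv_sq_dist (x, y) * half_ball (x, y).
  by apply: mulr_ge0; [apply: mulr_ge0; [exact: sqr_ge0|exact: isd_ge0]|exact: half_ball_ge0].
rewrite /local_energy -ge0_integralZl_EFin//; last by move=> y _; rewrite lee_fin E0.
apply: ge0_le_integral => //.
- by move=> y _; rewrite mule_ge0// lee_fin.
- exact: measurable_funeM.
- by apply/measurable_EFinP/measurable_funTS/measurable_funM => //; exact: m_isd.
move=> y _; rewrite -EFinM lee_fin /half_ball indicE; case: (boolP (_ \in _)) => [|_].
  rewrite inE /= mulr1 mulrA => h; apply: ler_wpM2r; [exact: isd_ge0|exact: cg].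
by rewrite !mulr0; apply: mulr_ge0; [exact: g0|exact: isd_ge0].
Qed.

(** Multiply the majorant by [gap x]: the mean over the half ball is at most
    [C1 a (gap x)^2] by the weak [L^3] bound, and in the energy one factor
    [gap x <= 2 gap y] passes under the integral, where it turns one of the two
    factors [speed y] into [weighted_speed y]. *)
Lemma weighted_speed_subsolution : {ae volume, forall x, B x -> ((f x)%:E <= (al * C1 * a)%:E +
  (2 * be)%:E * \int[volume]_(y in B) (inv_sq_dist (x, y) * (speed y * f y))%:E)%E}.
Proof.
have F0 : Filter (almost_everywhere (@volume R)) by exact: ae_filter_ringOfSetsType.
apply: filterS majorant_ae => x /= h Bx; have g0 := (gap_gt0 x0 S x).1 Bx.
rewrite /weighted_speed gtr0_norm// EFinM.
have g0' : (0 <= (gap x)%:E)%E by rewrite lee_fin ltW.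
apply: (le_trans (lee_wpmul2l g0' (h Bx))).
rewrite ge0_muleDr; last 2 first.
- apply: mule_ge0; last exact: local_mean_ge0.
  by rewrite lee_fin mulr_ge0 ?(ltW al0)// exprn_ge0// invr_ge0 ltW.
- by apply: mule_ge0; [rewrite lee_fin ltW|exact: local_energy_ge0].
apply: leeD.
  apply: (@le_trans _ _ ((gap x)%:E * ((al * (gap x)^-1 ^+ 3)%:E * (C1 * a * gap x ^+ 2)%:E))%E).
    apply: lee_wpmul2l => //; apply: lee_wpmul2l; last exact: local_mean_le.
    by rewrite lee_fin mulr_ge0 ?(ltW al0)// exprn_ge0// invr_ge0 ltW.
  rewrite -!EFinM lee_fin le_eqVlt; apply/orP; left; apply/eqP; field; rewrite gt_eqF//.
rewrite muleCA mulrC EFinM -muleA; apply: lee_wpmul2l; first by rewrite lee_fin ltW.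
apply: (@le_trans _ _ (\int[volume]_(y in B) (2 * (speed y * f y) * inv_sq_dist (x, y))%:E)%E).
  apply: energy_compare; first exact: ltW.
  - by apply: measurable_funM => //; exact: measurable_funM.
  - by move=> y; apply: mulr_ge0 => //; apply: mulr_ge0; [exact: sp0|exact: weighted_speed_ge0].
  move=> y hy; have By := half_ball_sub hy; have gy := (gap_gt0 x0 S y).1 By.
  rewrite /weighted_speed gtr0_norm// expr2 (_ : 2 * _ = 2 * gap y * (speed y * speed y)); last by ring.
  by apply: ler_wpM2r; [apply: mulr_ge0; exact: sp0|exact: half_ball_gap_le].
rewrite -ge0_integralZl_EFin//; last first.
- apply/measurable_EFinP/measurable_funTS; apply: measurable_funM; first exact: m_isd.
  exact: measurable_funM.
- by move=> y _; rewrite lee_fin; apply: mulr_ge0; [exact: isd_ge0|apply: mulr_ge0; [exact: sp0|exact: weighted_speed_ge0]].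
rewrite le_eqVlt; apply/orP; left; apply/eqP; apply: eq_integral => y _.
by rewrite -EFinM; congr _%:E; rewrite /f; ring.
Qed.

Lemma weak_weighted_speed s : 0 < s -> (volume (B `&` [set x | (s < f x)%R]) <= ((S * a / s) `^ 3)%:E)%E.
Proof.
move=> s0; have sS : 0 < s / S by rewrite divr_gt0.
have -> : S * a / s = a / (s / S) by field; rewrite !gt_eqF.
apply: le_trans (weak_speed sS); apply: le_measure; rewrite ?inE.
- by apply: measurableI => //; exact: measurable_superlevel.
- by apply: measurableI => //; exact: measurable_superlevel.
move=> x [Bx /=]; rewrite /weighted_speed => h; split=> //=.
have g0 := (gap_gt0 x0 S x).1 Bx; rewrite gtr0_norm// in h.
rewrite ltr_pdivrMr//; apply: (lt_le_trans h); by rewrite mulrC ler_wpM2l// gerBl enorm_ge0.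
Qed.

Hypothesis square_bound : forall x,
  (\int[volume]_(y in B) (f y * (f y * inv_sq_dist (x, y)))%:E <=
   (C3 * (al * C1 * a) ^+ 2 * ((2 * S) ^+ 3) `^ (1 / 3))%:E)%E.

(** On the smaller ball [gap x > S/3], hence [gap y > S/6] on the half ball around
    [x], where [speed^2 <= 36 weighted_speed^2 / S^2]; the energy is therefore
    bounded by the potential of [weighted_speed^2]. *)
Lemma ae_interior_bound : {ae volume, forall x, eball x0 (2 / 3 * S) x ->
  enorm (u x) <= (3 * (al * C1) + be * (72 * C3 * (al * C1) ^+ 2)) * a / S}.
Proof.
have F0 : Filter (almost_everywhere (@volume R)) by exact: ae_filter_ringOfSetsType.
have Sp : 0 < S := S0.
apply: filterS majorant_ae => x /= h; rewrite /eball /= => hx.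
have Bx : B x by rewrite /eball /=; apply: (lt_trans hx); lra.
have gS : S / 3 < gap x by rewrite /(gap _); lra.
have g0 : 0 < gap x by lra.
have S20 : 0 <= S ^+ 2 / 36 by rewrite divr_ge0 ?sqr_ge0.
have en : ((S ^+ 2 / 36)%:E * local_energy u x0 S x <= (C3 * (al * C1 * a) ^+ 2 * (2 * S))%:E)%E.
  apply: (@le_trans _ _ (\int[volume]_(y in B) ((f y * f y) * inv_sq_dist (x, y))%:E)%E).
    apply: energy_compare => //; first exact: measurable_funM.
    - by move=> y; apply: mulr_ge0; exact: weighted_speed_ge0.
    move=> y hy; have By := half_ball_sub hy; have gy := half_ball_gap_le hy.
    rewrite /weighted_speed gtr0_norm; last by lra.
    have -> : gap y * speed y * (gap y * speed y) = gap y ^+ 2 * speed y ^+ 2 by ring.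
    apply: ler_wpM2r; first exact: sqr_ge0.
    have -> : S ^+ 2 / 36 = (S / 6) ^+ 2 by field.
    by rewrite ler_pXn2r// ?nnegrE; lra.
  have <- : ((2 * S) ^+ 3) `^ (1 / 3) = 2 * S.
    by rewrite pow3_powR_third ?powRr1 ?mulr_ge0 ?(ltW S0).
  apply: le_trans (square_bound x); rewrite le_eqVlt; apply/orP; left; apply/eqP.
  by apply: eq_integral => y _; rewrite mulrA.
have en' : (local_energy u x0 S x <= (72 * C3 * (al * C1 * a) ^+ 2 / S)%:E)%E.
  have p0 : 0 < S ^+ 2 / 36 by rewrite divr_gt0 ?exprn_gt0.
  rewrite -(@lee_pmul2l _ (S ^+ 2 / 36)%:E)//.
  apply: (le_trans en); rewrite -EFinM lee_fin le_eqVlt; apply/orP; left; apply/eqP.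
  by field; rewrite gt_eqF.
have c0 : (0 <= (al * (gap x)^-1 ^+ 3)%:E)%E.
  by rewrite lee_fin mulr_ge0 ?(ltW al0)// exprn_ge0// invr_ge0 ltW.
have b0 : (0 <= be%:E)%E by rewrite lee_fin ltW.
have := le_trans (h Bx) (leeD (lee_wpmul2l c0 (local_mean_le Bx)) (lee_wpmul2l b0 en')).
rewrite speedE// -!EFinM -EFinD lee_fin => /le_trans; apply.
have -> : al * (gap x)^-1 ^+ 3 * (C1 * a * gap x ^+ 2) = al * C1 * a / gap x by field; rewrite gt_eqF.
have A0 : 0 < al * C1 by rewrite mulr_gt0.
have -> : (3 * (al * C1) + be * (72 * C3 * (al * C1) ^+ 2)) * a / S =
  3 * (al * C1) * a / S + be * (72 * C3 * (al * C1) ^+ 2) * a / S by ring.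
apply: lerD.
  have -> : 3 * (al * C1) * a / S = al * C1 * a / (S / 3) by field; rewrite gt_eqF.
  by apply: ler_wpM2l; [rewrite mulr_ge0 ?(ltW A0) ?(ltW a0)|rewrite lef_pV2 ?posrE ?divr_gt0// ltW].
have -> : be * (72 * C3 * (al * C1 * a) ^+ 2 / S) =
  be * (72 * C3 * (al * C1) ^+ 2) / S * a * a by ring.
have -> : be * (72 * C3 * (al * C1) ^+ 2) * a / S =
  be * (72 * C3 * (al * C1) ^+ 2) / S * a by ring.
rewrite ler_piMr// mulr_ge0 ?(ltW a0)// divr_ge0 ?(ltW S0)// mulr_ge0 ?(ltW be0)//.
by rewrite mulr_ge0 ?sqr_ge0// mulr_ge0// ltW.
Qed.

End interior_bound.

(** * Norms and conclusion *)

Section weak_norm.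
Context {R : realType}.
Implicit Types (Omega B : set (R3 R)) (u : R3 R -> R3 R).

Lemma weak_L3_norm_ge0 Omega u : (0 <= weak_L3_norm Omega u)%E.
Proof.
apply: (@le_trans _ _ (1%:E * leb3 (Omega `&` [set x | (1 < enorm (u x))%R]) `^ 3^-1)%E).
  by rewrite mul1e poweR_ge0.
by apply: ereal_sup_ubound; exists 1 => //=; exact: ltr01.
Qed.

Lemma weak_L3_normP Omega u (a : R) : 0 <= a -> (weak_L3_norm Omega u <= a%:E)%E ->
  forall s, 0 < s ->
  (leb3 (Omega `&` [set x | (s < enorm (u x))%R]) <= ((a / s) `^ 3)%:E)%E.
Proof.
move=> a0 ua s s0; set E := (leb3 _).
have h : (s%:E * E `^ 3^-1 <= a%:E)%E.
  by apply: le_trans ua; apply: ereal_sup_ubound; exists s.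
have E0 : (0 <= E)%E by exact: measure_ge0.
move: E0 h; case: E => [p| |//] => [|_].
  rewrite lee_fin poweR_EFin -EFinM !lee_fin => p0 h.
  have -> : p = (p `^ 3^-1) `^ 3 by rewrite -powRrM mulVf// powRr1.
  rewrite ge0_ler_powR ?nnegrE ?powR_ge0 ?divr_ge0 ?(ltW s0)//.
  by rewrite ler_pdivlMr// mulrC.
rewrite poweRyr ?invr_eq0 ?pnatr_eq0//.
by rewrite mulry gtr0_sg// mul1e leye_eq.
Qed.

Lemma Linfty_norm_le B u (M : R) : 0 <= M ->
  {ae (@leb3 R), forall x, B x -> enorm (u x) <= M} -> (Linfty_norm B u <= M%:E)%E.
Proof.
move=> M0 h; rewrite /Linfty_norm unlock; case: ifP => _; last by rewrite lee_fin.
apply/ess_supP.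
have F0 : Filter (almost_everywhere (@leb3 R)) by exact: ae_filter_ringOfSetsType.
apply: filterS h => x /= hx; rewrite patchE; case: ifPn; last by rewrite abse0 lee_fin.
by rewrite inE => /hx Bx; rewrite abse_EFin lee_fin ger0_norm ?enorm_ge0.
Qed.

End weak_norm.

Section conclusion.
Variable R : realType.
Implicit Types (Omega : set (R3 R)) (u : R3 R -> R3 R).

Lemma ae_bound_of_small_weak_L3_norm : exists2 eps : R, 0 < eps & exists2 C : R, 0 < C &
  forall Omega u x0 r a, open Omega -> L2_loc Omega u -> very_weak_solution Omega u ->
  0 < r -> eball x0 (2 * r) `<=` Omega -> 0 < a -> a <= eps ->
  (weak_L3_norm Omega u <= a%:E)%E ->
  {ae (@leb3 R), forall x, eball x0 r x -> enorm (u x) <= C * a / r}.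
Proof.
have [C1 C10 HC1] := @integral_weak_L3_le _ (mR3 R) R.
have [C2 C20 HC2] := @integral_bound_of_subsolution _ (mR3 R) R volume.
have [C3 C30 HC3] := @riesz_potential_square_le _ (mR3 R) R volume.
(* [48 = 3 * 16]: three components, and the mass [1/16] kept by the mollifier;
   the products stay abstract, being too large to be computed in unary *)
have [al al0 alE] : exists2 al : R, 0 < al & al = 48 * 800.
  by exists (48 * 800); [apply: mulr_gt0; rewrite ltr0n|].
have [be be0 beE] : exists2 be : R, 0 < be & be = 48 * 306.
  by exists (48 * 306); [apply: mulr_gt0; rewrite ltr0n|].
pose kap := 2 * be; have kap0 : 0 < kap by rewrite mulr_gt0.
exists (Num.min 1 (2 * (kap * C2))^-1).
  by rewrite lt_min ltr01 invr_gt0 !mulr_gt0.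
pose C := 3 * (al * C1) + be * (72 * C3 * (al * C1) ^+ 2).
have C0 : 0 < C.
  have p0 : 0 < al * C1 by rewrite mulr_gt0.
  apply: addr_gt0; first by rewrite mulr_gt0.
  apply: mulr_gt0 => //; apply: mulr_gt0; last exact: exprn_gt0.
  by apply: mulr_gt0 => //; rewrite ltr0n.
exists C => // Omega u x0 r a oO uL2 uws r0 x0O a0; rewrite le_min => /andP[a1 akap] ua.
have weak_u := weak_L3_normP (ltW a0) ua.
pose S := 3 / 2 * r; have S0 : 0 < S by rewrite mulr_gt0// divr_gt0.
have cO : cball x0 S `<=` Omega.
  move=> x hx; apply: x0O; rewrite /eball /=; apply: le_lt_trans hx _.
  by rewrite /S ltr_pM2r// ltr_pdivrMr// -natrM ltr_nat.
have Sv : 0 < (2 * S) ^+ 3 by rewrite exprn_gt0// mulr_gt0.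
pose B : set (mR3 R) := eball x0 S.
have mB : measurable B by exact: measurable_eball.
have BV : (volume B <= ((2 * S) ^+ 3)%:E)%E by exact: leb3_eball_le (ltW S0).
have msp := measurable_speed oO uL2 cO.
have sp0 := speed_ge0 u x0 S.
have wsp := weak_speed oO uL2 cO weak_u.
have mean_le := HC1 volume B _ a mB msp sp0 a0 wsp.
have majorant : {ae volume, forall x, B x -> ((speed u x0 S x)%:E <=
  (al * (gap x0 S x)^-1 ^+ 3)%:E * local_mean u x0 S x + be%:E * local_energy u x0 S x)%E}.
  have F0 : Filter (almost_everywhere (@volume R)) by exact: ae_filter_ringOfSetsType.
  apply: filterS (ae_speed_le_local_majorant oO uL2 uws S0 cO) => x /= h Bx.
  have g0 := (gap_gt0 x0 S x).1 Bx.
  rewrite speedE//; apply: (le_trans (h Bx)); rewrite /local_majorant gtr0_norm//.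
  rewrite ge0_muleDr.
  - by rewrite !muleA -!EFinM mulrA alE beE.
  - apply: mule_ge0; last exact: local_mean_ge0.
    by rewrite lee_fin mulr_ge0 ?ler0n// exprn_ge0// invr_ge0 ltW.
  - by apply: mule_ge0; [rewrite lee_fin ler0n|exact: local_energy_ge0].
have sub := weighted_speed_subsolution oO uL2 cO al0 be0 mean_le majorant.
have mf := measurable_weighted_speed oO uL2 cO.
have f0 := weighted_speed_ge0 u x0 S.
have wf := weak_weighted_speed oO uL2 S0 cO weak_u.
have M0 : 0 < al * C1 * a by rewrite !mulr_gt0.
have bnd := HC2 inv_sq_dist B _ _ _ _ _ _ inv_sq_dist_riesz mB BV msp sp0 a0 wsp mf f0
  (mulr_gt0 S0 a0) wf kap (ltW kap0) _ (ltW M0) sub.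
have small : kap * C2 * a <= 2^-1.
  rewrite invfM in akap.
  rewrite mulrC -ler_pdivlMr ?mulr_gt0//; apply: le_trans akap _; lra.
have sq := HC3 inv_sq_dist B _ _ _ inv_sq_dist_riesz mB BV Sv mf f0 M0 (bnd small).
have -> : r = 2 / 3 * S by rewrite /S; field.
have := ae_interior_bound oO uL2 S0 cO a0 a1 C10 C30 al0 be0 mean_le majorant sq.
have F0 : Filter (almost_everywhere (@volume R)) by exact: ae_filter_ringOfSetsType.
apply: filterS => x /= h Bx; apply: (le_trans (h Bx)).
apply: ler_wpM2l; first by rewrite mulr_ge0// ltW.
rewrite lef_pV2 ?posrE//; last by rewrite mulr_gt0// divr_gt0.
by rewrite ler_piMl ?(ltW S0)// ler_pdivrMr// mul1r ler_nat.
Qed.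

(** Sets on which [f] is almost everywhere bounded form an ideal; its cofinal filter
    turns compactness, in the form of [near_covering], into boundedness on [K]. *)
Lemma compact_ae_bounded (f : R3 R -> R) K : compact K ->
  (forall x, K x -> exists2 U, nbhs x U & exists M : R, {ae (@leb3 R), forall y, U y -> f y <= M}) ->
  exists M : R, {ae (@leb3 R), forall y, K y -> f y <= M}.
Proof.
move=> /compact_near_coveringP cK loc.
have F0 : Filter (almost_everywhere (@leb3 R)) by exact: ae_filter_ringOfSetsType.
pose bounded (A : set (R3 R)) := exists M : R, {ae (@leb3 R), forall y, A y -> f y <= M}.
have bounded0 : bounded set0 by exists 0; exact: aeW.
have boundedU A A' : bounded A -> bounded A' -> bounded (A `|` A').
  move=> [M HM] [M' HM']; exists (Num.max M M'); apply: filterS2 HM HM' => y h h' [/h|/h'] le_y.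
    by rewrite le_max le_y.
  by rewrite le_max le_y orbT.
pose F (P : set (set (R3 R))) := exists2 A, bounded A & forall A', bounded A' -> A `<=` A' -> P A'.
have FF : Filter F.
  split.
  - by exists set0.
  - move=> P Q [A bA AP] [A' bA' AQ]; exists (A `|` A'); first exact: boundedU.
    move=> E bE AE; split; [apply: AP|apply: AQ] => // y Ay; apply: AE; by [left|right].
  - by move=> P Q PQ [A bA AP]; exists A => // E bE AE; apply: PQ; exact: AP.
have [|A [M HM] /(_ A)] := cK _ F (fun A y => A y) FF.
  move=> x /loc[U xU bU]; exists (U, [set A | U `<=` A]).
    by split=> //; exists U.
  by move=> [y A] /= [Uy UA]; exact: UA.
move=> /(_ (ex_intro _ M HM) (@subset_refl _ A)) KA.
by exists M; apply: filterS HM => y h /KA.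
Qed.

Lemma open_eball_sub Omega x : open Omega -> Omega x ->
  exists2 r, 0 < r & eball x (2 * r) `<=` Omega.
Proof.
move=> oO Ox; have : nbhs x Omega by exact: open_nbhs_nbhs.
move=> /nbhs_ballP[e /= e0 he]; exists (e / 2); first by rewrite divr_gt0.
rewrite mulrC divfK// => y /eball_sub_box; rewrite box_ballE => h; exact: he.
Qed.

End conclusion.

Theorem theorem1p3 (R : realType) :
  exists eps3 C : R, [/\ 0 < eps3, 0 < C &
    forall (Omega : set (R3 R)) (u : R3 R -> R3 R),
      open Omega ->
      L2_loc Omega u ->
      very_weak_solution Omega u ->
      (weak_L3_norm Omega u <= eps3%:E)%E ->
      Linfty_loc Omega u /\
      forall (x0 : R3 R) (r : R), 0 < r -> eball x0 (2 * r) `<=` Omega ->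
        (Linfty_norm (eball x0 r) u <= (C / r)%:E * weak_L3_norm Omega u)%E].
Proof.
have [eps eps0 [C C0 H]] := ae_bound_of_small_weak_L3_norm R.
exists (eps / 2), C; split=> //; first by rewrite divr_gt0.
move=> Omega u oO uL2 uws ueps; split.
  split; first by case: uL2.
  move=> K cK KO; have [M HM] : exists M : R, {ae (@leb3 R), forall x, K x -> enorm (u x) <= M}.
    apply: compact_ae_bounded => // x /KO/(open_eball_sub oO)[r r0 rO].
    exists (eball x r); first by apply: open_nbhs_nbhs; split; [exact: open_eball|rewrite /eball /= subrr enorm0].
    exists (C * (eps / 2) / r); apply: (H Omega u x r (eps / 2)) ueps => //.
      by rewrite divr_gt0.
    by rewrite ler_pdivrMr// ler_peMr ?ler1n// ltW.
  apply: (@le_lt_trans _ _ (Num.max M 0)%:E); last exact: ltry.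
  apply: Linfty_norm_le; first by rewrite le_max lexx orbT.
  have F0 : Filter (almost_everywhere (@leb3 R)) by exact: ae_filter_ringOfSetsType.
  by apply: filterS HM => x h Kx; rewrite le_max h.
move=> x0 r r0 rO.
have [n Nn] : exists n : R, weak_L3_norm Omega u = n%:E.
  have := weak_L3_norm_ge0 Omega u; move: ueps.
  by case: (weak_L3_norm Omega u) => [n _ _|//|//]; exists n.
have n0 : 0 <= n by rewrite -lee_fin -Nn weak_L3_norm_ge0.
have ne : n <= eps / 2 by rewrite -lee_fin -Nn.
rewrite Nn -EFinM; apply/lee_addgt0Pr => e e0.
pose t := Num.min (eps / 2) (e * r / C).
have t0 : 0 < t by rewrite lt_min !divr_gt0// mulr_gt0.
have te : t <= eps / 2 by rewrite ge_min lexx.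
have tr : t <= e * r / C by rewrite ge_min lexx orbT.
have nt0 : 0 < n + t by rewrite ltr_wpDl.
apply: (@le_trans _ _ (C * (n + t) / r)%:E).
  apply: Linfty_norm_le; first by rewrite divr_ge0 ?(ltW r0)// mulr_ge0 ?ltW.
  apply: (H Omega u x0 r (n + t) oO uL2 uws r0 rO nt0).
    by rewrite (le_trans (lerD ne te))// -splitr.
  by rewrite Nn lee_fin lerDl ltW.
rewrite -EFinD lee_fin mulrDr mulrDl (mulrAC C n); apply: lerD => //.
rewrite ler_pdivrMr// mulrC -ler_pdivlMr//.
Qed.
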